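(* Let $E$ be a Bryant surface end with Bryant representation $F=\begin{pmatrix}A&B\\C&D\end{pmatrix}$ (defined on the universal cover of $\Omega^*$). Then there exists a unique polynomial $P_E(X,Y)\in\mathbb C[X,Y]$ such that, for all couples $(\mathcal C,\mathcal D)$ of distinct points in $\overline{\mathbb C}$, the flux through $E$ of the Killing field associated to the translation along the geodesic $(\mathcal C,\mathcal D)$ is $$\operatorname{Re}\left(\frac{P_E(\mathcal C,\mathcal D)}{\mathcal C-\mathcal D}\right)$$ and the flux through $E$ of the Killing field associated to the rotation about the geodesic $(\mathcal C,\mathcal D)$ is $$-\operatorname{Im}\left(\frac{P_E(\mathcal C,\mathcal D)}{\mathcal C-\mathcal D}\right).$$ This polynomial $P_E$ is symmetric, and $P_E(X,Y)=\varphi_2XY+\varphi_1(X+Y)+\varphi_0$ where $\varphi_0=4\pi\operatorname{Res}(D\,dC-C\,dD)$, $\varphi_1=4\pi\operatorname{Res}(C\,dB-D\,dA)$ and $\varphi_2=4\pi\operatorname{Res}(B\,dA-A\,dB)$. (The polynomial $\Pi_E(X)=P_E(X,X)=\varphi_2X^2+2\varphi_1X+\varphi_0$ is called the flux polynomial of $E$.)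
   Context: Hyperbolic space is $\mathbb H^3=\{(\zeta,w)\in\mathbb C\times\mathbb R: w>0\}$, $\zeta=u+iv$, with metric $\langle\cdot,\cdot\rangle=(|d\zeta|^2+dw^2)/w^2$ and orientation $du\wedge dv\wedge dw$; its asymptotic boundary is identified with $\overline{\mathbb C}=\mathbb C\cup\{\infty\}$. For distinct $\mathcal A,\mathcal B\in\overline{\mathbb C}$, $(\mathcal A,\mathcal B)$ is the oriented geodesic from $\mathcal A$ to $\mathcal B$. A Bryant surface is a surface of constant mean curvature $1$ in $\mathbb H^3$ (mean curvature $=$ half the trace of the second fundamental form). $\Omega$ is a neighbourhood of $0$ in $\mathbb C$ and $\Omega^*=\Omega\setminus\{0\}$. A Bryant surface end $E$ is given by a conformal immersion $X=(\zeta,w):\Omega^*\to\mathbb H^3$ of constant mean curvature $1$ (the puncture $0$ corresponding to the end), the orientation induced by $X$ being the one induced by the mean curvature vector $\vec H$. A Bryant representation of $E$ is a holomorphic map $F=\begin{pmatrix}A&B\\C&D\end{pmatrix}$ from the universal cover of $\Omega^*$ to $\mathrm{SL}_2(\mathbb C)$ with $dA\,dD-dB\,dC=0$ and $\zeta=\frac{\bar A C+\bar B D}{|A|^2+|B|^2}$, $w=\frac1{|A|^2+|B|^2}$. The one-forms $B\,dA-A\,dB$, $C\,dB-D\,dA$, $D\,dC-C\,dD$ are single-valued holomorphic on $\Omega^*$; $\operatorname{Res}$ denotes the residue at $0$, i.e. $\frac1{2\pi i}$ times the integral over a small positively oriented loop around $0$. Killing fields: if $\Phi_t$ is the translation of (signed)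 distance $t$ along $(\mathcal A,\mathcal B)$, the Killing field associated to the translation is defined by $\frac{d\Phi_t}{dt}=Y(\Phi_t)$ (for $(0,\infty)$: $Y(\zeta,w)=(\zeta,w)$). If $R_\theta$ is the rotation of angle $\theta$ in the direct sense about $(\mathcal A,\mathcal B)$, the Killing field associated to the rotation is defined by $\frac{dR_\theta}{d\theta}=Y(R_\theta)$ (for $(0,\infty)$: $Y(\zeta,w)=(i\zeta,0)$; the direct sense in general is obtained by conjugating with orientation-preserving isometries). Flux of a Killing field $Y$ through $E$: $\varphi=\int_\Gamma\langle\eta,Y\rangle-2\int_K\langle\nu,Y\rangle$, where $\Gamma$ is a generator of $\pi_1(E)$, $K$ a topological disk with boundary $\Gamma$, $\eta$ the unit conormal to $\Gamma$ pointing towards the asymptotic boundary of the end; $\Gamma$ is oriented so that $(\Gamma,\eta,-\vec H)$ is positively oriented, and $\nu$ is the unit normal to $K$ inducing this same orientation on $\Gamma$. It does not depend on the choices of $\Gamma$ and $K$. Convention: when $\mathcal C$ or $\mathcal D$ is $\infty$, the fraction $\frac{P_E(\mathcal C,\mathcal D)}{\mathcal C-\mathcal D}$ is understood as its limit; e.g. for $P_E=\varphi_2XY+\varphi_1(X+Y)+\varphi_0$ it is $\varphi_2\mathcal D+\varphi_1$ if $\mathcal C=\infty$ and $-(\varphi_2\mathcal C+\varphi_1)$ if $\mathcal D=\infty$. *)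

(* Defs.v *)
From Stdlib Require Import Reals.
From Coquelicot Require Import Coquelicot.
Set Implicit Arguments.
Open Scope R_scope.

Definition punctured (Om : C -> Prop) (z : C) : Prop := Om z /\ z <> RtoC 0.

Definition cis (t : R) : C := (cos t, sin t).

Definition holomorphic_on (U : C -> Prop) (f : C -> C) : Prop :=
  forall s, U s -> ex_derive (K := C_AbsRing) (V := C_NormedModule) f s.

(* Paths and homotopies are total continuous functions of real parameters; a
   map on a closed parameter interval extends continuously by clamping. *)
Definition path_connected (U : C -> Prop) : Prop :=
  forall a b, U a -> U b -> exists c : R -> C,
    (forall t, continuous c t) /\ c 0 = a /\ c 1 = b /\
    (forall t, 0 <= t <= 1 -> U (c t)).

Definition loop_in (U : C -> Prop) (g : R -> C) : Prop :=
  forall t, continuous g t /\ g (t + 2 * PI) = g t /\ U (g t).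

Definition freely_homotopic (U : C -> Prop) (g0 g1 : R -> C) : Prop :=
  exists h : R -> R -> C,
    (forall q : R * R, continuous (fun q => h (fst q) (snd q)) q) /\
    (forall s, 0 <= s <= 1 -> forall t, h s (t + 2 * PI) = h s t /\ U (h s t)) /\
    (forall t, h 0 t = g0 t) /\ (forall t, h 1 t = g1 t).

Definition simply_connected (U : C -> Prop) : Prop :=
  (exists a, U a) /\ path_connected U /\
  (forall g, loop_in U g -> exists a, freely_homotopic U g (fun _ => a)).

(* V is evenly covered: p^{-1}(V) is the disjoint union of sheets, the sheet of
   index i being the image of the holomorphic section sigma i of p over V. *)
Definition evenly_covered (U : C -> Prop) (p : C -> C) (V : C -> Prop) : Prop :=
  exists (I : Type) (sigma : I -> C -> C),
    (forall i, holomorphic_on V (sigma i) /\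
       forall z, V z -> U (sigma i z) /\ p (sigma i z) = z) /\
    (forall s, U s -> V (p s) -> exists! i, sigma i (p s) = s).

(* The universal cover of a plane domain W is conformally a plane domain U, by
   uniformization.  For W a punctured simply
   connected domain one may take U = exp^{-1}(W) and p = exp. *)
Definition universal_cover (U : C -> Prop) (p : C -> C) (W : C -> Prop) : Prop :=
  open U /\ simply_connected U /\ holomorphic_on U p /\
  (forall s, U s -> W (p s)) /\
  (forall z, W z -> exists s, U s /\ p s = z) /\
  (forall z, W z -> exists V : C -> Prop,
     open V /\ V z /\ (forall z', V z' -> W z') /\ evenly_covered U p V).

(* (zeta, w); the same type is used for points and for tangent vectors, with
   coordinates (u, v, w), and points of H^3 satisfy 0 < w. *)
Definition vec : Type := (C * R)%type.

Definition cu (a : vec) : R := Re (fst a).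
Definition cv (a : vec) : R := Im (fst a).
Definition cw (a : vec) : R := snd a.
Definition mkvec (u v w : R) : vec := ((u, v), w).

Definition vadd (a b : vec) : vec := mkvec (cu a + cu b) (cv a + cv b) (cw a + cw b).
Definition vscal (t : R) (a : vec) : vec := mkvec (t * cu a) (t * cv a) (t * cw a).

Definition dot (a b : vec) : R := cu a * cu b + cv a * cv b + cw a * cw b.
Definition cross (a b : vec) : vec :=
  mkvec (cv a * cw b - cw a * cv b)
        (cw a * cu b - cu a * cw b)
        (cu a * cv b - cv a * cu b).

(* Positive exactly when (a, b, c) is positive for du /\ dv /\ dw. *)
Definition det3 (a b c : vec) : R := dot (cross a b) c.

Definition hdot (q a b : vec) : R := dot a b / (cw q) ^ 2.

(* The unit vector (for hdot q) orthogonal to a and b such that (a, b, normal)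
   is positive; the metric is conformal to the Euclidean one. *)
Definition unit_normal (q a b : vec) : vec :=
  vscal (cw q / sqrt (dot (cross a b) (cross a b))) (cross a b).

Definition area_element (q a b : vec) : R :=
  sqrt (hdot q a a * hdot q b b - (hdot q a b) ^ 2).

Definition vDerive (f : R -> vec) (t : R) : vec :=
  mkvec (Derive (fun s => cu (f s)) t)
        (Derive (fun s => cv (f s)) t)
        (Derive (fun s => cw (f s)) t).

Definition dx (f : C -> vec) (z : C) : vec := vDerive (fun x => f (x, Im z)) (Re z).
Definition dy (f : C -> vec) (z : C) : vec := vDerive (fun y => f (Re z, y)) (Im z).

(* Class C^2 near z when it holds on a neighbourhood of z. *)
Definition C2_at (f : C -> vec) (z : C) : Prop :=
  ex_diff_n (fun x y => cu (f (x, y))) 2 (Re z) (Im z) /\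
  ex_diff_n (fun x y => cv (f (x, y))) 2 (Re z) (Im z) /\
  ex_diff_n (fun x y => cw (f (x, y))) 2 (Re z) (Im z).

(* Levi-Civita connection of (|dzeta|^2 + dw^2) / w^2 along a map f into H^3:
   the covariant derivative along d_i f of the field d_j f, at the point q, where
   a = d_i f, b = d_j f and ab = d_i d_j f.  For a metric exp(2 h) g_euc it is
   ab + dh(a) b + dh(b) a - (a . b) grad h, here with h = - ln w. *)
Definition cov (q a b ab : vec) : vec :=
  vadd (vadd ab (vscal (- (cw a / cw q)) b))
       (vadd (vscal (- (cw b / cw q)) a) (mkvec 0 0 (dot a b / cw q))).

(* Half the trace, with respect to the first fundamental form, of the second
   fundamental form <cov, N>, where (dx X, dy X, N) is positive. *)
Definition mean_curvature (X : C -> vec) (z : C) : R :=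
  let q := X z in let a := dx X z in let b := dy X z in
  let N := unit_normal q a b in
  let E := hdot q a a in let F := hdot q a b in let G := hdot q b b in
  let L := hdot q (cov q a a (dx (dx X) z)) N in
  let M := hdot q (cov q a b (dx (dy X) z)) N in
  let K := hdot q (cov q b b (dy (dy X) z)) N in
  (G * L - 2 * F * M + E * K) / (2 * (E * G - F ^ 2)).

(* Independent of the choice of unit normal. *)
Definition mean_curvature_vector (X : C -> vec) (z : C) : vec :=
  vscal (mean_curvature X z) (unit_normal (X z) (dx X z) (dy X z)).

(* The orientation induced by the mean curvature vector H is the one for which
   (e1, e2, H) is positive when (e1, e2) is. *)
Definition bryant_end (Om : C -> Prop) (X : C -> vec) : Prop :=
  open Om /\ Om (RtoC 0) /\
  forall z, punctured Om z ->
    let H := mean_curvature_vector X z in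
    0 < cw (X z) /\ C2_at X z /\
    cross (dx X z) (dy X z) <> mkvec 0 0 0 /\
    hdot (X z) (dx X z) (dx X z) = hdot (X z) (dy X z) (dy X z) /\
    hdot (X z) (dx X z) (dy X z) = 0 /\
    hdot (X z) H H = 1 /\
    0 < det3 (dx X z) (dy X z) H.

(* The matrix (A, B; C', D) represents the end X on the cover p : U -> Omega^*. *)
Definition bryant_representation (U : C -> Prop) (p : C -> C) (X : C -> vec)
    (A B C' D : C -> C) : Prop :=
  holomorphic_on U A /\ holomorphic_on U B /\
  holomorphic_on U C' /\ holomorphic_on U D /\
  forall s, U s ->
    (A s * D s - B s * C' s)%C = RtoC 1 /\
    (C_derive A s * C_derive D s - C_derive B s * C_derive C' s)%C = RtoC 0 /\
    let n := Cmod (A s) ^ 2 + Cmod (B s) ^ 2 in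
    X (p s) = (((Cconj (A s) * C' s + Cconj (B s) * D s) / RtoC n)%C, 1 / n).

Definition circle_integral (f : C -> C) (r : R) : C :=
  RInt (V := C_R_CompleteNormedModule)
    (fun t => f (RtoC r * cis t) * (Ci * RtoC r * cis t))%C 0 (2 * PI).

Definition is_residue (f : C -> C) (rho : C) : Prop :=
  exists r0, 0 < r0 /\ forall r, 0 < r < r0 ->
    (circle_integral f r / (RtoC 2 * RtoC PI * Ci))%C = rho.

(* The one-form omega(s) ds on U is the pull-back by p of a single-valued
   holomorphic one-form f(z) dz on Omega^*, whose residue at 0 is rho. *)
Definition form_residue (Om : C -> Prop) (U : C -> Prop) (p : C -> C)
    (omega : C -> C) (rho : C) : Prop :=
  exists f : C -> C,
    holomorphic_on (punctured Om) f /\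
    (forall s, U s -> omega s = (f (p s) * C_derive p s)%C) /\
    is_residue f rho.

Inductive Cbar : Type := Fin (z : C) | Inf.

Record mat2 : Type := Mat2 { m11 : C; m12 : C; m21 : C; m22 : C }.

Definition det2 (g : mat2) : C := (m11 g * m22 g - m12 g * m21 g)%C.
Definition adj2 (g : mat2) : mat2 := Mat2 (m22 g) (- m12 g)%C (- m21 g)%C (m11 g).

(* The orientation-preserving isometry of H^3 extending the Moebius
   transformation z |-> (a z + b) / (c z + d) of the boundary, for any invertible
   matrix (not necessarily unimodular). *)
Definition poincare (g : mat2) (q : vec) : vec :=
  let zeta := fst q in let w := snd q in
  let cd := (m21 g * zeta + m22 g)%C in
  let n := Cmod cd ^ 2 + Cmod (m21 g) ^ 2 * w ^ 2 in
  ((((m11 g * zeta + m12 g) * Cconj cd + m11 g * Cconj (m21 g) * RtoC (w ^ 2))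
      / RtoC n)%C,
   Cmod (det2 g) * w / n).

(* A Moebius transformation sending 0 to a and infinity to b, when a <> b. *)
Definition to_geodesic (a b : Cbar) : mat2 :=
  match a, b with
  | Fin a, Fin b => Mat2 b a (RtoC 1) (RtoC 1)
  | Fin a, Inf => Mat2 (RtoC 1) a (RtoC 0) (RtoC 1)
  | Inf, Fin b => Mat2 b (RtoC 1) (RtoC 1) (RtoC 0)
  | Inf, Inf => Mat2 (RtoC 1) (RtoC 0) (RtoC 0) (RtoC 1)
  end.

(* Isometries of H^3 moved from the oriented geodesic (0, infinity) to (a, b); the
   adjugate induces the inverse isometry. *)
Definition conjugate_to (a b : Cbar) (phi : vec -> vec) (q : vec) : vec :=
  poincare (to_geodesic a b) (phi (poincare (adj2 (to_geodesic a b)) q)).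

Definition translation (a b : Cbar) (t : R) : vec -> vec :=
  conjugate_to a b (fun q => vscal (exp t) q).
Definition rotation (a b : Cbar) (t : R) : vec -> vec :=
  conjugate_to a b (fun q => ((cis t * fst q)%C, snd q)).

(* The field Y with d Phi_t / dt = Y(Phi_t), for a one-parameter group Phi. *)
Definition killing_field (Phi : R -> vec -> vec) (q : vec) : vec :=
  vDerive (fun t => Phi t q) 0.

Definition plane_velocity (g : R -> C) (t : R) : C :=
  (Derive (fun s => Re (g s)) t, Derive (fun s => Im (g s)) t).

Definition pushforward (X : C -> vec) (z xi : C) : vec :=
  vadd (vscal (Re xi) (dx X z)) (vscal (Im xi) (dy X z)).

Definition plane_det (a b : C) : R := Re a * Im b - Im a * Re b.

(* Gamma = X o gamma is a regular closed curve generating pi_1(E): gamma is freely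
   homotopic in Omega^* to a small circle about 0 described eps = +1 or -1 times.
   The conormal eta is the image by dX of the plane field xi.  The puncture lies to
   the left of gamma if eps = 1 and to its right if eps = -1, so eta points towards
   the end when eps * plane_det gamma' xi > 0.  The curve need not be simple. *)
Definition end_generator (Om : C -> Prop) (X : C -> vec) (gamma xi : R -> C) : Prop :=
  loop_in (punctured Om) gamma /\
  (forall t, ex_derive (K := R_AbsRing)
       (V := prod_NormedModule R_AbsRing R_NormedModule R_NormedModule) gamma t /\
     continuous (plane_velocity gamma) t /\ plane_velocity gamma t <> RtoC 0) /\
  exists eps r, (eps = 1 \/ eps = -1) /\ 0 < r /\
    (forall z, Cmod z <= r -> Om z) /\
    freely_homotopic (punctured Om) gamma (fun t => (RtoC r * cis (eps * t))%C) /\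
    forall t,
      let q := X (gamma t) in
      let T := vDerive (fun s => X (gamma s)) t in
      let eta := pushforward X (gamma t) (xi t) in
      hdot q eta eta = 1 /\ hdot q eta T = 0 /\
      0 < eps * plane_det (plane_velocity gamma t) (xi t) /\
      0 < det3 T eta (vscal (-1) (mean_curvature_vector X (gamma t))).

(* A disk of class C^2 (up to the boundary) with boundary Gamma, not necessarily
   embedded, parametrized so that the boundary of the unit disk, described
   counterclockwise, is mapped to Gamma with its orientation. *)
Definition spanning_disk (X : C -> vec) (gamma : R -> C) (kappa : C -> vec) : Prop :=
  (exists rho, 1 < rho /\ forall z, Cmod z < rho -> C2_at kappa z) /\
  (forall z, Cmod z <= 1 -> 0 < cw (kappa z)) /\
  (forall t, kappa (cis t) = X (gamma t)).

Definition conormal_flux (X : C -> vec) (Y : vec -> vec) (gamma xi : R -> C) : R :=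
  RInt (fun t =>
    let q := X (gamma t) in
    let T := vDerive (fun s => X (gamma s)) t in
    hdot q (pushforward X (gamma t) (xi t)) (Y q) * sqrt (hdot q T T)) 0 (2 * PI).

(* The integral over the unit disk is taken in polar coordinates.  The normal nu
   makes (outward conormal, Gamma', nu) positive along the boundary, in the same
   way as (eta, Gamma', H) is positive on the surface.  Where kappa is not an
   immersion, the area element vanishes. *)
Definition disk_flux (Y : vec -> vec) (kappa : C -> vec) : R :=
  RInt (fun r => RInt (fun t =>
    let z := (RtoC r * cis t)%C in
    let q := kappa z in let a := dx kappa z in let b := dy kappa z in
    hdot q (unit_normal q a b) (Y q) * area_element q a b * r) 0 (2 * PI)) 0 1.

(* phi is the flux of Y through the end: the common value for all choices of Gamma
   and K, which exist. *)
Definition is_flux (Om : C -> Prop) (X : C -> vec) (Y : vec -> vec) (phi : R) : Prop :=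
  (exists gamma xi kappa,
     end_generator Om X gamma xi /\ spanning_disk X gamma kappa) /\
  (forall gamma xi kappa,
     end_generator Om X gamma xi -> spanning_disk X gamma kappa ->
     conormal_flux X Y gamma xi - 2 * disk_flux Y kappa = phi).

(* An element of C[X, Y] is its family of coefficients P i j of X^i Y^j, with
   P i j = 0 outside a square i <= n, j <= n. *)
Definition supported (n : nat) (P : nat -> nat -> C) : Prop :=
  forall i j, (n < i)%nat \/ (n < j)%nat -> P i j = RtoC 0.

(* Does not depend on n as long as P is supported by n. *)
Definition eval (n : nat) (P : nat -> nat -> C) (x y : C) : C :=
  sum_n (fun i => sum_n (fun j => P i j * x ^ i * y ^ j)%C n) n.

(* phi2 X Y + phi1 (X + Y) + phi0 *)
Definition symmetric_biaffine (phi0 phi1 phi2 : C) (i j : nat) : C :=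
  match i, j with
  | O, O => phi0
  | S O, O | O, S O => phi1
  | S O, S O => phi2
  | _, _ => RtoC 0
  end.

Definition Cinfinity (Q : C -> Prop) : Prop := exists M, forall z, M < Cmod z -> Q z.

(* q is the value f(c, d) / (c - d), understood as a limit when c or d is Inf. *)
Definition is_quotient (f : C -> C -> C) (c d : Cbar) (q : C) : Prop :=
  match c, d with
  | Fin c, Fin d => q = (f c d / (c - d))%C
  | Inf, Fin d => filterlim (fun c : C => (f c d / (c - d))%C) Cinfinity (locally q)
  | Fin c, Inf => filterlim (fun d : C => (f c d / (c - d))%C) Cinfinity (locally q)
  | Inf, Inf => False
  end.

Definition is_flux_polynomial (Om : C -> Prop) (X : C -> vec)
    (P : nat -> nat -> C) : Prop :=
  exists n, supported n P /\
    forall c d : Cbar, c <> d ->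
      exists q, is_quotient (eval n P) c d q /\
        is_flux Om X (killing_field (translation c d)) (Re q) /\
        is_flux Om X (killing_field (rotation c d)) (- Im q).

(* Main.v *)
Require Import Defs.
From Stdlib Require Import Reals Lra Lia ClassicalEpsilon FunctionalExtensionality.
From Coquelicot Require Import Coquelicot.
Open Scope R_scope.

(** A quadratic polynomial tau(z) = t0 + t1 z + t2 z^2 is an infinitesimal Moebius
    transformation of the boundary sphere; it extends to a Killing field [killing]
    of the half-space, and every Killing field is of this form. To tau belongs the
    complex [density]
      g = tau(zeta) (conj zeta)_z / w^2 + tau'(zeta) w_z / w - (tau''/2) zeta_z
    of an immersion X = (zeta, w), and the whole proof consists in understanding
    the one-form g dz on the punctured domain.

    The form g dz is holomorphic. A conformal immersion of mean curvature 1
    satisfies a semilinear equation for its Laplacian ([bryant_end_equation]), and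
    that equation is exactly what makes g satisfy the Cauchy-Riemann equations
    ([density_cauchy_riemann]). As X is of class C^2, g is of class C^1, so it is
    complex differentiable and its real and imaginary parts define closed forms.

    The flux is an integral of g dz. The closed two-form 2 i_Y vol on the
    half-space has the explicit primitive [volume_potential], so Stokes' formula
    turns the disk term of the flux into a second integral along the boundary loop
    ([disk_flux_boundary]), and the sum of the two integrands is 2 Im(g dz)
    ([density_flux]). Closed forms have equal integrals along freely homotopic
    loops ([closed_form_homotopy]: subdivide the homotopy into squares whose images
    lie in boxes on which the form has a primitive). The orientation conventions
    force the generator to run clockwise around the puncture, whence the flux is
    minus twice the imaginary part of the counterclockwise integral of g dz on a
    small circle ([killing_flux]), that is, a real part of 4 pi times a residue.

    The residues are those of the Bryant representation. With M the product of F
    and its conjugate transpose, M depends on X alone and the matrix of one-forms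
    (d' M) M^-1 = dF F^-1 has entries the three forms of the statement. Hence they
    descend to the punctured domain, where they are the densities of the
    polynomials -1, z and -z^2 ([representation_density]).

    Translation and rotation along the geodesic from c to d correspond to
    tau = (z - c)(z - d)/(c - d) and to i tau ([translation_killing],
    [rotation_killing], through the law [poincare_mul] of composition of
    isometries). Since g is linear in tau, both fluxes are read off from the same
    quotient P(c, d)/(c - d). Uniqueness of P holds because the two fluxes give the
    real and imaginary parts of that quotient for all finite c <> d, and a
    polynomial vanishing off the diagonal vanishes. *)

(** * Smooth functions of two real variables *)

Lemma rder_const (c t : R) : is_derive (fun _ : R => c) t 0.
Proof. apply (is_derive_const (K := R_AbsRing) (V := R_NormedModule)). Qed.

Lemma rder_id (t : R) : is_derive (fun x : R => x) t 1.
Proof. apply (is_derive_id (K := R_AbsRing)). Qed.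

Lemma rder_mult (f g : R -> R) (t l m : R) : is_derive f t l -> is_derive g t m ->
  is_derive (fun s => f s * g s) t (l * g t + f t * m).
Proof. intros. apply (is_derive_mult f g); auto. exact Rmult_comm. Qed.

Lemma rder_plus (f g : R -> R) (t l m : R) : is_derive f t l -> is_derive g t m ->
  is_derive (fun s => f s + g s) t (l + m).
Proof. intros. apply (is_derive_plus f g); auto. Qed.

Lemma rder_minus (f g : R -> R) (t l m : R) : is_derive f t l -> is_derive g t m ->
  is_derive (fun s => f s - g s) t (l - m).
Proof. intros. apply (is_derive_minus f g); auto. Qed.

Lemma rder_opp (f : R -> R) (t l : R) : is_derive f t l -> is_derive (fun s => - f s) t (- l).
Proof. intros. apply (is_derive_opp f); auto. Qed.

Lemma rder_div (f g : R -> R) (t l m : R) : g t <> 0 -> is_derive f t l -> is_derive g t m ->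
  is_derive (fun s => f s / g s) t ((l * g t - f t * m) / g t ^ 2).
Proof. intros. apply (is_derive_div f g); auto. Qed.

Lemma rder_inv (f : R -> R) (t l : R) : f t <> 0 -> is_derive f t l ->
  is_derive (fun s => / f s) t (- l / f t ^ 2).
Proof. intros. apply (is_derive_inv f); auto. Qed.

Lemma rder_pow2 (f : R -> R) (t l : R) : is_derive f t l -> is_derive (fun s => f s ^ 2) t (2 * f t * l).
Proof. intros. evar_last. apply (is_derive_pow f 2); eassumption. simpl. ring. Qed.

Definition px (f : R -> R -> R) (x y : R) : R := Derive (fun z => f z y) x.
Definition py (f : R -> R -> R) (x y : R) : R := Derive (fun z => f x z) y.
Definition open2 (W : R -> R -> Prop) : Prop := forall x y, W x y -> locally_2d W x y.
(** The iterated partial derivatives are only constrained on [W]; on an open [W] this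
    class is stable under the field operations, by induction on [n]. *)
Definition smooth (n : nat) (W : R -> R -> Prop) (f : R -> R -> R) : Prop :=
  forall x y, W x y -> ex_diff_n f n x y.

Lemma smooth_le n m W f : (m <= n)%nat -> smooth n W f -> smooth m W f.
Proof. intros H Hf x y Hw. exact (ex_diff_n_m n m H f x y (Hf x y Hw)). Qed.

Lemma smooth_cont n W f x y : smooth n W f -> W x y -> continuity_2d_pt f x y.
Proof. intros H Hw. specialize (H x y Hw). destruct n; apply H. Qed.

Lemma smooth_px n W f : smooth (S n) W f -> smooth n W (px f).
Proof. intros H x y Hw. apply (H x y Hw). Qed.

Lemma smooth_py n W f : smooth (S n) W f -> smooth n W (py f).
Proof. intros H x y Hw. apply (H x y Hw). Qed.

Lemma smooth_is_px n W f x y : smooth (S n) W f -> W x y ->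
  is_derive (fun z => f z y) x (px f x y).
Proof. intros H Hw. apply Derive_correct, (H x y Hw). Qed.

Lemma smooth_is_py n W f x y : smooth (S n) W f -> W x y ->
  is_derive (fun z => f x z) y (py f x y).
Proof. intros H Hw. apply Derive_correct, (H x y Hw). Qed.

(** On an open set the partial derivatives may be given by formulas: [ex_diff_n] speaks of
    [Derive], which agrees with the formulas near each point. *)
Lemma smooth_intro n W f fx fy : open2 W ->
  (forall x y, W x y -> is_derive (fun z => f z y) x (fx x y)) ->
  (forall x y, W x y -> is_derive (fun z => f x z) y (fy x y)) ->
  smooth 0 W f -> smooth n W fx -> smooth n W fy -> smooth (S n) W f.
Proof.
  intros HW Hx Hy H0 H1 H2 x y Hw. simpl. split; [|split; [|split; [|split]]].
  - apply (H0 x y Hw).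
  - eexists; apply Hx, Hw.
  - eexists; apply Hy, Hw.
  - apply ex_diff_n_ext_loc with fx; [|apply H1, Hw].
    destruct (HW x y Hw) as [d Hd]. exists d. intros u v Hu Hv.
    symmetry. apply is_derive_unique, Hx, Hd; assumption.
  - apply ex_diff_n_ext_loc with fy; [|apply H2, Hw].
    destruct (HW x y Hw) as [d Hd]. exists d. intros u v Hu Hv.
    symmetry. apply is_derive_unique, Hy, Hd; assumption.
Qed.

Lemma smooth_ext n W f g : open2 W -> (forall x y, W x y -> f x y = g x y) ->
  smooth n W f -> smooth n W g.
Proof.
  intros HW He Hf x y Hw. apply ex_diff_n_ext_loc with f; [|apply Hf, Hw].
  destruct (HW x y Hw) as [d Hd]. exists d. intros u v Hu Hv. apply He, Hd; assumption.
Qed.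

Lemma smooth_const n W c : open2 W -> smooth n W (fun _ _ => c).
Proof.
  intros HW. revert c. induction n as [|n IH]; intros c.
  - intros x y _. split; [apply continuity_2d_pt_const|exact I].
  - apply smooth_intro with (fun _ _ => 0) (fun _ _ => 0); auto.
    + intros; apply rder_const.
    + intros; apply rder_const.
    + intros x y _. split; [apply continuity_2d_pt_const|exact I].
Qed.

Lemma smooth_fst n W : open2 W -> smooth n W (fun x _ => x).
Proof.
  intros HW. assert (H0 : smooth 0 W (fun x _ => x)).
  { intros x y _. split; [apply continuity_2d_pt_id1|exact I]. }
  destruct n; auto. apply smooth_intro with (fun _ _ => 1) (fun _ _ => 0); auto using smooth_const.
  - intros; apply rder_id.
  - intros; apply rder_const.
Qed.

Lemma smooth_snd n W : open2 W -> smooth n W (fun _ y => y).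
Proof.
  intros HW. assert (H0 : smooth 0 W (fun _ y => y)).
  { intros x y _. split; [apply continuity_2d_pt_id2|exact I]. }
  destruct n; auto. apply smooth_intro with (fun _ _ => 0) (fun _ _ => 1); auto using smooth_const.
  - intros; apply rder_const.
  - intros; apply rder_id.
Qed.

Lemma smooth_plus n W f g : open2 W -> smooth n W f -> smooth n W g ->
  smooth n W (fun x y => f x y + g x y).
Proof.
  intros HW. revert f g. induction n as [|n IH]; intros f g Hf Hg.
  - intros x y Hw. split; [apply continuity_2d_pt_plus; eapply smooth_cont; eauto|exact I].
  - apply smooth_intro with (fun x y => px f x y + px g x y) (fun x y => py f x y + py g x y); auto.
    + intros x y Hw. apply (is_derive_plus (fun z => f z y) (fun z => g z y));
        eapply smooth_is_px; eauto.
    + intros x y Hw. apply (is_derive_plus (f x) (g x)); eapply smooth_is_py; eauto.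
    + intros x y Hw. split; [apply continuity_2d_pt_plus; eapply smooth_cont; eauto|exact I].
    + apply IH; apply smooth_px; assumption.
    + apply IH; apply smooth_py; assumption.
Qed.

Lemma smooth_mult n W f g : open2 W -> smooth n W f -> smooth n W g ->
  smooth n W (fun x y => f x y * g x y).
Proof.
  intros HW. revert f g. induction n as [|n IH]; intros f g Hf Hg.
  - intros x y Hw. split; [apply continuity_2d_pt_mult; eapply smooth_cont; eauto|exact I].
  - apply smooth_intro with (fun x y => px f x y * g x y + f x y * px g x y)
       (fun x y => py f x y * g x y + f x y * py g x y); auto.
    + intros x y Hw. apply (is_derive_mult (fun z => f z y) (fun z => g z y));
        [eapply smooth_is_px; eauto ..| exact Rmult_comm].
    + intros x y Hw. apply (is_derive_mult (f x) (g x));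
        [eapply smooth_is_py; eauto ..| exact Rmult_comm].
    + intros x y Hw. split; [apply continuity_2d_pt_mult; eapply smooth_cont; eauto|exact I].
    + apply smooth_plus; auto; apply IH; eauto using smooth_px, smooth_le.
    + apply smooth_plus; auto; apply IH; eauto using smooth_py, smooth_le.
Qed.

Lemma smooth_opp n W f : open2 W -> smooth n W f -> smooth n W (fun x y => - f x y).
Proof.
  intros HW Hf. apply smooth_ext with (fun x y => (-1) * f x y); auto.
  - intros; ring.
  - apply smooth_mult; auto using smooth_const.
Qed.

Lemma smooth_minus n W f g : open2 W -> smooth n W f -> smooth n W g ->
  smooth n W (fun x y => f x y - g x y).
Proof. intros. apply smooth_plus; auto using smooth_opp. Qed.

Lemma smooth_inv n W f : open2 W -> (forall x y, W x y -> f x y <> 0) -> smooth n W f ->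
  smooth n W (fun x y => / f x y).
Proof.
  intros HW H0 Hf.
  assert (HC : smooth 0 W (fun x y => / f x y)).
  { intros x y Hw. split; [|exact I].
    apply continuity_2d_pt_inv; auto. eapply smooth_cont; eauto. }
  revert Hf. induction n as [|n IH]; intros Hf; [exact HC|].
  assert (Hi : smooth n W (fun x y => / f x y)) by (apply IH; eauto using smooth_le).
  apply smooth_intro with (fun x y => - px f x y * (/ f x y * / f x y))
       (fun x y => - py f x y * (/ f x y * / f x y)); auto.
  - intros x y Hw. evar_last.
    apply (is_derive_inv (fun z => f z y)); [eapply smooth_is_px; eauto|auto].
    simpl. field; auto.
  - intros x y Hw. evar_last.
    apply (is_derive_inv (f x)); [eapply smooth_is_py; eauto|auto].
    simpl. field; auto.
  - apply smooth_mult; auto using smooth_opp, smooth_px, smooth_mult.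
  - apply smooth_mult; auto using smooth_opp, smooth_py, smooth_mult.
Qed.

Lemma smooth_div n W f g : open2 W -> (forall x y, W x y -> g x y <> 0) ->
  smooth n W f -> smooth n W g -> smooth n W (fun x y => f x y / g x y).
Proof. intros. apply smooth_mult; auto using smooth_inv. Qed.

Lemma smooth_pow n W f k : open2 W -> smooth n W f -> smooth n W (fun x y => f x y ^ k).
Proof.
  intros HW Hf. induction k as [|k IH]; simpl.
  - apply smooth_const, HW.
  - apply smooth_mult; auto.
Qed.

(** Continuity of the partial derivatives gives the total differential. *)
Lemma smooth_differentiable n W f x y : open2 W -> smooth (S n) W f -> W x y ->
  differentiable_pt_lim f x y (px f x y) (py f x y).
Proof.
  intros HW Hf Hw. apply filterdiff_differentiable_pt_lim.
  eapply filterdiff_ext_lin.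
  - apply (is_derive_filterdiff f x y (px f) (py f x y)).
    + destruct (HW x y Hw) as [d Hd]. exists d. intros [u v] [Hu Hv].
      apply (smooth_is_px n W); auto.
    + eapply smooth_is_py; eauto.
    + assert (H : continuity_2d_pt (px f) x y).
      { eapply smooth_cont; [apply smooth_px; eauto|auto]. }
      apply continuity_2d_pt_filterlim in H. exact H.
  - intros [u v]. simpl. reflexivity.
Qed.

Lemma smooth_comp_curve n W f g1 g2 t d1 d2 : open2 W -> smooth (S n) W f ->
  W (g1 t) (g2 t) -> is_derive g1 t d1 -> is_derive g2 t d2 ->
  is_derive (fun s => f (g1 s) (g2 s)) t (px f (g1 t) (g2 t) * d1 + py f (g1 t) (g2 t) * d2).
Proof.
  intros HW Hf Hw H1 H2. apply is_derive_Reals. apply derivable_pt_lim_comp_2d.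
  - eapply smooth_differentiable; eauto.
  - apply is_derive_Reals, H1.
  - apply is_derive_Reals, H2.
Qed.

Lemma smooth_schwarz W f x y : open2 W -> smooth 2 W f -> W x y ->
  px (py f) x y = py (px f) x y.
Proof.
  intros HW Hf Hw.
  apply (Schwarz f x y).
  - destruct (HW x y Hw) as [d Hd]. exists d. intros u v Hu Hv.
    specialize (Hf u v (Hd u v Hu Hv)). repeat split; apply Hf.
  - apply (Hf x y Hw).
  - apply (Hf x y Hw).
Qed.

Lemma continuity_2d_comp f g1 g2 x y : continuity_2d_pt f (g1 x y) (g2 x y) ->
  continuity_2d_pt g1 x y -> continuity_2d_pt g2 x y ->
  continuity_2d_pt (fun u v => f (g1 u v) (g2 u v)) x y.
Proof.
  intros Hf H1 H2 eps. destruct (Hf eps) as [d Hd].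
  destruct (H1 d) as [d1 Hd1]. destruct (H2 d) as [d2 Hd2].
  assert (Hm : 0 < Rmin d1 d2) by (apply Rmin_pos; apply cond_pos).
  exists (mkposreal _ Hm). simpl. intros u v Hu Hv.
  pose proof (Rmin_l d1 d2). pose proof (Rmin_r d1 d2).
  apply Hd; [apply Hd1|apply Hd2]; lra.
Qed.

Lemma continuity_2d_scale a b x y :
  continuity_2d_pt (fun u _ => a * u) x y /\ continuity_2d_pt (fun _ v => b * v) x y.
Proof.
  split; apply continuity_2d_pt_mult;
    auto using continuity_2d_pt_const, continuity_2d_pt_id1, continuity_2d_pt_id2.
Qed.

Lemma open2_scale W a b : open2 W -> open2 (fun x y => W (a * x) (b * y)).
Proof.
  intros HW x y Hw. destruct (HW _ _ Hw) as [d Hd].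
  destruct (continuity_2d_scale a b x y) as [Ca Cb].
  eapply locally_2d_impl; [|apply locally_2d_and; [exact (Ca d)|exact (Cb d)]].
  apply locally_2d_forall. intros u v [Hu Hv]. apply Hd; assumption.
Qed.

Lemma smooth_scale n W f a b : open2 W -> smooth n W f ->
  smooth n (fun x y => W (a * x) (b * y)) (fun x y => f (a * x) (b * y)).
Proof.
  intros HW. revert f.
  assert (C0 : forall f, smooth 0 W f -> smooth 0 (fun x y => W (a * x) (b * y)) (fun x y => f (a * x) (b *
    y))).
  { intros f Hf x y Hw. split; [|exact I]. destruct (continuity_2d_scale a b x y) as [Ca Cb].
    apply (continuity_2d_comp f (fun u _ => a * u) (fun _ v => b * v)); auto.
    eapply smooth_cont; eauto. }
  induction n as [|n IH]; intros f Hf; [exact (C0 f Hf)|].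
  apply smooth_intro with (fun x y => a * px f (a * x) (b * y)) (fun x y => b * py f (a * x) (b * y)).
  - apply open2_scale, HW.
  - intros x y Hw. evar_last.
    apply (is_derive_comp (fun z => f z (b * y)) (fun z => a * z)).
    + eapply smooth_is_px; eauto.
    + apply (is_derive_scal (fun z => z) x a 1), rder_id.
    + simpl. unfold scal; simpl; unfold mult; simpl. ring.
  - intros x y Hw. evar_last.
    apply (is_derive_comp (fun z => f (a * x) z) (fun z => b * z)).
    + eapply smooth_is_py; eauto.
    + apply (is_derive_scal (fun z => z) y b 1), rder_id.
    + simpl. unfold scal; simpl; unfold mult; simpl. ring.
  - apply C0. eauto using smooth_le with arith.
  - apply smooth_mult; [apply open2_scale, HW|apply smooth_const, open2_scale, HW|].
    apply IH, smooth_px, Hf.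
  - apply smooth_mult; [apply open2_scale, HW|apply smooth_const, open2_scale, HW|].
    apply IH, smooth_py, Hf.
Qed.

(** * Closed one-forms and homotopies of loops *)

Definition box (a1 a2 e x y : R) : Prop := Rabs (x - a1) < e /\ Rabs (y - a2) < e.

Definition closed_form (W : R -> R -> Prop) (al be : R -> R -> R) : Prop :=
  open2 W /\ smooth 1 W al /\ smooth 1 W be /\
  forall x y, W x y -> py al x y = px be x y.

Definition primitive_on (B : R -> R -> Prop) (al be F : R -> R -> R) : Prop :=
  forall x y, B x y -> differentiable_pt_lim F x y (al x y) (be x y).

Lemma between_abs c e x y s : Rabs (x - c) < e -> Rabs (y - c) < e ->
  Rmin x y <= s <= Rmax x y -> Rabs (s - c) < e.
Proof.
  intros Hx Hy Hs. apply Rabs_def2 in Hx. apply Rabs_def2 in Hy. apply Rabs_def1.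
  - apply Rle_lt_trans with (Rmax x y - c); [lra|]. unfold Rmax; destruct (Rle_dec x y); lra.
  - apply Rlt_le_trans with (Rmin x y - c); [|lra]. unfold Rmin; destruct (Rle_dec x y); lra.
Qed.

Lemma continuity_2d_slice_y f x y : continuity_2d_pt f x y -> continuous (fun z => f x z) y.
Proof.
  intros H. apply continuity_2d_pt_filterlim in H. intros P HP.
  destruct (H P HP) as [d Hd]. exists d. intros z Hz. apply (Hd (x, z)).
  split; [apply ball_center|exact Hz].
Qed.

Lemma continuity_2d_slice_x f x y : continuity_2d_pt f x y -> continuous (fun z => f z y) x.
Proof.
  intros H. apply continuity_2d_pt_filterlim in H. intros P HP.
  destruct (H P HP) as [d Hd]. exists d. intros z Hz. apply (Hd (z, y)).
  split; [exact Hz|apply ball_center].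
Qed.

Lemma abs_ball c e x : Rabs (x - c) < e -> exists d : posreal, forall z, Rabs (z - x) < d -> Rabs (z - c) < e.
Proof.
  intros H. assert (Hp : 0 < e - Rabs (x - c)) by lra.
  exists (mkposreal _ Hp). simpl. intros z Hz.
  replace (z - c) with ((z - x) + (x - c)) by ring.
  eapply Rle_lt_trans; [apply Rabs_triang|lra].
Qed.

Lemma is_derive_RInt_upper (f : R -> R) (a c e x : R) :
  (forall s, Rabs (s - c) < e -> continuous f s) -> Rabs (a - c) < e -> Rabs (x - c) < e ->
  is_derive (fun z => RInt f a z) x (f x).
Proof.
  intros Hf Ha Hx. apply (is_derive_RInt f (fun z => RInt f a z) a).
  - destruct (abs_ball _ _ _ Hx) as [d Hd]. exists d. intros z Hz.
    apply (RInt_correct (V:=R_CompleteNormedModule)), (ex_RInt_continuous (V:=R_CompleteNormedModule)).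
      intros s Hs. apply Hf.
    eapply between_abs; [exact Ha| |exact Hs]. apply Hd, Hz.
  - apply Hf, Hx.
Qed.

(** The primitive integrates the form along a horizontal segment and then a vertical one.
    The derivative in [y] is immediate; in [x], the derivative of the vertical integral is
    the integral of [px be = py al], which makes up for the change of [al]. *)
Lemma closed_form_primitive W al be a1 a2 e : closed_form W al be ->
  (forall x y, box a1 a2 e x y -> W x y) ->
  exists F, primitive_on (box a1 a2 e) al be F.
Proof.
  intros (HW & Hal & Hbe & Hcl) HB.
  set (F := fun x y => RInt (fun s => al s a2) a1 x + RInt (fun s => be x s) a2 y).
  exists F. intros x y Hxy.
  assert (He : 0 < e) by (destruct Hxy as [H _]; pose proof (Rabs_pos (x - a1)); lra).
  assert (E1 : Rabs (a1 - a1) < e) by (replace (a1 - a1) with 0 by ring; rewrite Rabs_R0; lra).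
  assert (E2 : Rabs (a2 - a2) < e) by (replace (a2 - a2) with 0 by ring; rewrite Rabs_R0; lra).
  assert (HDx : forall x y, box a1 a2 e x y ->
    is_derive (fun z => F z y) x (al x y)).
  { unfold F. clear x y Hxy. intros x y [Hx Hy]. evar_last.
    - apply (is_derive_plus (fun z => RInt (fun s => al s a2) a1 z) (fun z => RInt (fun s => be z s) a2 y)).
      + apply is_derive_RInt_upper with (c := a1) (e := e); auto.
        intros s Hs. apply (continuity_2d_slice_x al).
        apply (smooth_cont 1 W); auto. apply HB. split; auto.
      + apply (is_derive_RInt_param (fun z s => be z s) a2 y x).
        * destruct (abs_ball _ _ _ Hx) as [d Hd]. exists d. intros z Hz t Ht.
          eexists. apply (smooth_is_px 0 W); auto. apply HB. split; [apply Hd, Hz|].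
          eapply between_abs; [exact E2|exact Hy|exact Ht].
        * intros t Ht. apply (smooth_cont 0 W); [apply smooth_px, Hbe|].
          apply HB. split; auto. eapply between_abs; [exact E2|exact Hy|exact Ht].
        * destruct (abs_ball _ _ _ Hx) as [d Hd]. exists d. intros z Hz.
          apply (ex_RInt_continuous (V:=R_CompleteNormedModule)). intros s Hs.
          apply (continuity_2d_slice_y be). apply (smooth_cont 1 W); auto. apply HB.
          split; [apply Hd, Hz|]. eapply between_abs; [exact E2|exact Hy|exact Hs].
    - assert (HI : is_RInt (fun s => py al x s) a2 y (minus (al x y) (al x a2))).
      { apply (is_RInt_derive (V:=R_CompleteNormedModule) (fun s => al x s)).
        - intros s Hs. apply (smooth_is_py 0 W); auto. apply HB. split; auto.
          eapply between_abs; [exact E2|exact Hy|exact Hs].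
        - intros s Hs. apply (continuity_2d_slice_y (py al)).
          apply (smooth_cont 0 W); [apply smooth_py, Hal|]. apply HB. split; auto.
          eapply between_abs; [exact E2|exact Hy|exact Hs]. }
      rewrite (RInt_ext (fun t => Derive (fun u => be u t) x) (fun s => py al x s)).
      + rewrite (is_RInt_unique _ _ _ _ HI). unfold plus, minus, opp; simpl. unfold plus, opp; simpl. ring.
      + intros s Hs. symmetry. apply Hcl, HB. split; auto.
        eapply between_abs; [exact E2|exact Hy|lra]. }
  assert (HDy : is_derive (fun z => F x z) y (be x y)).
  { unfold F. destruct Hxy as [Hx Hy]. evar_last.
    - apply (is_derive_plus (fun _ => RInt (fun s => al s a2) a1 x) (fun z => RInt (fun s => be x s) a2 z)).
      + apply rder_const.
      + apply is_derive_RInt_upper with (c := a2) (e := e); auto.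
        intros s Hs. apply (continuity_2d_slice_y be).
        apply (smooth_cont 1 W); auto. apply HB. split; auto.
    - unfold plus, zero; simpl. ring. }
  apply filterdiff_differentiable_pt_lim. eapply filterdiff_ext_lin.
  - apply (is_derive_filterdiff F x y al (be x y)).
    + destruct Hxy as [Hx Hy].
      destruct (abs_ball _ _ _ Hx) as [d Hd]. destruct (abs_ball _ _ _ Hy) as [d' Hd'].
      assert (Hm : 0 < Rmin d d') by (apply Rmin_pos; apply cond_pos).
      exists (mkposreal _ Hm). intros [u v] [Hu Hv]. simpl.
      apply HDx. split.
      * apply Hd. eapply Rlt_le_trans; [exact Hu|apply Rmin_l].
      * apply Hd'. eapply Rlt_le_trans; [exact Hv|apply Rmin_r].
    + exact HDy.
    + assert (H : continuity_2d_pt al x y) by (apply (smooth_cont 1 W); auto).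
      apply continuity_2d_pt_filterlim in H. exact H.
  - intros [u v]. reflexivity.
Qed.

Definition form_along (al be : R -> R -> R) (g1 g2 d1 d2 : R -> R) (t : R) : R :=
  al (g1 t) (g2 t) * d1 t + be (g1 t) (g2 t) * d2 t.

Definition C1_curve (g1 g2 d1 d2 : R -> R) (t : R) : Prop :=
  is_derive g1 t (d1 t) /\ is_derive g2 t (d2 t) /\ continuous d1 t /\ continuous d2 t.

Lemma continuous_comp_2d f g1 g2 (t : R) : continuity_2d_pt f (g1 t) (g2 t) ->
  continuous g1 t -> continuous g2 t -> continuous (fun s => f (g1 s) (g2 s)) t.
Proof.
  intros Hf H1 H2.
  apply (continuous_comp_2 g1 g2 f); auto.
  apply continuity_2d_pt_filterlim in Hf. exact Hf.
Qed.

Lemma is_derive_continuous (f : R -> R) t l : is_derive f t l -> continuous f t.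
Proof. intros H. apply (ex_derive_continuous (V:=R_NormedModule)). eexists; exact H. Qed.

Lemma form_along_continuous n W al be g1 g2 d1 d2 t : smooth n W al -> smooth n W be ->
  W (g1 t) (g2 t) -> C1_curve g1 g2 d1 d2 t ->
  continuous (form_along al be g1 g2 d1 d2) t.
Proof.
  intros Hal Hbe Hw (H1 & H2 & H3 & H4).
  apply (continuous_plus (V:=R_NormedModule)); apply (continuous_mult (K:=R_AbsRing)); auto;
  apply continuous_comp_2d; eauto using is_derive_continuous, smooth_cont.
Qed.

Lemma primitive_along (B W : R -> R -> Prop) al be F g1 g2 d1 d2 t1 t2 : closed_form W al be ->
  (forall x y, B x y -> W x y) ->
  primitive_on B al be F -> t1 <= t2 ->
  (forall t, t1 <= t <= t2 -> C1_curve g1 g2 d1 d2 t /\ B (g1 t) (g2 t)) ->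
  is_RInt (form_along al be g1 g2 d1 d2) t1 t2 (F (g1 t2) (g2 t2) - F (g1 t1) (g2 t1)).
Proof.
  intros Hc HB HF Ht Hg.
  apply (is_RInt_derive (V:=R_CompleteNormedModule) (fun t => F (g1 t) (g2 t))).
  - intros t H. rewrite Rmin_left, Rmax_right in H by assumption.
    destruct (Hg t H) as [(H1 & H2 & _) Hb]. apply is_derive_Reals.
    apply derivable_pt_lim_comp_2d; [apply HF, Hb|apply is_derive_Reals, H1|apply is_derive_Reals, H2].
  - intros t H. rewrite Rmin_left, Rmax_right in H by assumption.
    destruct (Hg t H) as [Hcv Hb]. destruct Hc as (_ & Hal & Hbe & _).
      apply form_along_continuous with 1%nat W; auto.
Qed.

Definition seg_x (x1 x2 s : R) : R := x1 + s * (x2 - x1).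

(** Segments replace the curves of a homotopy, which are merely continuous, so that the form
    cannot be integrated along them. *)
Definition segment_integral (al be : R -> R -> R) (x1 y1 x2 y2 : R) : R :=
  RInt (form_along al be (seg_x x1 x2) (seg_x y1 y2) (fun _ => x2 - x1) (fun _ => y2 - y1)) 0 1.

Lemma seg_x_in c e x1 x2 s : Rabs (x1 - c) < e -> Rabs (x2 - c) < e -> 0 <= s <= 1 ->
  Rabs (seg_x x1 x2 s - c) < e.
Proof.
  unfold seg_x. intros H1 H2 Hs.
  replace (x1 + s * (x2 - x1) - c) with ((1 - s) * (x1 - c) + s * (x2 - c)) by ring.
  eapply Rle_lt_trans; [apply Rabs_triang|]. rewrite !Rabs_mult, (Rabs_right (1 - s)), (Rabs_right s) by lra.
  pose proof (Rabs_pos (x1 - c)). destruct (Req_dec s 0) as [->|Hn]; [lra|].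
  assert (s * Rabs (x2 - c) < s * e) by (apply Rmult_lt_compat_l; lra).
  assert ((1 - s) * Rabs (x1 - c) <= (1 - s) * e) by (apply Rmult_le_compat_l; lra). lra.
Qed.

Lemma is_derive_seg_x x1 x2 s : is_derive (seg_x x1 x2) s (x2 - x1).
Proof. unfold seg_x. auto_derive; auto. ring. Qed.

Lemma segment_integral_primitive W al be F a1 a2 e x1 y1 x2 y2 : closed_form W al be ->
  (forall x y, box a1 a2 e x y -> W x y) -> primitive_on (box a1 a2 e) al be F ->
  box a1 a2 e x1 y1 -> box a1 a2 e x2 y2 ->
  segment_integral al be x1 y1 x2 y2 = F x2 y2 - F x1 y1.
Proof.
  intros Hc HB HF [Hx1 Hy1] [Hx2 Hy2]. apply is_RInt_unique.
  evar_last.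
  - apply (primitive_along (box a1 a2 e) W al be F); [exact Hc|exact HB|exact HF|lra|].
    intros t Ht. split; [|split; apply seg_x_in; auto].
    split; [apply is_derive_seg_x|split; [apply is_derive_seg_x|split; apply continuous_const]].
  - unfold seg_x. simpl. f_equal; f_equal; ring.
Qed.

Definition node (T : R) (N j : nat) : R := T * INR j / INR (S N).

(** Edges are numbered from 0, and [k] is the last one: it ends at [node T N (S k)]. *)
Definition polygon_integral (al be : R -> R -> R) (T : R) (N : nat) (g1 g2 : R -> R) (k : nat) : R :=
  sum_n (fun j => segment_integral al be
     (g1 (node T N j)) (g2 (node T N j))
     (g1 (node T N (S j))) (g2 (node T N (S j)))) k.

Section Homotopy.
Variables (W : R -> R -> Prop) (al be : R -> R -> R) (h1 h2 : R -> R -> R) (T : R).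
Hypothesis Hc : closed_form W al be.
Hypothesis HT : 0 < T.
Hypothesis Hh1 : forall s t, continuity_2d_pt h1 s t.
Hypothesis Hh2 : forall s t, continuity_2d_pt h2 s t.
Hypothesis HhW : forall s, 0 <= s <= 1 -> forall t, W (h1 s t) (h2 s t).
Hypothesis Hper : forall s, 0 <= s <= 1 -> h1 s T = h1 s 0 /\ h2 s T = h2 s 0.

(** [d] is a Lebesgue number: it bounds the size of the parameter squares that are mapped
    into a single box of the domain. *)
Definition small_squares (d : R) : Prop := forall s t, 0 <= s <= 1 -> 0 <= t <= T ->
  exists a1 a2 e, (forall x y, box a1 a2 e x y -> W x y) /\
    forall s' t', Rabs (s' - s) < d -> Rabs (t' - t) < d -> box a1 a2 e (h1 s' t') (h2 s' t').

(** The radii are halved so that the square around an arbitrary point fits into the square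
    around a centre of the finite subcover. *)
Lemma homotopy_lebesgue_number : exists d : posreal, small_squares d.
Proof.
  assert (Hloc : forall s t, exists d : posreal, 0 <= s <= 1 ->
    exists e, (forall x y, box (h1 s t) (h2 s t) e x y -> W x y) /\
    forall s' t', Rabs (s' - s) < 2 * d -> Rabs (t' - t) < 2 * d ->
       box (h1 s t) (h2 s t) e (h1 s' t') (h2 s' t')).
  { intros s t. destruct (classic (0 <= s <= 1)) as [Hs|Hs];
      [|exists (mkposreal 1 Rlt_0_1); intros; contradiction].
    destruct Hc as [HW _]. destruct (HW _ _ (HhW s Hs t)) as [e He].
    destruct (Hh1 s t e) as [d1 Hd1]. destruct (Hh2 s t e) as [d2 Hd2].
    assert (Hm : 0 < Rmin d1 d2 / 2).
    { assert (0 < Rmin d1 d2) by (apply Rmin_pos; apply cond_pos). lra. }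
    exists (mkposreal _ Hm). intros _. exists e. split.
    - intros x y [Hx Hy]. apply He; auto.
    - simpl. intros s' t' Hs' Ht'. pose proof (Rmin_l d1 d2). pose proof (Rmin_r d1 d2).
      split; [apply Hd1|apply Hd2]; lra. }
  destruct (choice (fun st d => 0 <= fst st <= 1 ->
    exists e, (forall x y, box (h1 (fst st) (snd st)) (h2 (fst st) (snd st)) e x y -> W x y) /\
    forall s' t', Rabs (s' - fst st) < 2 * pos d -> Rabs (t' - snd st) < 2 * pos d ->
       box (h1 (fst st) (snd st)) (h2 (fst st) (snd st)) e (h1 s' t') (h2 s' t'))) as [D HD].
  { intros [s t]. apply Hloc. }
  destruct (compactness_value_2d 0 1 0 T (fun s t => D (s, t))) as [d Hd].
  exists d. intros s t Hs Ht. specialize (Hd s t Hs Ht). apply NNPP in Hd.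
  destruct Hd as (u & v & Hu & Hv & Hsu & Htv & Hle).
  destruct (HD (u, v) Hu) as (e & He & Hbox). simpl in *.
  exists (h1 u v), (h2 u v), e. split; auto.
  intros s' t' Hs' Ht'. apply Hbox.
  - replace (s' - u) with ((s' - s) + (s - u)) by ring. eapply Rle_lt_trans; [apply Rabs_triang|]. lra.
  - replace (t' - v) with ((t' - t) + (t - v)) by ring. eapply Rle_lt_trans; [apply Rabs_triang|]. lra.
Qed.

Variables (d : posreal) (N : nat).
Hypothesis Hd : small_squares d.
Hypothesis HNT : T / INR (S N) < d.
Hypothesis HN1 : 1 / INR (S N) < d.

Lemma node_0 : node T N 0 = 0.
Proof. unfold node. simpl (INR 0). unfold Rdiv. ring. Qed.

Lemma node_last : node T N (S N) = T.
Proof. unfold node. field. apply not_0_INR. lia. Qed.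

Lemma node_step j : Rabs (node T N (S j) - node T N j) < d.
Proof.
  unfold node.
  assert (HS : 0 < INR (S N)) by (apply lt_0_INR; lia).
  rewrite (S_INR j). replace (T * (INR j + 1) / INR (S N) - T * INR j / INR (S N)) with (T / INR (S N)) by
    (field; lra).
  rewrite Rabs_right; auto. apply Rle_ge, Rlt_le, Rdiv_lt_0_compat; auto.
Qed.

Lemma node_range j : (j <= S N)%nat -> 0 <= node T N j <= T.
Proof.
  unfold node. intros Hj. assert (HS : 0 < INR (S N)) by (apply lt_0_INR; lia).
  apply le_INR in Hj. pose proof (pos_INR j). split.
  - apply Rmult_le_pos; [nra|]. apply Rlt_le, Rinv_0_lt_compat, HS.
  - apply Rmult_le_reg_r with (INR (S N)); auto.
    replace (T * INR j / INR (S N) * INR (S N)) with (T * INR j) by (field; lra). nra.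
Qed.

(** On each small quadrilateral the form has a primitive, so the integrals over opposite
    sides differ by those over the two connecting sides. Adding up along the polygon, the
    connecting sides cancel except for the first and the last. *)
Lemma polygon_close s s' k : 0 <= s <= 1 -> 0 <= s' <= 1 -> Rabs (s' - s) < d -> (k <= N)%nat ->
  polygon_integral al be T N (h1 s) (h2 s) k =
  polygon_integral al be T N (h1 s') (h2 s') k
  + segment_integral al be (h1 s 0) (h2 s 0) (h1 s' 0) (h2 s' 0)
  - segment_integral al be (h1 s (node T N (S k))) (h2 s (node T N (S k)))
      (h1 s' (node T N (S k))) (h2 s' (node T N (S k))).
Proof.
  intros Hs Hs' Hss.
  assert (Hquad : forall j, (j <= N)%nat ->
    segment_integral al be (h1 s (node T N j)) (h2 s (node T N j))
       (h1 s (node T N (S j))) (h2 s (node T N (S j))) =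
    segment_integral al be (h1 s' (node T N j)) (h2 s' (node T N j))
       (h1 s' (node T N (S j))) (h2 s' (node T N (S j))) +
    segment_integral al be (h1 s (node T N j)) (h2 s (node T N j))
       (h1 s' (node T N j)) (h2 s' (node T N j)) -
    segment_integral al be (h1 s (node T N (S j))) (h2 s (node T N (S j)))
       (h1 s' (node T N (S j))) (h2 s' (node T N (S j)))).
  { intros j Hj. pose proof (node_step j) as Hst.
    destruct (Hd s (node T N j) Hs) as (a1 & a2 & e & HB & Hbox); [apply node_range; lia|].
    destruct (closed_form_primitive W al be a1 a2 e Hc HB) as [F HF].
    assert (Z0 : forall z, Rabs (z - z) < d).
    { intros z. replace (z - z) with 0 by ring. rewrite Rabs_R0. apply cond_pos. }
    rewrite !(segment_integral_primitive W al be F a1 a2 e); auto; ring. }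
  unfold polygon_integral. induction k as [|k IH]; intros Hk.
  - rewrite !sum_O. rewrite Hquad by lia. rewrite node_0. ring.
  - rewrite !sum_Sn. rewrite IH by lia. rewrite (Hquad (S k)) by lia. unfold plus; simpl. ring.
Qed.

(** For loops the first and the last connecting sides coincide. *)
Lemma polygon_close_loop s s' : 0 <= s <= 1 -> 0 <= s' <= 1 -> Rabs (s' - s) < d ->
  polygon_integral al be T N (h1 s) (h2 s) N = polygon_integral al be T N (h1 s') (h2 s') N.
Proof.
  intros Hs Hs' Hss. rewrite (polygon_close s s' N Hs Hs' Hss (le_n N)).
  rewrite node_last. destruct (Hper s Hs) as [-> ->]. destruct (Hper s' Hs') as [-> ->]. ring.
Qed.

Lemma polygon_homotopic : polygon_integral al be T N (h1 0) (h2 0) N = polygon_integral al be T N (h1 1) (h2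
  1) N.
Proof.
  assert (HS : 0 < INR (S N)) by (apply lt_0_INR; lia).
  assert (H : forall i, (i <= S N)%nat -> polygon_integral al be T N (h1 0) (h2 0) N =
     polygon_integral al be T N (h1 (INR i / INR (S N))) (h2 (INR i / INR (S N))) N).
  { assert (Hr : forall i, (i <= S N)%nat -> 0 <= INR i / INR (S N) <= 1).
    { intros i Hi. apply le_INR in Hi. pose proof (pos_INR i). split.
      - apply Rmult_le_pos; auto. apply Rlt_le, Rinv_0_lt_compat, HS.
      - apply Rmult_le_reg_r with (INR (S N)); auto.
        replace (INR i / INR (S N) * INR (S N)) with (INR i) by (field; lra). lra. }
    induction i as [|i IH]; intros Hi.
    - change (INR 0) with 0. replace (0 / INR (S N)) with 0 by (unfold Rdiv; ring). reflexivity.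
    - rewrite IH by lia. apply polygon_close_loop; try (apply Hr; lia).
      rewrite (S_INR i). replace ((INR i + 1) / INR (S N) - INR i / INR (S N)) with (1 / INR (S N)) by
        (field; lra).
      rewrite Rabs_right; auto. apply Rle_ge, Rlt_le, Rdiv_lt_0_compat; auto; lra. }
  rewrite (H (S N) (le_n _)). replace (INR (S N) / INR (S N)) with 1 by (field; lra). reflexivity.
Qed.

(** A C^1 curve and the inscribed polygon with the same vertices are compared arc by arc,
    inside boxes on which the form has a primitive. *)
Lemma polygon_of_curve s d1 d2 : 0 <= s <= 1 ->
  (forall t, C1_curve (h1 s) (h2 s) d1 d2 t) ->
  is_RInt (form_along al be (h1 s) (h2 s) d1 d2) 0 T (polygon_integral al be T N (h1 s) (h2 s) N).
Proof.
  intros Hs Hcv. assert (HS : 0 < INR (S N)) by (apply lt_0_INR; lia).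
  assert (Hst : forall j, (j <= N)%nat -> is_RInt (form_along al be (h1 s) (h2 s) d1 d2)
     (node T N j) (node T N (S j))
     (segment_integral al be (h1 s (node T N j)) (h2 s (node T N j))
       (h1 s (node T N (S j))) (h2 s (node T N (S j))))).
  { intros j Hj. pose proof (node_step j) as Hst.
    destruct (Hd s (node T N j) Hs) as (a1 & a2 & e & HB & Hbox); [apply node_range; lia|].
    destruct (closed_form_primitive W al be a1 a2 e Hc HB) as [F HF].
    assert (Z0 : forall z, Rabs (z - z) < d).
    { intros z. replace (z - z) with 0 by ring. rewrite Rabs_R0. apply cond_pos. }
    rewrite (segment_integral_primitive W al be F a1 a2 e); auto.
    assert (Hlt : node T N j <= node T N (S j)).
    { unfold node. apply Rmult_le_compat_r; [apply Rlt_le, Rinv_0_lt_compat, HS|].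
      apply Rmult_le_compat_l; [lra|]. apply le_INR; lia. }
    apply (primitive_along (box a1 a2 e) W); auto.
    intros t Ht. split; auto. apply Hbox; auto.
    rewrite Rabs_right by lra. apply Rabs_def2 in Hst. lra. }
  assert (H : forall k, (k <= N)%nat -> is_RInt (form_along al be (h1 s) (h2 s) d1 d2) 0 (node T N (S k))
     (polygon_integral al be T N (h1 s) (h2 s) k)).
  { unfold polygon_integral. induction k as [|k IH]; intros Hk.
    - rewrite sum_O. rewrite <- node_0. apply Hst, Hk.
    - rewrite sum_Sn. eapply (is_RInt_Chasles (V:=R_NormedModule)); [apply IH; lia|apply Hst, Hk]. }
  specialize (H N (le_n N)). rewrite node_last in H. exact H.
Qed.
End Homotopy.

Lemma ex_fine_subdivision (T d : R) : 0 < T -> 0 < d -> exists N, T / INR (S N) < d /\ 1 / INR (S N) < d.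
Proof.
  intros HT Hd. destruct (INR_unbounded ((T + 1) / d)) as [N HN]. exists N.
  assert (HS : 0 < INR (S N)) by (apply lt_0_INR; lia).
  assert (HX : T + 1 < d * INR (S N)).
  { rewrite S_INR. apply Rmult_lt_reg_l with (/ d); [apply Rinv_0_lt_compat, Hd|].
    replace (/ d * (d * (INR N + 1))) with (INR N + 1) by (field; lra). unfold Rdiv in HN. lra. }
  split; apply Rmult_lt_reg_r with (INR (S N)); auto; unfold Rdiv; rewrite Rmult_assoc, Rinv_l by lra; lra.
Qed.

(** Only the two end curves of the homotopy are differentiable. Both integrals exist and equal
    the integral over an inscribed polygon, which does not change along the homotopy. *)
Lemma closed_form_homotopy W al be h1 h2 T d1 d2 e1 e2 : closed_form W al be -> 0 < T ->
  (forall s t, continuity_2d_pt h1 s t) -> (forall s t, continuity_2d_pt h2 s t) ->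
  (forall s, 0 <= s <= 1 -> forall t, W (h1 s t) (h2 s t)) ->
  (forall s, 0 <= s <= 1 -> h1 s T = h1 s 0 /\ h2 s T = h2 s 0) ->
  (forall t, C1_curve (h1 0) (h2 0) d1 d2 t) ->
  (forall t, C1_curve (h1 1) (h2 1) e1 e2 t) ->
  exists I, is_RInt (form_along al be (h1 0) (h2 0) d1 d2) 0 T I /\
            is_RInt (form_along al be (h1 1) (h2 1) e1 e2) 0 T I.
Proof.
  intros Hc HT H1 H2 HhW Hper Hd0 Hd1.
  destruct (homotopy_lebesgue_number W al be h1 h2 T Hc H1 H2 HhW) as [d Hd].
  destruct (ex_fine_subdivision T d HT (cond_pos d)) as (N & HN & HN').
  exists (polygon_integral al be T N (h1 0) (h2 0) N). split.
  - eapply polygon_of_curve; eauto; lra.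
  - erewrite polygon_homotopic; eauto. eapply polygon_of_curve; eauto; lra.
Qed.

(** * Green's formula on a disc *)

(** Continuity under the integral sign, from uniform continuity on the compact interval. *)
Lemma continuous_RInt_param f a b c : a <= b ->
  (forall t, a <= t <= b -> continuity_2d_pt f c t) ->
  locally c (fun x => ex_RInt (f x) a b) ->
  continuous (fun x => RInt (f x) a b) c.
Proof.
  intros Hab Hf [d0 Hd0]. apply (proj2 (filterlim_locally _ _)). intros eps.
  assert (He : 0 < eps / (b - a + 1)) by (apply Rdiv_lt_0_compat; [apply cond_pos|lra]).
  destruct (uniform_continuity_2d_1d' f a b c Hf (mkposreal _ He)) as [d Hd].
  assert (Hm : 0 < Rmin d d0) by (apply Rmin_pos; apply cond_pos).
  exists (mkposreal _ Hm). intros x Hx.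
  pose proof (Rmin_l d d0). pose proof (Rmin_r d d0).
  assert (Hx' : Rabs (x - c) < Rmin d d0) by exact Hx.
  assert (E1 : ex_RInt (f x) a b) by (apply Hd0; change (Rabs (x - c) < d0); lra).
  assert (E2 : ex_RInt (f c) a b) by (apply Hd0, ball_center).
  change (Rabs (RInt (f x) a b - RInt (f c) a b) < eps).
  rewrite <- (RInt_minus (V:=R_CompleteNormedModule) (f x) (f c)) by assumption.
  apply Rle_lt_trans with ((b - a) * (eps / (b - a + 1))).
  - apply abs_RInt_le_const; auto.
    + apply (ex_RInt_minus (V:=R_NormedModule)); assumption.
    + intros t Ht. left. unfold minus, plus, opp; simpl.
      pose proof (cond_pos d). apply Rabs_def2 in Hx'.
      apply (Hd t c t x); try lra; replace (t - t) with 0 by ring; rewrite Rabs_R0; lra.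
  - pose proof (cond_pos eps). replace (pos eps) with ((b - a + 1) * (eps / (b - a + 1))) at 2 by (field;
    lra).
    apply Rmult_lt_compat_r; lra.
Qed.

Lemma continuity_2d_polar f r t : continuity_2d_pt f (r * cos t) (r * sin t) ->
  continuity_2d_pt (fun r t => f (r * cos t) (r * sin t)) r t.
Proof.
  intros H. apply continuity_2d_comp; auto; apply continuity_2d_pt_mult; auto using continuity_2d_pt_id1.
  - apply (continuity_1d_2d_pt_comp cos (fun _ t => t)); [apply continuity_cos|apply continuity_2d_pt_id2].
  - apply (continuity_1d_2d_pt_comp sin (fun _ t => t)); [apply continuity_sin|apply continuity_2d_pt_id2].
Qed.

Lemma continuity_2d_cos r t : continuity_2d_pt (fun _ t => cos t) r t.
Proof. apply (continuity_1d_2d_pt_comp cos (fun _ t => t));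
  [apply continuity_cos|apply continuity_2d_pt_id2]. Qed.

Lemma continuity_2d_sin r t : continuity_2d_pt (fun _ t => sin t) r t.
Proof. apply (continuity_1d_2d_pt_comp sin (fun _ t => t));
  [apply continuity_sin|apply continuity_2d_pt_id2]. Qed.

(** [Cb] is the continuity, in polar coordinates, of a function that is smooth of a given order. *)
Ltac polar_cont Cb := repeat first [apply continuity_2d_pt_plus | apply continuity_2d_pt_minus
  | apply continuity_2d_pt_mult | apply continuity_2d_pt_opp
  | apply continuity_2d_pt_id1 | apply continuity_2d_cos | apply continuity_2d_sin
  | eapply (Cb 0%nat); [first [apply smooth_px|apply smooth_py]; eassumption|assumption|assumption]
  | eapply (Cb 1%nat); eassumption].

(** In polar coordinates the form is P dr + Q dt and the integrand is Q_r - P_t. The term P_t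
    integrates to 0 over a period, the term Q_r integrates to the value of Q at r = 1, and Q
    vanishes at r = 0. The domain is described by polar coordinates in a rectangle slightly
    larger than [0, 1] x [0, 2 PI], on which both variables may be differentiated. *)
Lemma green_disc W rho b1 b2 : open2 W -> 1 < rho ->
  (forall r t, -1 < r < rho -> -1 < t < 2 * PI + 1 -> W (r * cos t) (r * sin t)) ->
  smooth 1 W b1 -> smooth 1 W b2 ->
  RInt (fun r => RInt (fun t => (px b2 (r * cos t) (r * sin t) - py b1 (r * cos t) (r * sin t)) * r) 0 (2 *
    PI)) 0 1
  = RInt (form_along b1 b2 cos sin (fun t => - sin t) cos) 0 (2 * PI).
Proof.
  intros HW Hrho HB S1 S2. pose proof PI_RGT_0 as Hpi.
  assert (Cb : forall n f r t, smooth n W f -> -1 < r < rho -> -1 < t < 2 * PI + 1 ->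
     continuity_2d_pt (fun r t => f (r * cos t) (r * sin t)) r t).
  { intros n f r t Hf Hr Ht. apply continuity_2d_polar. eapply smooth_cont; eauto. }
  assert (Hr01 : forall r, 0 <= r <= 1 -> -1 < r < rho) by (intros; lra).
  assert (Ht0 : forall t, Rmin 0 (2 * PI) <= t <= Rmax 0 (2 * PI) -> -1 < t < 2 * PI + 1).
  { intros t. rewrite Rmin_left, Rmax_right; lra. }
  assert (Hnear : forall a b r, a < r < b -> exists d : posreal, forall z, Rabs (z - r) < d -> a < z < b).
  { intros a b r Hr. assert (Hm : 0 < Rmin (r - a) (b - r)) by (apply Rmin_pos; lra).
    exists (mkposreal _ Hm). simpl. intros z Hz. pose proof (Rmin_l (r - a) (b - r)).
      pose proof (Rmin_r (r - a) (b - r)).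
    apply Rabs_def2 in Hz. lra. }
  set (Q := fun r t => r * (b2 (r * cos t) (r * sin t) * cos t - b1 (r * cos t) (r * sin t) * sin t)).
  set (G := fun r t => (px b2 (r * cos t) (r * sin t) - py b1 (r * cos t) (r * sin t)) * r).
  set (Pt := fun r t =>
     (px b1 (r * cos t) (r * sin t) * (- (r * sin t)) + py b1 (r * cos t) (r * sin t) * (r * cos t)) * cos t
     - b1 (r * cos t) (r * sin t) * sin t +
     (px b2 (r * cos t) (r * sin t) * (- (r * sin t)) + py b2 (r * cos t) (r * sin t) * (r * cos t)) * sin t
     + b2 (r * cos t) (r * sin t) * cos t).
  assert (Pd : forall f r t, smooth 1 W f -> -1 < r < rho -> -1 < t < 2 * PI + 1 ->
     is_derive (fun z => f (z * cos t) (z * sin t)) r (px f (r * cos t) (r * sin t) * cos t + py f (r * cos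
       t) (r * sin t) * sin t)).
  { intros f r t Hf Hr Ht. apply (smooth_comp_curve 0 W f (fun z => z * cos t) (fun z => z * sin t)); auto.
    - auto_derive; auto; ring.
    - auto_derive; auto; ring. }
  assert (Td : forall f r t, smooth 1 W f -> -1 < r < rho -> -1 < t < 2 * PI + 1 ->
     is_derive (fun z => f (r * cos z) (r * sin z)) t (px f (r * cos t) (r * sin t) * - (r * sin t) + py f (r
       * cos t) (r * sin t) * (r * cos t))).
  { intros f r t Hf Hr Ht. apply (smooth_comp_curve 0 W f (fun z => r * cos z) (fun z => r * sin z)); auto.
    - auto_derive; auto; ring.
    - auto_derive; auto; ring. }
  assert (HQ : forall r t, -1 < r < rho -> -1 < t < 2 * PI + 1 ->
    is_derive (fun z => Q z t) r (G r t + Pt r t)).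
  { intros r t Hr Ht. unfold Q. evar_last.
    - apply (rder_mult (fun z => z)); [apply rder_id|].
      apply rder_minus.
      + apply (rder_mult (fun z => b2 (z * cos t) (z * sin t))); [apply Pd; auto|apply rder_const].
      + apply (rder_mult (fun z => b1 (z * cos t) (z * sin t))); [apply Pd; auto|apply rder_const].
    - pose proof (sin2_cos2 t) as Hs. unfold Rsqr in Hs.
      assert (Hs' : sin t ^ 2 = 1 - cos t ^ 2) by nra. unfold G, Pt. ring [Hs']. }
  assert (HPc : forall r t, -1 < r < rho -> -1 < t < 2 * PI + 1 -> continuity_2d_pt Pt r t)
    by (intros r t Hr Ht; unfold Pt; polar_cont Cb).
  assert (HQc : forall r t, -1 < r < rho -> -1 < t < 2 * PI + 1 -> continuity_2d_pt Q r t)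
    by (intros r t Hr Ht; unfold Q; polar_cont Cb).
  assert (HP : forall r, -1 < r < rho -> is_RInt (Pt r) 0 (2 * PI) 0).
  { intros r Hr. evar_last.
    - apply (is_RInt_derive (V:=R_CompleteNormedModule)
        (fun t => b1 (r * cos t) (r * sin t) * cos t + b2 (r * cos t) (r * sin t) * sin t)).
      + intros t Ht. apply Ht0 in Ht. evar_last.
        * apply rder_plus.
          -- apply (rder_mult (fun t => b1 (r * cos t) (r * sin t)) cos); [apply Td;
            auto|apply is_derive_cos].
          -- apply (rder_mult (fun t => b2 (r * cos t) (r * sin t)) sin); [apply Td;
            auto|apply is_derive_sin].
        * unfold Pt. ring.
      + intros t Ht. apply (continuity_2d_slice_y Pt). auto.
    - rewrite !cos_2PI, !sin_2PI, cos_0, sin_0. unfold minus, plus, opp; simpl. ring. }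
  assert (HG : forall r t, -1 < r < rho -> -1 < t < 2 * PI + 1 -> continuity_2d_pt G r t).
  { intros r t Hr Ht. unfold G. apply continuity_2d_pt_mult; [|apply continuity_2d_pt_id1].
    apply continuity_2d_pt_minus; [apply (Cb 0%nat (px b2))|apply (Cb 0%nat (py b1))];
     auto using smooth_px, smooth_py. }
  assert (HGi : forall r, -1 < r < rho -> ex_RInt (G r) 0 (2 * PI)).
  { intros r Hr. apply (ex_RInt_continuous (V:=R_CompleteNormedModule)). intros t Ht. apply Ht0 in Ht.
    apply (continuity_2d_slice_y G). auto. }
  assert (HJ : forall r, -1 < r < rho -> is_derive (fun z => RInt (Q z) 0 (2 * PI)) r (RInt (G r) 0 (2 *
    PI))).
  { intros r Hr. evar_last.
    - apply (is_derive_RInt_param Q 0 (2 * PI) r).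
      + destruct (Hnear _ _ r Hr) as [d Hd]. exists d. intros z Hz t Ht.
        eexists. apply HQ; [apply Hd, Hz|apply Ht0, Ht].
      + intros t Ht. apply Ht0 in Ht. apply continuity_2d_pt_ext_loc with (fun r t => G r t + Pt r t).
        * destruct (Hnear _ _ r Hr) as [d Hd]. destruct (Hnear _ _ t Ht) as [d' Hd'].
          assert (Hm : 0 < Rmin d d') by (apply Rmin_pos; apply cond_pos).
          exists (mkposreal _ Hm). simpl. intros u v Hu Hv. symmetry.
          pose proof (Rmin_l d d'). pose proof (Rmin_r d d').
          apply is_derive_unique, HQ; [apply Hd; lra|apply Hd'; lra].
        * apply continuity_2d_pt_plus; auto.
      + destruct (Hnear _ _ r Hr) as [d Hd]. exists d. intros z Hz.
        apply (ex_RInt_continuous (V:=R_CompleteNormedModule)). intros t Ht. apply Ht0 in Ht.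
        apply (continuity_2d_slice_y Q). apply HQc; [apply Hd, Hz|exact Ht].
    - rewrite (RInt_ext _ (fun t => plus (G r t) (Pt r t))).
      + rewrite (RInt_plus (V:=R_CompleteNormedModule)); [|auto|eexists; apply HP; auto].
        rewrite (is_RInt_unique _ _ _ _ (HP r Hr)). unfold plus; simpl. ring.
      + intros t Ht. apply is_derive_unique, HQ; [exact Hr|apply Ht0; lra]. }
  change (RInt (fun r => RInt (G r) 0 (2 * PI)) 0 1 = RInt (form_along b1 b2 cos sin (fun t => - sin t) cos)
    0 (2 * PI)).
  transitivity (RInt (Q 1) 0 (2 * PI) - RInt (Q 0) 0 (2 * PI)).
  - apply is_RInt_unique.
    apply (is_RInt_derive (V:=R_CompleteNormedModule) (fun z => RInt (Q z) 0 (2 * PI))).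
    + intros r Hr. rewrite Rmin_left, Rmax_right in Hr by lra. apply HJ, Hr01, Hr.
    + intros r Hr. rewrite Rmin_left, Rmax_right in Hr by lra.
      apply continuous_RInt_param; [lra|intros t Ht; apply HG; [apply Hr01, Hr|lra]|].
      destruct (Hnear _ _ r (Hr01 r Hr)) as [d Hd]. exists d. intros z Hz. apply HGi, Hd, Hz.
  - rewrite (RInt_ext (Q 0) (fun _ => 0)).
    + rewrite RInt_const. unfold scal; simpl; unfold mult; simpl. rewrite Rmult_0_r, Rminus_0_r.
      apply RInt_ext. intros t _.
      change (@eq R (Q 1 t) (form_along b1 b2 cos sin (fun t => - sin t) cos t)).
      unfold Q, form_along. rewrite !Rmult_1_l. ring.
    + intros t _. change (@eq R (Q 0 t) 0). unfold Q. ring.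
Qed.

(** * Killing fields and the flux density *)

Definition quad (t0 t1 t2 z : C) : C := (t0 + t1 * z + t2 * (z * z))%C.
Definition quad' (t1 t2 z : C) : C := (t1 + RtoC 2 * (t2 * z))%C.

(** The extension to the half-space of the field [quad t0 t1 t2] of the boundary plane. *)
Definition killing (t0 t1 t2 : C) (q : vec) : vec :=
  ((quad t0 t1 t2 (fst q) - Cconj t2 * RtoC (cw q ^ 2))%C, cw q * Re (quad' t1 t2 (fst q))).

(** The operator (d/dx - i d/dy) / 2 in terms of the two partial derivatives. *)
Definition d_z (a b : C) : C := ((Re a + Im b) / 2, (Im a - Re b) / 2).

(** [a] and [b] are the partial derivatives of an immersion at the point [q]. The value is the
    coefficient of dz in a one-form whose imaginary part is half the flux form. For the
    polynomials 1, z, z^2 it is, up to sign, an entry of (d' M) M^-1, where M is the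
    Hermitian matrix of the point [q]. *)
Definition density (t0 t1 t2 : C) (q a b : vec) : C :=
  (quad t0 t1 t2 (fst q) * d_z (Cconj (fst a)) (Cconj (fst b)) * RtoC (/ cw q ^ 2)
   + quad' t1 t2 (fst q) * d_z (RtoC (cw a)) (RtoC (cw b)) * RtoC (/ cw q)
   - t2 * d_z (fst a) (fst b))%C.

(** A one-form whose exterior derivative is twice the contraction of the volume form with
    [killing]; see [potential_exterior_derivative]. *)
Definition volume_potential (t0 t1 t2 : C) (q a : vec) : R :=
  - (Im (quad t0 t1 t2 (fst q) * Cconj (fst a))%C / cw q ^ 2
     + Im (quad' t1 t2 (fst q)) * cw a / cw q - Im (t2 * fst a)%C).

(** The direction (x2, - x1) is the rotation of (x1, x2) by a quarter turn: the first term on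
    the right is the conormal part of the flux, the second one the disk part. *)
Lemma density_flux t0 t1 t2 q a b x1 x2 : cw q <> 0 ->
  2 * Im (density t0 t1 t2 q a b * (x1, x2))%C =
  hdot q (vadd (vscal x2 a) (vscal (- x1) b)) (killing t0 t1 t2 q)
  - volume_potential t0 t1 t2 q (vadd (vscal x1 a) (vscal x2 b)).
Proof.
  destruct t0 as [t0r t0i], t1 as [t1r t1i], t2 as [t2r t2i], q as [[u v] w], a as [[a1 a2] a3],
    b as [[b1 b2] b3].
  unfold density, volume_potential, killing, quad, quad', d_z, hdot, dot, vadd, vscal, mkvec, cu, cv, cw.
    simpl. intros Hw.
  field. exact Hw.
Qed.

Lemma vanishing_derivative_x W E x y l : open2 W -> (forall x y, W x y -> E x y = 0) -> W x y ->
  is_derive (fun z => E z y) x l -> l = 0.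
Proof.
  intros HW H0 Hw Hd. apply is_derive_unique in Hd. rewrite <- Hd.
  rewrite (Derive_ext_loc _ (fun _ => 0)); [apply Derive_const|].
  apply (locally_2d_1d_const_y (fun u v => E u v = 0)).
  destruct (HW x y Hw) as [d Hd']. exists d. intros u v Hu Hv. apply H0, Hd'; auto.
Qed.

Lemma vanishing_derivative_y W E x y l : open2 W -> (forall x y, W x y -> E x y = 0) -> W x y ->
  is_derive (fun z => E x z) y l -> l = 0.
Proof.
  intros HW H0 Hw Hd. apply is_derive_unique in Hd. rewrite <- Hd.
  rewrite (Derive_ext_loc _ (fun _ => 0)); [apply Derive_const|].
  apply (locally_2d_1d_const_x (fun u v => E u v = 0)).
  destruct (HW x y Hw) as [d Hd']. exists d. intros u v Hu Hv. apply H0, Hd'; auto.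
Qed.

(** [l] stands for the Laplacian of the immersion. In conformal parameters the equation says
    that the tension field of the immersion is twice the unit normal times the conformal
    factor, written with Euclidean operations. *)
Definition bryant_equation (q a b l : vec) : Prop :=
  let w := cw q in
  l = vadd (vscal (2 / w) (vadd (vscal (cw a) a) (vscal (cw b) b)))
       (vadd (mkvec 0 0 (- (dot a a + dot b b) / w)) (vscal (2 / w) (cross a b))).

Ltac vec_ring := intros; repeat match goal with v : vec |- _ => destruct v as [[? ?] ?] end;
  unfold det3, dot, cross, vadd, vscal, mkvec, cu, cv, cw; simpl; ring.

Lemma vec_eq (a b : vec) : cu a = cu b -> cv a = cv b -> cw a = cw b -> a = b.
Proof.
  destruct a as [[a1 a2] a3], b as [[b1 b2] b3]. unfold cu, cv, cw. simpl. congruence.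
Qed.

(** [a], [b] and [cross a b] span the space: [R0] times the squared length of [cross a b] is a
    combination of the three vanishing products. *)
Lemma orthogonal_frame_zero (R0 a b : vec) : cross a b <> mkvec 0 0 0 ->
  dot R0 a = 0 -> dot R0 b = 0 -> dot R0 (cross a b) = 0 -> R0 = mkvec 0 0 0.
Proof.
  destruct R0 as [[r1 r2] r3], a as [[a1 a2] a3], b as [[b1 b2] b3].
  unfold cross, dot, mkvec, cu, cv, cw. simpl. intros Hn Ha Hb Hc.
  set (n1 := a2 * b3 - a3 * b2) in *. set (n2 := a3 * b1 - a1 * b3) in *. set (n3 := a1 * b2 - a2 * b1) in *.
  assert (Hp : n1 * n1 + n2 * n2 + n3 * n3 <> 0).
  { intros H0. apply Hn.
    assert (n1 = 0) by nra. assert (n2 = 0) by nra. assert (n3 = 0) by nra. congruence. }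
  assert (K : forall r c1 c2 n, r * (n1 * n1 + n2 * n2 + n3 * n3) =
     (r1 * a1 + r2 * a2 + r3 * a3) * c1 + (r1 * b1 + r2 * b2 + r3 * b3) * c2 + (r1 * n1 + r2 * n2 + r3 * n3)
       * n -> r = 0).
  { intros r c1 c2 n E. rewrite Ha, Hb, Hc in E.
    apply Rmult_eq_reg_r with (n1 * n1 + n2 * n2 + n3 * n3); lra. }
  rewrite (K r1 (b2 * n3 - b3 * n2) (n2 * a3 - n3 * a2) n1) by (unfold n1, n2, n3; ring).
  rewrite (K r2 (b3 * n1 - b1 * n3) (n3 * a1 - n1 * a3) n2) by (unfold n1, n2, n3; ring).
  rewrite (K r3 (b1 * n2 - b2 * n1) (n1 * a2 - n2 * a1) n3) by (unfold n1, n2, n3; ring).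
  reflexivity.
Qed.

Lemma conformal_cross_norm a b : dot a a = dot b b -> dot a b = 0 ->
  dot (cross a b) (cross a b) = dot a a ^ 2.
Proof.
  intros H1 H2. transitivity (dot a a * dot b b - dot a b ^ 2).
  - vec_ring.
  - rewrite H2, <- H1. ring.
Qed.

Lemma cross_nonzero_norm a b : cross a b <> mkvec 0 0 0 -> 0 < dot (cross a b) (cross a b).
Proof.
  generalize (cross a b). intros [[n1 n2] n3] H. unfold dot, cu, cv, cw, mkvec in *; simpl in *.
  assert (n1 <> 0 \/ n2 <> 0 \/ n3 <> 0) as [K|[K|K]].
  { destruct (Req_dec n1 0); [|tauto]. destruct (Req_dec n2 0); [|tauto]. destruct (Req_dec n3 0); [|tauto].
    subst. tauto. }
  all: apply Rsqr_pos_lt in K; unfold Rsqr in K; nra.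
Qed.

Lemma dot_scal_l k a b : dot (vscal k a) b = k * dot a b.
Proof. vec_ring. Qed.
Lemma dot_scal_r k a b : dot a (vscal k b) = k * dot a b.
Proof. vec_ring. Qed.
Lemma dot_add_l a a' b : dot (vadd a a') b = dot a b + dot a' b.
Proof. vec_ring. Qed.
Lemma dot_comm a b : dot a b = dot b a.
Proof. vec_ring. Qed.
Lemma dot_conformal_frame a b x y x' y' : dot a a = dot b b -> dot a b = 0 ->
  dot (vadd (vscal x a) (vscal y b)) (vadd (vscal x' a) (vscal y' b)) = dot a a * (x * x' + y * y').
Proof.
  intros HE HF. rewrite (dot_comm (vadd (vscal x a) _)), !dot_add_l, !dot_scal_l.
  rewrite !(dot_comm _ (vadd _ _)), !dot_add_l, !dot_scal_l, (dot_comm b a), HF, <- HE. ring.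
Qed.

Lemma dot_cross_l a b : dot a (cross a b) = 0.
Proof. vec_ring. Qed.
Lemma dot_cross_r a b : dot b (cross a b) = 0.
Proof. vec_ring. Qed.

(** The norm condition only gives mean curvature 1 or -1; the orientation induced by the mean
    curvature vector excludes -1. *)
Lemma mean_curvature_is_1 X z : 0 < cw (X z) -> cross (dx X z) (dy X z) <> mkvec 0 0 0 ->
  hdot (X z) (mean_curvature_vector X z) (mean_curvature_vector X z) = 1 ->
  0 < det3 (dx X z) (dy X z) (mean_curvature_vector X z) -> mean_curvature X z = 1.
Proof.
  intros Hw Hn. unfold mean_curvature_vector. set (k := mean_curvature X z). clearbody k.
  unfold hdot, det3, unit_normal. rewrite !dot_scal_l, !dot_scal_r.
  set (n := cross (dx X z) (dy X z)) in *. set (w := cw (X z)) in *.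
  pose proof (cross_nonzero_norm _ _ Hn) as Hp. fold n in Hp.
  set (S := sqrt (dot n n)). assert (HS : 0 < S) by (apply sqrt_lt_R0, Hp).
  assert (HS2 : dot n n = S * S) by (symmetry; apply sqrt_sqrt; lra). rewrite HS2.
  intros H1 H2.
  replace (k * (w / S * (k * (w / S * (S * S)))) / w ^ 2) with (k * k) in H1 by (field; lra).
  replace (k * (w / S * (S * S))) with (k * (w * S)) in H2 by (field; lra).
  assert (0 < w * S) by nra. assert (0 < k) by nra. nra.
Qed.

(** The difference of the two sides is tested on the frame [a], [b], [cross a b]: the first two
    products vanish by conformality, the third one is the mean curvature equation. *)
Lemma bryant_equation_from_curvature X z (aa bb : vec) :
  aa = dx (dx X) z -> bb = dy (dy X) z -> 0 < cw (X z) ->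
  cross (dx X z) (dy X z) <> mkvec 0 0 0 -> dot (dx X z) (dx X z) = dot (dy X z) (dy X z) ->
  dot (dx X z) (dy X z) = 0 -> mean_curvature X z = 1 ->
  dot (vadd aa bb) (dx X z) = 0 -> dot (vadd aa bb) (dy X z) = 0 ->
  bryant_equation (X z) (dx X z) (dy X z) (vadd aa bb).
Proof.
  intros -> -> Hw Hn HE HF Hm Ha Hb.
  revert Hm. unfold mean_curvature.
  set (q := X z) in *. set (a := dx X z) in *. set (b := dy X z) in *.
  set (aa := dx (dx X) z) in *. set (bb := dy (dy X) z) in *. set (ab := dx (dy X) z).
  unfold unit_normal.
  pose proof (cross_nonzero_norm _ _ Hn) as Hp. pose proof (conformal_cross_norm a b HE HF) as Hcr.
  assert (Hl : 0 < dot a a).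
  { assert (0 <= dot a a) by (unfold dot; nra). assert (dot a a <> 0) by (intros H0; rewrite H0 in Hcr; nra).
    lra. }
  assert (Hsq : sqrt (dot (cross a b) (cross a b)) = dot a a) by (rewrite Hcr; apply sqrt_pow2; lra).
  rewrite Hsq. unfold hdot. rewrite !dot_scal_r, HF, <- HE.
  set (w := cw q) in *. set (la := dot a a) in *. set (n := cross a b) in *.
  intros Hm.
  (* Mean curvature 1: the unit normal is n scaled by w / la, and both diagonal coefficients of the
     first fundamental form are la / w^2. *)
  assert (Hcov : dot (cov q a a aa) n + dot (cov q b b bb) n = 2 * la ^ 2 / w).
  { set (L := dot (cov q a a aa) n) in *. set (K := dot (cov q b b bb) n) in *.
    assert (Hm' : (la / w ^ 2 * (w / la * L / w ^ 2) - 2 * (0 / w ^ 2) * (w / la * dot (cov q a b ab) n / w ^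
      2)
       + la / w ^ 2 * (w / la * K / w ^ 2)) / (2 * (la / w ^ 2 * (la / w ^ 2) - (0 / w ^ 2) ^ 2)) = (L + K) *
         w / (2 * la ^ 2)).
    { field. repeat split; nra. }
    rewrite Hm' in Hm.
    replace (L + K) with ((L + K) * w / (2 * la ^ 2) * (2 * la ^ 2 / w)) by (field; lra).
    rewrite Hm. ring. }
  unfold bryant_equation. fold w.
  set (rhs := vadd _ (vadd _ _)).
  assert (Hz : vadd (vadd aa bb) (vscal (-1) rhs) = mkvec 0 0 0).
  { apply orthogonal_frame_zero with a b; auto; fold n.
    - rewrite dot_add_l, Ha, dot_scal_l. unfold rhs.
      rewrite !dot_add_l, !dot_scal_l, !dot_add_l, !dot_scal_l, (dot_comm b a), HF, (dot_comm (cross a b) a).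
      rewrite dot_cross_l, <- HE. fold la.
      unfold dot at 1. unfold mkvec, cu, cv; simpl. fold (cw a).
      change (cw (0, 0, - (la + la) / w)) with (- (la + la) / w). field. lra.
    - rewrite dot_add_l, Hb, dot_scal_l. unfold rhs.
      rewrite !dot_add_l, !dot_scal_l, !dot_add_l, !dot_scal_l, HF, (dot_comm (cross a b) b).
      rewrite dot_cross_r, <- HE. fold la.
      unfold dot at 1. unfold mkvec, cu, cv; simpl. fold (cw b).
      change (cw (0, 0, - (la + la) / w)) with (- (la + la) / w). field. lra.
    - rewrite dot_add_l, dot_scal_l. unfold rhs.
      rewrite !dot_add_l, !dot_scal_l, !dot_add_l, !dot_scal_l. unfold n. rewrite dot_cross_l, dot_cross_r.
      fold n. rewrite Hcr. rewrite <- HE. fold la.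
      unfold cov in Hcov. rewrite !dot_add_l, !dot_scal_l in Hcov. fold la in Hcov.
      rewrite <- HE in Hcov. unfold n in Hcov. rewrite dot_cross_l, dot_cross_r in Hcov. fold n w in Hcov.
      assert (Hk : forall x, dot (mkvec 0 0 x) n = x * cw n) by (intros; unfold dot, mkvec, cu, cv, cw;
        simpl; ring).
      rewrite !Hk in *.
      replace (dot aa n + dot bb n) with (2 * la ^ 2 / w - 2 * (la / w * cw n)).
      + field. lra.
      + rewrite <- Hcov. fold la. field. lra. }
  apply vec_eq; [apply (f_equal cu) in Hz|apply (f_equal cv) in Hz|apply (f_equal cw) in Hz];
  revert Hz; generalize (vadd aa bb); intros [[l1 l2] l3]; clearbody rhs; destruct rhs as [[r1 r2] r3];
  unfold vadd, vscal, mkvec, cu, cv, cw; simpl; intros; lra.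
Qed.

(** * Cauchy-Riemann equations for the flux density *)

(** The derivative of [density] when its arguments vary with velocities [q'], [a'] and [b']. *)
Definition density_differential (t0 t1 t2 : C) (q a b q' a' b' : vec) : C :=
  (quad' t1 t2 (fst q) * fst q' * d_z (Cconj (fst a)) (Cconj (fst b)) * RtoC (/ cw q ^ 2)
   + quad t0 t1 t2 (fst q) * d_z (Cconj (fst a')) (Cconj (fst b')) * RtoC (/ cw q ^ 2)
   - RtoC 2 * quad t0 t1 t2 (fst q) * d_z (Cconj (fst a)) (Cconj (fst b)) * RtoC (cw q' / cw q ^ 3)
   + RtoC 2 * t2 * fst q' * d_z (RtoC (cw a)) (RtoC (cw b)) * RtoC (/ cw q)
   + quad' t1 t2 (fst q) * d_z (RtoC (cw a')) (RtoC (cw b')) * RtoC (/ cw q)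
   - quad' t1 t2 (fst q) * d_z (RtoC (cw a)) (RtoC (cw b)) * RtoC (cw q' / cw q ^ 2)
   - t2 * d_z (fst a') (fst b'))%C.

(** Call by value keeps the terms small: nested complex products are evaluated before their
    components are duplicated. *)
Ltac unfold_fields := cbv beta iota zeta delta [density_differential density volume_potential killing quad
  quad' d_z
    hdot dot cross vadd vscal mkvec cu cv cw Cminus Copp Cplus Cmult RtoC Cconj Ci Re Im fst snd].

Definition is_vderive (f : R -> vec) (t : R) (l : vec) : Prop :=
  is_derive (fun s => cu (f s)) t (cu l) /\ is_derive (fun s => cv (f s)) t (cv l) /\
  is_derive (fun s => cw (f s)) t (cw l).


Definition cder (f : R -> C) (t : R) (l : C) : Prop :=
  is_derive (fun s => Re (f s)) t (Re l) /\ is_derive (fun s => Im (f s)) t (Im l).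

Lemma cder_const c t : cder (fun _ => c) t (RtoC 0).
Proof. split; apply rder_const. Qed.

Lemma cder_plus (f g : R -> C) (t : R) (l m : C) : cder f t l -> cder g t m ->
  cder (fun s => f s + g s)%C t (l + m)%C.
Proof.
  intros [H1 H2] [H3 H4]. split.
  - apply (is_derive_plus (fun s => Re (f s)) (fun s => Re (g s))); assumption.
  - apply (is_derive_plus (fun s => Im (f s)) (fun s => Im (g s))); assumption.
Qed.

Lemma cder_opp (f : R -> C) (t : R) (l : C) : cder f t l -> cder (fun s => - f s)%C t (- l)%C.
Proof.
  intros [H1 H2]. split.
  - apply (is_derive_opp (fun s => Re (f s))); assumption.
  - apply (is_derive_opp (fun s => Im (f s))); assumption.
Qed.

Lemma cder_minus (f g : R -> C) (t : R) (l m : C) : cder f t l -> cder g t m ->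
  cder (fun s => f s - g s)%C t (l - m)%C.
Proof. intros. apply cder_plus; auto using cder_opp. Qed.

Lemma cder_mult (f g : R -> C) (t : R) (l m : C) : cder f t l -> cder g t m ->
  cder (fun s => f s * g s)%C t (l * g t + f t * m)%C.
Proof.
  intros [H1 H2] [H3 H4]. split.
  - evar_last.
    + apply (rder_minus (fun s => Re (f s) * Re (g s)) (fun s => Im (f s) * Im (g s))); apply rder_mult;
      eassumption.
    + destruct l, m, (f t), (g t). simpl. ring.
  - evar_last.
    + apply (rder_plus (fun s => Re (f s) * Im (g s)) (fun s => Im (f s) * Re (g s))); apply rder_mult;
      eassumption.
    + destruct l, m, (f t), (g t). simpl. ring.
Qed.

Lemma cder_conj (f : R -> C) (t : R) (l : C) : cder f t l -> cder (fun s => Cconj (f s)) t (Cconj l).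
Proof. intros [H1 H2]. split; auto. apply rder_opp, H2. Qed.

Lemma cder_RtoC (f : R -> R) (t l : R) : is_derive f t l -> cder (fun s => RtoC (f s)) t (RtoC l).
Proof.
  intros H. split; [exact H|]. change (is_derive (fun _ : R => 0) t 0).
  apply rder_const.
Qed.

Lemma cder_d_z (f g : R -> C) (t : R) (l m : C) : cder f t l -> cder g t m ->
  cder (fun s => d_z (f s) (g s)) t (d_z l m).
Proof.
  intros [H1 H2] [H3 H4]. split.
  - apply (is_derive_ext (fun s => /2 * (Re (f s) + Im (g s)))).
    { intros s. unfold d_z; simpl. field. }
    evar_last. apply is_derive_scal. apply rder_plus; eassumption. simpl. field.
  - apply (is_derive_ext (fun s => /2 * (Im (f s) - Re (g s)))).
    { intros s. unfold d_z; simpl. field. }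
    evar_last. apply is_derive_scal. apply rder_minus; eassumption. simpl. field.
Qed.

Lemma cder_eq f t l m : cder f t l -> l = m -> cder f t m.
Proof. intros H <-. exact H. Qed.

Lemma is_vderive_cder q t q' : is_vderive q t q' -> cder (fun s => fst (q s)) t (fst q').
Proof. intros (H1 & H2 & _). split; assumption. Qed.

Lemma cder_quad t0 t1 t2 f t l : cder f t l ->
  cder (fun s => quad t0 t1 t2 (f s)) t (quad' t1 t2 (f t) * l)%C.
Proof.
  intros H. eapply cder_eq.
  - unfold quad. apply cder_plus; [apply cder_plus|apply cder_mult; [apply cder_const|apply cder_mult;
    exact H]].
    apply cder_const. apply cder_mult; [apply cder_const|exact H].
  - unfold quad'. simpl. unfold RtoC. rewrite ?RtoC_plus. ring_simplify.
    destruct t1, t2, l, (f t). apply injective_projections; simpl; ring.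
Qed.

Lemma cder_quad' t1 t2 f t l : cder f t l -> cder (fun s => quad' t1 t2 (f s)) t (RtoC 2 * t2 * l)%C.
Proof.
  intros H. eapply cder_eq.
  - unfold quad'. apply cder_plus; [apply cder_const|].
    apply cder_mult; [apply cder_const|apply cder_mult; [apply cder_const|exact H]].
  - destruct t1, t2, l, (f t). apply injective_projections; simpl; ring.
Qed.

Lemma density_derivative t0 t1 t2 q a b t q' a' b' : cw (q t) <> 0 ->
  is_vderive q t q' -> is_vderive a t a' -> is_vderive b t b' ->
  cder (fun s => density t0 t1 t2 (q s) (a s) (b s)) t
    (density_differential t0 t1 t2 (q t) (a t) (b t) q' a' b').
Proof.
  intros Hw Hq Ha Hb. pose proof (is_vderive_cder _ _ _ Hq) as Cq.
  pose proof (is_vderive_cder _ _ _ Ha) as Ca. pose proof (is_vderive_cder _ _ _ Hb) as Cb.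
  destruct Hq as (_ & _ & Hqw), Ha as (_ & _ & Haw), Hb as (_ & _ & Hbw).
  assert (Hw2 : cw (q t) ^ 2 <> 0) by (apply pow_nonzero, Hw).
  eapply cder_eq.
  - unfold density. apply cder_minus; [apply cder_plus|].
    + apply cder_mult; [apply cder_mult|].
      * apply cder_quad, Cq.
      * apply cder_d_z; apply cder_conj; eassumption.
      * apply cder_RtoC, rder_inv; [exact Hw2|apply rder_pow2, Hqw].
    + apply cder_mult; [apply cder_mult|].
      * apply cder_quad', Cq.
      * apply cder_d_z; apply cder_RtoC; eassumption.
      * apply cder_RtoC, rder_inv; [exact Hw|apply Hqw].
    + apply cder_mult; [apply cder_const|apply cder_d_z; eassumption].
  - unfold density_differential.
    set (Q := quad t0 t1 t2 (fst (q t))). set (Q' := quad' t1 t2 (fst (q t))).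
    set (D1 := d_z _ _). set (D2 := d_z _ _). set (D3 := d_z _ _). set (D4 := d_z _ _). set (D5 := d_z _ _).
      set (D6 := d_z _ _).
    replace (RtoC (- (2 * cw (q t) * cw q') / (cw (q t) ^ 2) ^ 2)) with (- (RtoC 2 * RtoC (cw q' / cw (q t) ^
      3)))%C.
    2:{ apply injective_projections; simpl; field; auto. }
    replace (RtoC (- cw q' / cw (q t) ^ 2)) with (- RtoC (cw q' / cw (q t) ^ 2))%C.
    2:{ apply injective_projections; simpl; field; auto. }
    ring.
Qed.

Definition csmooth (n : nat) (W : R -> R -> Prop) (f : R -> R -> C) : Prop :=
  smooth n W (fun x y => Re (f x y)) /\ smooth n W (fun x y => Im (f x y)).

Lemma csmooth_const n W c : open2 W -> csmooth n W (fun _ _ => c).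
Proof. intros; split; apply smooth_const; assumption. Qed.

Lemma csmooth_plus n W (f g : R -> R -> C) : open2 W -> csmooth n W f -> csmooth n W g ->
  csmooth n W (fun x y => f x y + g x y)%C.
Proof. intros HW [H1 H2] [H3 H4]. split; [apply (smooth_plus n W _ _ HW H1 H3)|apply (smooth_plus n W _ _ HW
  H2 H4)]. Qed.

Lemma csmooth_opp n W (f : R -> R -> C) : open2 W -> csmooth n W f -> csmooth n W (fun x y => - f x y)%C.
Proof. intros HW [H1 H2]. split; [apply (smooth_opp n W _ HW H1)|apply (smooth_opp n W _ HW H2)]. Qed.

Lemma csmooth_mult n W (f g : R -> R -> C) : open2 W -> csmooth n W f -> csmooth n W g ->
  csmooth n W (fun x y => f x y * g x y)%C.
Proof.
  intros HW [H1 H2] [H3 H4]. split.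
  - apply smooth_minus; auto; apply smooth_mult; auto.
  - apply smooth_plus; auto; apply smooth_mult; auto.
Qed.

Lemma csmooth_conj n W (f : R -> R -> C) : open2 W -> csmooth n W f -> csmooth n W (fun x y => Cconj (f x y)).
Proof. intros HW [H1 H2]. split; [exact H1|apply (smooth_opp n W _ HW H2)]. Qed.

Lemma csmooth_RtoC n W (f : R -> R -> R) : open2 W -> smooth n W f -> csmooth n W (fun x y => RtoC (f x y)).
Proof. intros HW H1. split; [exact H1|exact (smooth_const n W 0 HW)]. Qed.

Lemma csmooth_d_z n W (f g : R -> R -> C) : open2 W -> csmooth n W f -> csmooth n W g ->
  csmooth n W (fun x y => d_z (f x y) (g x y)).
Proof.
  intros HW [H1 H2] [H3 H4]. unfold d_z. split; simpl; unfold Rdiv; apply smooth_mult;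
    auto using smooth_const.
  - apply smooth_plus; auto.
  - apply smooth_minus; auto.
Qed.

Lemma csmooth_quad n W t0 t1 t2 f : open2 W -> csmooth n W f ->
  csmooth n W (fun x y => quad t0 t1 t2 (f x y)).
Proof. intros HW H. unfold quad. repeat first [apply csmooth_plus|apply csmooth_mult|apply
  csmooth_const|assumption]. Qed.

Lemma csmooth_quad' n W t1 t2 f : open2 W -> csmooth n W f -> csmooth n W (fun x y => quad' t1 t2 (f x y)).
Proof. intros HW H. unfold quad'. repeat first [apply csmooth_plus|apply csmooth_mult|apply
  csmooth_const|assumption]. Qed.

Definition vsmooth (n : nat) (W : R -> R -> Prop) (f : R -> R -> vec) : Prop :=
  smooth n W (fun x y => cu (f x y)) /\ smooth n W (fun x y => cv (f x y)) /\ smooth n W (fun x y => cw (f x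
    y)).

Lemma vsmooth_csmooth n W f : vsmooth n W f -> csmooth n W (fun x y => fst (f x y)).
Proof. intros (H1 & H2 & _). split; assumption. Qed.

Lemma density_smooth n W t0 t1 t2 q a b : open2 W -> (forall x y, W x y -> cw (q x y) <> 0) ->
  vsmooth n W q -> vsmooth n W a -> vsmooth n W b ->
  csmooth n W (fun x y => density t0 t1 t2 (q x y) (a x y) (b x y)).
Proof.
  intros HW Hw Hq Ha Hb. pose proof (vsmooth_csmooth _ _ _ Hq) as Cq.
  pose proof (vsmooth_csmooth _ _ _ Ha) as Ca. pose proof (vsmooth_csmooth _ _ _ Hb) as Cb.
  destruct Hq as (_ & _ & Hqw), Ha as (_ & _ & Haw), Hb as (_ & _ & Hbw).
  unfold density. apply csmooth_plus, csmooth_opp; auto; [apply csmooth_plus; auto|].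
  - apply csmooth_mult; [auto|apply csmooth_mult; auto|].
    + apply csmooth_quad; auto.
    + apply csmooth_d_z; auto; apply csmooth_conj; auto.
    + apply csmooth_RtoC; auto. apply smooth_inv; auto. intros x y Hxy; apply pow_nonzero, Hw, Hxy.
      apply smooth_pow; auto.
  - apply csmooth_mult; [auto|apply csmooth_mult; auto|].
    + apply csmooth_quad'; auto.
    + apply csmooth_d_z; auto; apply csmooth_RtoC; auto.
    + apply csmooth_RtoC; auto. apply smooth_inv; auto.
  - apply csmooth_mult; auto using csmooth_const, csmooth_d_z.
Qed.

(** The second derivatives enter through [ab] and, in one combination, through [vadd aa bb];
    the latter is replaced by first derivatives with the Bryant equation. *)
Lemma density_cauchy_riemann t0 t1 t2 q a b aa ab bb : cw q <> 0 ->
  bryant_equation q a b (vadd aa bb) ->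
  (density_differential t0 t1 t2 q a b b ab bb = Ci * density_differential t0 t1 t2 q a b a aa ab)%C.
Proof.
  destruct t0 as [t0r t0i], t1 as [t1r t1i], t2 as [t2r t2i], q as [[u v] w].
  destruct a as [[a1 a2] a3], b as [[b1 b2] b3], aa as [[aa1 aa2] aa3], ab as [[ab1 ab2] ab3],
    bb as [[bb1 bb2] bb3].
  unfold bryant_equation. intros Hw He.
  assert (E1 := f_equal cu He). assert (E2 := f_equal cv He). assert (E3 := f_equal cw He). clear He.
  revert Hw E1 E2 E3.
  unfold_fields. intros Hw E1 E2 E3.
  assert (bb1 = 2 / w * (a3 * a1 + b3 * b1) + (0 + 2 / w * (a2 * b3 - a3 * b2)) - aa1) by lra.
  assert (bb2 = 2 / w * (a3 * a2 + b3 * b2) + (0 + 2 / w * (a3 * b1 - a1 * b3)) - aa2) by lra.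
  assert (bb3 = 2 / w * (a3 * a3 + b3 * b3) +
     (- (a1 * a1 + a2 * a2 + a3 * a3 + (b1 * b1 + b2 * b2 + b3 * b3)) / w + 2 / w * (a1 * b2 - a2 * b1)) -
       aa3) by lra.
  clear E1 E2 E3. subst. f_equal; field; exact Hw.
Qed.

(** * Holomorphic densities on a Bryant end *)

Lemma Cmod_le_max (x y e : R) : Rabs x <= e -> Rabs y <= e -> Cmod (x, y) <= 2 * e.
Proof.
  intros Hx Hy. pose proof (Cmod_2Rmax (x, y)) as H. simpl in H.
  assert (Rmax (Rabs x) (Rabs y) <= e) by (apply Rmax_lub; assumption).
  assert (sqrt 2 <= 2). { rewrite <- (sqrt_pow2 2) at 2 by lra. apply sqrt_le_1; lra. }
  pose proof (sqrt_pos 2). pose proof (Rabs_pos x).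
  assert (0 <= Rmax (Rabs x) (Rabs y)). { eapply Rle_trans; [exact H3|apply Rmax_l]. }
  nra.
Qed.

Lemma Cmod_ge_abs (x y : R) : Rabs x <= Cmod (x, y) /\ Rabs y <= Cmod (x, y).
Proof.
  pose proof (Rmax_Cmod (x, y)) as H. simpl in H.
  split; (eapply Rle_trans; [|exact H]); [apply Rmax_l|apply Rmax_r].
Qed.

(** Complex differentiability is real differentiability with a differential of the form
    l dz. *)
Lemma holomorphic_iff_differentiable (f : C -> C) (z l : C) :
  is_derive (K := C_AbsRing) (V := C_NormedModule) f z l <->
  differentiable_pt_lim (fun x y => Re (f (x, y))) (Re z) (Im z) (Re l) (- Im l) /\
  differentiable_pt_lim (fun x y => Im (f (x, y))) (Re z) (Im z) (Im l) (Re l).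
Proof.
  destruct z as [x0 y0]. destruct l as [a b]. cbn [Re Im fst snd]. split.
  - intros [_ H]. specialize (H (x0, y0) (fun P HP => HP)).
    assert (K : forall eps : posreal, exists d : posreal, forall x y,
      Rabs (x - x0) < d -> Rabs (y - y0) < d ->
       Cmod (f (x, y) - f (x0, y0) - ((x - x0)%R, (y - y0)%R) * (a,
         b))%C <= eps * Rmax (Rabs (x - x0)) (Rabs (y - y0))).
    { intros eps. assert (He : 0 < eps / 2) by (pose proof (cond_pos eps); lra).
      destruct (H (mkposreal _ He)) as [d Hd].
      assert (Hp : 0 < d / 2) by (pose proof (cond_pos d); lra). exists (mkposreal _ Hp). simpl.
      intros x y Hx Hy. specialize (Hd (x, y)).
      assert (Hc : Cmod ((x - x0)%R, (y - y0)%R) <= 2 * Rmax (Rabs (x - x0)) (Rabs (y - y0))).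
      { apply Cmod_le_max; [apply Rmax_l|apply Rmax_r]. }
      eapply Rle_trans; [apply Hd|].
      - change (Cmod ((x - x0)%R, (y - y0)%R) < d). eapply Rle_lt_trans; [exact Hc|].
        assert (Rmax (Rabs (x - x0)) (Rabs (y - y0)) < d / 2) by (apply Rmax_lub_lt; assumption). lra.
      - change (eps / 2 * Cmod ((x - x0)%R, (y - y0)%R) <= eps * Rmax (Rabs (x - x0)) (Rabs (y - y0))).
        simpl in He. nra. }
    split; intros eps; destruct (K eps) as [d Hd]; exists d; intros x y Hx Hy; specialize (Hd x y Hx Hy);
    (eapply Rle_trans; [|exact Hd]).
    + pose proof (proj1 (Cmod_ge_abs (Re (f (x, y) - f (x0, y0) - ((x - x0)%R, (y - y0)%R) * (a,
      b))%C) (Im (f (x, y) - f (x0, y0) - ((x - x0)%R, (y - y0)%R) * (a, b))%C))) as H1.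
      rewrite <- surjective_pairing in H1. eapply Rle_trans; [|exact H1]. right. f_equal.
      destruct (f (x, y)), (f (x0, y0)). simpl. ring.
    + pose proof (proj2 (Cmod_ge_abs (Re (f (x, y) - f (x0, y0) - ((x - x0)%R, (y - y0)%R) * (a,
      b))%C) (Im (f (x, y) - f (x0, y0) - ((x - x0)%R, (y - y0)%R) * (a, b))%C))) as H1.
      rewrite <- surjective_pairing in H1. eapply Rle_trans; [|exact H1]. right. f_equal.
      destruct (f (x, y)), (f (x0, y0)). simpl. ring.
  - intros [H1 H2]. split; [apply is_linear_scal_l|].
    intros z Hz.
    assert (Hz' : (x0, y0) = z) by exact (is_filter_lim_locally_unique (V := AbsRing_NormedModule C_AbsRing)
      (x0, y0) z Hz).
    rewrite <- Hz'. clear z Hz Hz'.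
    intros eps. assert (He : 0 < eps / 2) by (pose proof (cond_pos eps); lra).
    destruct (H1 (mkposreal _ He)) as [d1 Hd1]. destruct (H2 (mkposreal _ He)) as [d2 Hd2].
    assert (Hm : 0 < Rmin d1 d2) by (apply Rmin_pos; apply cond_pos).
    exists (mkposreal _ Hm). intros [x y] Hxy. change (Cmod ((x - x0)%R, (y - y0)%R) < Rmin d1 d2) in Hxy.
    pose proof (Rmin_l d1 d2). pose proof (Rmin_r d1 d2).
    destruct (Cmod_ge_abs (x - x0) (y - y0)) as [G1 G2].
    assert (Hmax : Rmax (Rabs (x - x0)) (Rabs (y - y0)) <= Cmod ((x - x0)%R,
      (y - y0)%R)) by apply (Rmax_Cmod ((x - x0)%R, (y - y0)%R)).
    change (Cmod (f (x, y) - f (x0, y0) - ((x - x0)%R, (y - y0)%R) * (a, b))%C <= eps * Cmod ((x - x0)%R,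
      (y - y0)%R)).
    specialize (Hd1 x y). specialize (Hd2 x y). simpl in Hd1, Hd2.
    replace (eps * Cmod ((x - x0)%R, (y - y0)%R)) with (2 * (eps / 2 * Cmod ((x - x0)%R,
      (y - y0)%R))) by field.
    match goal with |- Cmod ?c <= _ => rewrite (surjective_pairing c) end.
    apply Cmod_le_max.
    + eapply Rle_trans; [|eapply Rle_trans; [apply Hd1; lra|apply Rmult_le_compat_l; [lra|exact Hmax]]].
      right. f_equal. destruct (f (x, y)), (f (x0, y0)). simpl. ring.
    + eapply Rle_trans; [|eapply Rle_trans; [apply Hd2; lra|apply Rmult_le_compat_l; [lra|exact Hmax]]].
      right. f_equal. destruct (f (x, y)), (f (x0, y0)). simpl. ring.
Qed.

Lemma holomorphic_comp_curve (f : C -> C) (g : R -> C) (t : R) (l m : C) :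
  is_derive (K := C_AbsRing) (V := C_NormedModule) f (g t) l -> cder g t m ->
  cder (fun s => f (g s)) t (l * m)%C.
Proof.
  intros Hf [H1 H2]. apply holomorphic_iff_differentiable in Hf. destruct Hf as [F1 F2].
  split.
  - apply (is_derive_ext (fun s => Re (f (Re (g s), Im (g s))))).
    { intros s. destruct (g s); reflexivity. }
    evar_last. apply is_derive_Reals.
    + apply (derivable_pt_lim_comp_2d (fun x y => Re (f (x, y))) (fun s => Re (g s)) (fun s => Im (g s))).
      exact F1. apply is_derive_Reals, H1. apply is_derive_Reals, H2.
    + destruct l, m; simpl; ring.
  - apply (is_derive_ext (fun s => Im (f (Re (g s), Im (g s))))).
    { intros s. destruct (g s); reflexivity. }
    evar_last. apply is_derive_Reals.
    + apply (derivable_pt_lim_comp_2d (fun x y => Im (f (x, y))) (fun s => Re (g s)) (fun s => Im (g s))).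
      exact F2. apply is_derive_Reals, H1. apply is_derive_Reals, H2.
    + destruct l, m; simpl; ring.
Qed.

Definition on_plane (P : C -> Prop) (x y : R) : Prop := P (x, y).
Definition vec_field (f : C -> vec) (x y : R) : vec := f (x, y).

Lemma open_open2 (P : C -> Prop) : open P -> open2 (on_plane P).
Proof.
  intros H x y Hp. destruct (H (x, y) Hp) as [d Hd]. exists d. intros u v Hu Hv.
  apply (Hd (u, v)). split; assumption.
Qed.

Lemma open_punctured Om : open Om -> open (punctured Om).
Proof.
  intros H z [Hz Hn].
  assert (Hm : 0 < Cmod z / 2) by (apply Cmod_gt_0 in Hn; lra).
  destruct (H z Hz) as [d Hd].
  assert (Hp : 0 < Rmin d (Cmod z / 2)) by (apply Rmin_pos; [apply cond_pos|exact Hm]).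
  exists (mkposreal _ Hp). intros y Hy. split.
  - apply Hd. destruct Hy as [H1 H2]. split; eapply Rlt_le_trans;
    [exact H1|apply Rmin_l|exact H2|apply Rmin_l].
  - intros ->. destruct Hy as [H1 H2]. destruct z as [a b]. simpl in *.
    change (Rabs (0 - a) < Rmin d (Cmod (a, b) / 2)) in H1.
      change (Rabs (0 - b) < Rmin d (Cmod (a, b) / 2)) in H2.
    rewrite Rminus_0_l, Rabs_Ropp in H1, H2.
    pose proof (Rmin_r d (Cmod (a, b) / 2)).
    assert (K : Cmod (a, b) <= 2 * Rmax (Rabs a) (Rabs b)) by (apply Cmod_le_max;
      [apply Rmax_l|apply Rmax_r]).
    assert (Rmax (Rabs a) (Rabs b) < Cmod (a, b) / 2) by (apply Rmax_lub_lt; lra). lra.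
Qed.

Lemma vsmooth_is_dx n W f x y : vsmooth (S n) W (vec_field f) -> W x y ->
  is_vderive (fun s => f (s, y)) x (dx f (x, y)).
Proof.
  intros (H1 & H2 & H3) Hw. split; [|split].
  - apply (smooth_is_px n W _ x y H1 Hw).
  - apply (smooth_is_px n W _ x y H2 Hw).
  - apply (smooth_is_px n W _ x y H3 Hw).
Qed.

Lemma vsmooth_is_dy n W f x y : vsmooth (S n) W (vec_field f) -> W x y ->
  is_vderive (fun s => f (x, s)) y (dy f (x, y)).
Proof.
  intros (H1 & H2 & H3) Hw. split; [|split].
  - apply (smooth_is_py n W _ x y H1 Hw).
  - apply (smooth_is_py n W _ x y H2 Hw).
  - apply (smooth_is_py n W _ x y H3 Hw).
Qed.

Lemma vsmooth_dx n W f : vsmooth (S n) W (vec_field f) -> vsmooth n W (vec_field (dx f)).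
Proof.
  intros (H1 & H2 & H3). split; [|split].
  - exact (smooth_px n W _ H1).
  - exact (smooth_px n W _ H2).
  - exact (smooth_px n W _ H3).
Qed.

Lemma vsmooth_dy n W f : vsmooth (S n) W (vec_field f) -> vsmooth n W (vec_field (dy f)).
Proof.
  intros (H1 & H2 & H3). split; [|split].
  - exact (smooth_py n W _ H1).
  - exact (smooth_py n W _ H2).
  - exact (smooth_py n W _ H3).
Qed.

Lemma vsmooth_schwarz W f x y : open2 W -> vsmooth 2 W (vec_field f) -> W x y ->
  dx (dy f) (x, y) = dy (dx f) (x, y).
Proof.
  intros HW (H1 & H2 & H3) Hw.
  apply vec_eq.
  - exact (smooth_schwarz W _ x y HW H1 Hw).
  - exact (smooth_schwarz W _ x y HW H2 Hw).
  - exact (smooth_schwarz W _ x y HW H3 Hw).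
Qed.

Lemma vsmooth_le n m W f : (m <= n)%nat -> vsmooth n W f -> vsmooth m W f.
Proof. intros H (H1 & H2 & H3). repeat split; eapply smooth_le; eauto. Qed.

Lemma rder_dot f g t f' g' : is_vderive f t f' -> is_vderive g t g' ->
  is_derive (fun s => dot (f s) (g s)) t (dot f' (g t) + dot (f t) g').
Proof.
  intros (F1 & F2 & F3) (G1 & G2 & G3). unfold dot. evar_last.
  - apply rder_plus; [apply rder_plus|]; apply rder_mult; eassumption.
  - cbv beta. ring.
Qed.

Lemma bryant_end_smooth Om X : bryant_end Om X ->
  open2 (on_plane (punctured Om)) /\ vsmooth 2 (on_plane (punctured Om)) (vec_field X) /\
  forall x y, on_plane (punctured Om) x y -> cw (X (x, y)) <> 0.
Proof.
  intros (HO & _ & H). split; [apply open_open2, open_punctured, HO|]. split.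
  - split; [|split]; intros x y Hw; apply (H (x, y) Hw).
  - intros x y Hw. destruct (H (x, y) Hw) as (Hp & _). lra.
Qed.

Lemma bryant_end_conformal Om X x y : bryant_end Om X -> on_plane (punctured Om) x y ->
  dot (dx X (x, y)) (dx X (x, y)) = dot (dy X (x, y)) (dy X (x, y)) /\
  dot (dx X (x, y)) (dy X (x, y)) = 0.
Proof.
  intros (HO & _ & H) Hw. destruct (H (x, y) Hw) as (Hp & _ & _ & HE & HF & _).
  unfold hdot in *. assert (Hw2 : cw (X (x, y)) ^ 2 <> 0) by (apply pow_nonzero; lra).
  split.
  - apply (f_equal (fun r => r * cw (X (x, y)) ^ 2)) in HE. unfold Rdiv in HE.
    rewrite !Rmult_assoc, !Rinv_l, !Rmult_1_r in HE by assumption. exact HE.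
  - apply (f_equal (fun r => r * cw (X (x, y)) ^ 2)) in HF. unfold Rdiv in HF.
    rewrite !Rmult_assoc, !Rinv_l, !Rmult_1_r, Rmult_0_l in HF by assumption. exact HF.
Qed.

(** Differentiating the two conformality relations shows that the Laplacian is orthogonal to
    both partial derivatives; the normal component is given by the mean curvature. *)
Lemma bryant_end_equation Om X x y : bryant_end Om X -> on_plane (punctured Om) x y ->
  bryant_equation (X (x, y)) (dx X (x, y)) (dy X (x, y)) (vadd (dx (dx X) (x, y)) (dy (dy X) (x, y))).
Proof.
  intros HB Hw. destruct (bryant_end_smooth Om X HB) as (HW & HS & _).
  destruct (bryant_end_conformal Om X x y HB Hw) as [HE HF].
  pose proof (vsmooth_dx _ _ _ HS) as Sx. pose proof (vsmooth_dy _ _ _ HS) as Sy.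
  pose proof (vsmooth_is_dx _ _ _ _ _ Sx Hw) as Dxx. pose proof (vsmooth_is_dy _ _ _ _ _ Sx Hw) as Dxy.
  pose proof (vsmooth_is_dx _ _ _ _ _ Sy Hw) as Dyx. pose proof (vsmooth_is_dy _ _ _ _ _ Sy Hw) as Dyy.
  rewrite (vsmooth_schwarz _ X x y HW HS Hw) in Dyx.
  set (E := fun x y => dot (dx X (x, y)) (dx X (x, y)) - dot (dy X (x, y)) (dy X (x, y))).
  set (F := fun x y => dot (dx X (x, y)) (dy X (x, y))).
  assert (E0 : forall x y, on_plane (punctured Om) x y -> E x y = 0).
  { intros u v Huv. destruct (bryant_end_conformal Om X u v HB Huv) as [K _]. unfold E. rewrite K. ring. }
  assert (F0 : forall x y, on_plane (punctured Om) x y -> F x y = 0).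
  { intros u v Huv. apply (bryant_end_conformal Om X u v HB Huv). }
  assert (Ex := vanishing_derivative_x _ E x y _ HW E0 Hw (rder_minus _ _ _ _ _ (rder_dot _ _ _ _ _ Dxx Dxx)
    (rder_dot _ _ _ _ _ Dyx Dyx))).
  assert (Ey := vanishing_derivative_y _ E x y _ HW E0 Hw (rder_minus _ _ _ _ _ (rder_dot _ _ _ _ _ Dxy Dxy)
    (rder_dot _ _ _ _ _ Dyy Dyy))).
  assert (Fx := vanishing_derivative_x _ F x y _ HW F0 Hw (rder_dot _ _ _ _ _ Dxx Dyx)).
  assert (Fy := vanishing_derivative_y _ F x y _ HW F0 Hw (rder_dot _ _ _ _ _ Dxy Dyy)).
  cbv beta in Ex, Ey, Fx, Fy.
  destruct HB as (HO & _ & H). destruct (H (x, y) Hw) as (Hp & _ & Hn & _ & _ & HH & Hdet).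
  apply bryant_equation_from_curvature; auto.
  - apply mean_curvature_is_1; auto.
  - rewrite dot_add_l, (dot_comm (dy (dy X) (x, y))).
    rewrite (dot_comm (dx X (x, y)) (dx (dx X) (x, y))) in Ex.
    rewrite (dot_comm (dy (dx X) (x, y)) (dy X (x, y))) in Ex, Fy.  lra.
  - rewrite dot_add_l.
    rewrite (dot_comm (dx X (x, y)) (dy (dx X) (x, y))) in Ey, Fx.
    rewrite (dot_comm (dy X (x, y)) (dy (dy X) (x, y))) in Ey. lra.
Qed.

Definition surface_density (X : C -> vec) (t0 t1 t2 : C) (z : C) : C :=
  density t0 t1 t2 (X z) (dx X z) (dy X z).

Definition re_density (X : C -> vec) (t0 t1 t2 : C) (x y : R) : R := Re (surface_density X t0 t1 t2 (x, y)).
Definition im_density (X : C -> vec) (t0 t1 t2 : C) (x y : R) : R := Im (surface_density X t0 t1 t2 (x, y)).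

Lemma surface_density_smooth Om X t0 t1 t2 : bryant_end Om X ->
  csmooth 1 (on_plane (punctured Om)) (fun x y => surface_density X t0 t1 t2 (x, y)).
Proof.
  intros HB. destruct (bryant_end_smooth Om X HB) as (HW & HS & Hw).
  apply (density_smooth 1 _ t0 t1 t2 (vec_field X) (vec_field (dx X)) (vec_field (dy X))); auto.
  - apply vsmooth_le with 2%nat; auto.
  - apply vsmooth_dx, HS.
  - apply vsmooth_dy, HS.
Qed.

Lemma surface_density_cauchy_riemann Om X t0 t1 t2 x y : bryant_end Om X -> on_plane (punctured Om) x y ->
  px (re_density X t0 t1 t2) x y = py (im_density X t0 t1 t2) x y /\
  py (re_density X t0 t1 t2) x y = - px (im_density X t0 t1 t2) x y.
Proof.
  intros HB Hxy. destruct (bryant_end_smooth Om X HB) as (HW & HS & Hw).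
  pose proof (vsmooth_dx _ _ _ HS) as Sx. pose proof (vsmooth_dy _ _ _ HS) as Sy.
  pose proof (vsmooth_is_dx _ _ _ _ _ HS Hxy) as Dx. pose proof (vsmooth_is_dy _ _ _ _ _ HS Hxy) as Dy.
  pose proof (vsmooth_is_dx _ _ _ _ _ Sx Hxy) as Dxx. pose proof (vsmooth_is_dy _ _ _ _ _ Sx Hxy) as Dxy.
  pose proof (vsmooth_is_dx _ _ _ _ _ Sy Hxy) as Dyx. pose proof (vsmooth_is_dy _ _ _ _ _ Sy Hxy) as Dyy.
  rewrite (vsmooth_schwarz _ X x y HW HS Hxy) in Dyx.
  destruct (density_derivative t0 t1 t2 _ _ _ x _ _ _ (Hw x y Hxy) Dx Dxx Dyx) as [X1 X2].
  destruct (density_derivative t0 t1 t2 _ _ _ y _ _ _ (Hw x y Hxy) Dy Dxy Dyy) as [Y1 Y2].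
  pose proof (density_cauchy_riemann t0 t1 t2 _ _ _ _ (dy (dx X) (x,
    y)) _ (Hw x y Hxy) (bryant_end_equation Om X x y HB Hxy)) as E.
  apply is_derive_unique in X1, X2, Y1, Y2. rewrite E in Y1, Y2.
  split.
  - etransitivity; [exact X1|]. symmetry. etransitivity; [exact Y2|].
    destruct (density_differential _ _ _ _ _ _ _ _ _). simpl. ring.
  - etransitivity; [exact Y1|].
    transitivity (- Im (density_differential t0 t1 t2 (X (x, y)) (dx X (x, y)) (dy X (x, y))
        (dx X (x, y)) (dx (dx X) (x, y)) (dy (dx X) (x, y)))).
    + destruct (density_differential _ _ _ _ _ _ _ _ _). simpl. ring.
    + f_equal. symmetry. exact X2.
Qed.


(** Class C^1 comes from the regularity of the immersion, the Cauchy-Riemann equations from its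
    mean curvature. *)
Lemma surface_density_holomorphic Om X t0 t1 t2 : bryant_end Om X ->
  holomorphic_on (punctured Om) (surface_density X t0 t1 t2).
Proof.
  intros HB [x y] Hxy. destruct (bryant_end_smooth Om X HB) as (HW & _ & _).
  destruct (surface_density_smooth Om X t0 t1 t2 HB) as [S1 S2].
  destruct (surface_density_cauchy_riemann Om X t0 t1 t2 x y HB Hxy) as [C1 C2].
  exists (px (re_density X t0 t1 t2) x y, px (im_density X t0 t1 t2) x y).
  apply holomorphic_iff_differentiable. split.
  - pose proof (smooth_differentiable 0 _ (re_density X t0 t1 t2) x y HW S1 Hxy) as D. rewrite C2 in D.
    exact D.
  - pose proof (smooth_differentiable 0 _ (im_density X t0 t1 t2) x y HW S2 Hxy) as D. rewrite <- C1 in D.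
    exact D.
Qed.

Lemma surface_density_closed_re Om X t0 t1 t2 : bryant_end Om X ->
  closed_form (on_plane (punctured Om)) (re_density X t0 t1 t2)
    (fun x y => - Im (surface_density X t0 t1 t2 (x, y))).
Proof.
  intros HB. destruct (bryant_end_smooth Om X HB) as (HW & _ & _).
  destruct (surface_density_smooth Om X t0 t1 t2 HB) as [S1 S2].
  split; [exact HW|split; [exact S1|split]].
  - apply (smooth_opp 1 _ (im_density X t0 t1 t2)); auto.
  - intros x y Hxy. rewrite (proj2 (surface_density_cauchy_riemann Om X t0 t1 t2 x y HB Hxy)).
    symmetry. apply is_derive_unique.
    apply (rder_opp (fun x => Im (surface_density X t0 t1 t2 (x, y)))). apply (smooth_is_px 0 _ _ x y S2 Hxy).
Qed.

Lemma surface_density_closed_im Om X t0 t1 t2 : bryant_end Om X ->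
  closed_form (on_plane (punctured Om)) (im_density X t0 t1 t2)
    (re_density X t0 t1 t2).
Proof.
  intros HB. destruct (bryant_end_smooth Om X HB) as (HW & _ & _).
  destruct (surface_density_smooth Om X t0 t1 t2 HB) as [S1 S2].
  split; [exact HW|split; [exact S2|split; [exact S1|]]].
  intros x y Hxy. symmetry. apply (surface_density_cauchy_riemann Om X t0 t1 t2 x y HB Hxy).
Qed.

(** * Circle integrals around the puncture *)

Definition circle_form (al be : R -> R -> R) (r : R) : R -> R :=
  form_along al be (fun t => r * cos t) (fun t => r * sin t) (fun t => - (r * sin t)) (fun t => r * cos t).

Lemma circle_C1 r t : C1_curve (fun t => r * cos t) (fun t => r * sin t) (fun t => - (r * sin t)) (fun t => r
  * cos t) t.
Proof.
  split; [|split; [|split]].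
  - auto_derive; auto; ring.
  - auto_derive; auto; ring.
  - apply (is_derive_continuous _ t (- (r * cos t))). auto_derive; auto; ring.
  - apply (is_derive_continuous _ t (- (r * sin t))). auto_derive; auto; ring.
Qed.

Lemma Cmod_polar r t : 0 <= r -> Cmod (r * cos t, r * sin t) = r.
Proof.
  intros Hr. unfold Cmod. cbn [fst snd]. pose proof (sin2_cos2 t) as Hs. unfold Rsqr in Hs.
  replace ((r * cos t) ^ 2 + (r * sin t) ^ 2) with (r ^ 2 * (sin t * sin t + cos t * cos t)) by ring.
  rewrite Hs, Rmult_1_r. apply sqrt_pow2, Hr.
Qed.

Definition disc_in (Om : C -> Prop) (r : R) : Prop := 0 < r /\ forall z, Cmod z <= r -> Om z.

Lemma polar_punctured Om r s t : disc_in Om r -> 0 < s <= r ->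
  on_plane (punctured Om) (s * cos t) (s * sin t).
Proof.
  intros [Hr HD] Hs. split.
  - apply HD. rewrite Cmod_polar; lra.
  - intros H. apply (f_equal Cmod) in H. rewrite Cmod_polar, Cmod_0 in H; lra.
Qed.

Lemma continuity_2d_polar_radius a b s t :
  continuity_2d_pt (fun s t => (a + s * (b - a)) * cos t) s t /\
  continuity_2d_pt (fun s t => (a + s * (b - a)) * sin t) s t.
Proof.
  split; repeat first [apply continuity_2d_pt_mult | apply continuity_2d_pt_plus | apply continuity_2d_cos |
    apply continuity_2d_sin
    | apply continuity_2d_pt_const | apply continuity_2d_pt_id1].
Qed.

(** The circles of intermediate radii form a homotopy. *)
Lemma circle_integrals_equal Om al be r1 r2 : closed_form (on_plane (punctured Om)) al be ->
  disc_in Om r1 -> disc_in Om r2 ->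
  exists J, is_RInt (circle_form al be r1) 0 (2 * PI) J /\ is_RInt (circle_form al be r2) 0 (2 * PI) J.
Proof.
  intros Hc H1 H2. pose proof PI_RGT_0.
  assert (HD : disc_in Om (Rmax r1 r2)).
  { unfold Rmax. destruct (Rle_dec r1 r2); assumption. }
  destruct (closed_form_homotopy (on_plane (punctured Om)) al be
     (fun s t => (r1 + s * (r2 - r1)) * cos t) (fun s t => (r1 + s * (r2 - r1)) * sin t) (2 * PI)
     (fun t => - ((r1 + 0 * (r2 - r1)) * sin t)) (fun t => (r1 + 0 * (r2 - r1)) * cos t)
     (fun t => - ((r1 + 1 * (r2 - r1)) * sin t)) (fun t => (r1 + 1 * (r2 - r1)) * cos t) Hc) as (J & J1 & J2).
  - lra.
  - apply continuity_2d_polar_radius.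
  - apply continuity_2d_polar_radius.
  - intros s Hs t. apply polar_punctured with (1 := HD).
    destruct H1 as [H1 _], H2 as [H2 _]. unfold Rmax. destruct (Rle_dec r1 r2); nra.
  - intros s Hs. rewrite cos_2PI, sin_2PI, cos_0, sin_0. auto.
  - intros t. apply circle_C1.
  - intros t. apply circle_C1.
  - exists J. replace r1 with (r1 + 0 * (r2 - r1)) at 1 by ring. split; [exact J1|].
    replace r2 with (r1 + 1 * (r2 - r1)) at 1 by ring. exact J2.
Qed.

Lemma circle_integral_constant Om al be r0 : closed_form (on_plane (punctured Om)) al be -> disc_in Om r0 ->
  exists J, forall r, disc_in Om r -> is_RInt (circle_form al be r) 0 (2 * PI) J.
Proof.
  intros Hc H0. exists (RInt (circle_form al be r0) 0 (2 * PI)).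
  intros r Hr. destruct (circle_integrals_equal Om al be r0 r Hc H0 Hr) as (J & J1 & J2).
  rewrite (is_RInt_unique _ _ _ _ J1). exact J2.
Qed.

Definition loop_form (al be : R -> R -> R) (g : R -> C) : R -> R :=
  form_along al be (fun t => Re (g t)) (fun t => Im (g t))
     (fun t => Re (plane_velocity g t)) (fun t => Im (plane_velocity g t)).

(** The normed module over which the generator of an end is differentiable. *)
Notation R2 := (prod_NormedModule R_AbsRing R_NormedModule R_NormedModule).

Definition C1_loop (g : R -> C) : Prop := forall t,
  ex_derive (K := R_AbsRing) (V := R2) g t /\
  continuous (plane_velocity g) t.

Lemma C1_loop_curve g t : C1_loop g -> C1_curve (fun t => Re (g t)) (fun t => Im (g t))
     (fun t => Re (plane_velocity g t)) (fun t => Im (plane_velocity g t)) t.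
Proof.
  intros Hg. destruct (Hg t) as [[l Hl] Hc].
  assert (H : forall pr : R2 -> R, is_linear (V:=R_NormedModule) pr -> ex_derive (fun t => pr (g t)) t).
  { intros pr Hpr. exists (pr l).
    eapply filterdiff_ext_lin; [apply (filterdiff_comp' (K:=R_AbsRing) (V:=R2) (W:=R_NormedModule) g pr t _
      pr Hl)|].
    - apply filterdiff_linear, Hpr.
    - intros y. apply (linear_scal pr Hpr). }
  split; [|split; [|split]].
  - apply Derive_correct, (H fst), is_linear_fst.
  - apply Derive_correct, (H snd), is_linear_snd.
  - apply (continuous_comp (plane_velocity g) (fun z : C => Re z)); [exact Hc|apply continuous_fst].
  - apply (continuous_comp (plane_velocity g) (fun z : C => Im z)); [exact Hc|apply continuous_snd].
Qed.

Lemma continuous_components (h : R -> R -> C) :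
  (forall q : R * R, continuous (fun q => h (fst q) (snd q)) q) ->
  (forall s t, continuity_2d_pt (fun s t => Re (h s t)) s t) /\
  (forall s t, continuity_2d_pt (fun s t => Im (h s t)) s t).
Proof.
  intros H. split; intros s t; apply continuity_2d_pt_filterlim.
  - apply (continuous_comp (fun q : R * R => h (fst q) (snd q)) (fun z : C => Re z) (s, t));
    [apply H|apply continuous_fst].
  - apply (continuous_comp (fun q : R * R => h (fst q) (snd q)) (fun z : C => Im z) (s, t));
    [apply H|apply continuous_snd].
Qed.

Lemma cis_scaled r a : (RtoC r * cis a)%C = (r * cos a, r * sin a).
Proof. unfold cis. apply injective_projections; simpl; ring. Qed.

(** Substitution of 2 PI - t for the parameter. *)
Lemma clockwise_circle_integral al be r J :
  is_RInt (circle_form al be r) 0 (2 * PI) J ->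
  is_RInt (form_along al be (fun t => r * cos (-1 * t)) (fun t => r * sin (-1 * t))
     (fun t => r * sin (-1 * t)) (fun t => - (r * cos (-1 * t)))) 0 (2 * PI) (- J).
Proof.
  intros H. apply (is_RInt_swap (V:=R_NormedModule)) in H.
  assert (E : is_RInt (circle_form al be r) (-1 * 0 + 2 * PI) (-1 * (2 * PI) + 2 * PI) (- J)).
  { replace (-1 * 0 + 2 * PI) with (2 * PI) by ring. replace (-1 * (2 * PI) + 2 * PI) with 0 by ring.
    exact H. }
  apply (is_RInt_comp_lin (V:=R_NormedModule)) in E.
  eapply is_RInt_ext; [|exact E]. intros t _.
  unfold circle_form, form_along, scal; simpl; unfold mult; simpl.
  rewrite (cos_plus (-1 * t)), (sin_plus (-1 * t)), cos_2PI, sin_2PI.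
  replace (cos (-1 * t) * 1 - sin (-1 * t) * 0) with (cos (-1 * t)) by ring.
  replace (sin (-1 * t) * 1 + cos (-1 * t) * 0) with (sin (-1 * t)) by ring. ring.
Qed.

(** The sign comes from the direction of the circle, which is described clockwise. *)
Lemma end_loop_integral Om al be g r J : closed_form (on_plane (punctured Om)) al be ->
  C1_loop g -> disc_in Om r ->
  freely_homotopic (punctured Om) g (fun t => (RtoC r * cis (-1 * t))%C) ->
  (forall r, disc_in Om r -> is_RInt (circle_form al be r) 0 (2 * PI) J) ->
  is_RInt (loop_form al be g) 0 (2 * PI) (- J).
Proof.
  intros Hc Hg HD (h & Hh & Hper & H0 & H1) HJ. pose proof PI_RGT_0.
  destruct (continuous_components h Hh) as [K1 K2].
  assert (Hf0 : h 0 = g) by (apply functional_extensionality; exact H0).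
  assert (Hf1 : h 1 = fun t => (r * cos (-1 * t), r * sin (-1 * t))).
  { apply functional_extensionality; intros t. rewrite H1. apply cis_scaled. }
  destruct (closed_form_homotopy (on_plane (punctured Om)) al be
     (fun s t => Re (h s t)) (fun s t => Im (h s t)) (2 * PI)
     (fun t => Re (plane_velocity g t)) (fun t => Im (plane_velocity g t))
     (fun t => r * sin (-1 * t)) (fun t => - (r * cos (-1 * t))) Hc) as (J' & J1 & J2); auto.
  - lra.
  - intros s Hs t. destruct (Hper s Hs t) as [_ K]. unfold on_plane. destruct (h s t); exact K.
  - intros s Hs. destruct (Hper s Hs 0) as [K _]. rewrite Rplus_0_l in K. rewrite K. auto.
  - intros t. rewrite Hf0. apply C1_loop_curve, Hg.
  - intros t. rewrite Hf1. simpl. split; [|split; [|split]].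
    + auto_derive; auto; ring.
    + auto_derive; auto; ring.
    + apply (is_derive_continuous _ t (- (r * cos (-1 * t)))). auto_derive; auto; ring.
    + apply (is_derive_continuous _ t (- (r * sin (-1 * t)))). auto_derive; auto; ring.
  - rewrite Hf0 in J1. rewrite Hf1 in J2. simpl in J2.
    pose proof (clockwise_circle_integral al be r J (HJ r HD)) as J3.
    assert (E : J' = - J).
    { rewrite <- (is_RInt_unique _ _ _ _ J2). apply is_RInt_unique. exact J3. }
    rewrite <- E. exact J1.
Qed.

Lemma circle_integral_components f r J K :
  is_RInt (circle_form (fun x y => Re (f (x, y))) (fun x y => - Im (f (x, y))) r) 0 (2 * PI) J ->
  is_RInt (circle_form (fun x y => Im (f (x, y))) (fun x y => Re (f (x, y))) r) 0 (2 * PI) K ->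
  circle_integral f r = (J, K).
Proof.
  intros HJ HK. unfold circle_integral.
  apply (is_RInt_unique (V := C_R_CompleteNormedModule)).
  apply (is_RInt_fct_extend_pair (U := R_NormedModule) (V := R_NormedModule)).
  - eapply is_RInt_ext; [|exact HJ]. intros t _. rewrite cis_scaled.
    unfold circle_form, form_along, cis. destruct (f (r * cos t, r * sin t)). simpl. ring.
  - eapply is_RInt_ext; [|exact HK]. intros t _. rewrite cis_scaled.
    unfold circle_form, form_along, cis. destruct (f (r * cos t, r * sin t)). simpl. ring.
Qed.

(** * From flux to circle integrals *)

(** The derivative of [volume_potential] when its arguments vary with velocities [q'] and [b']. *)
Definition potential_differential (t0 t1 t2 : C) (q b q' b' : vec) : R :=
  - (Im (quad' t1 t2 (fst q) * fst q' * Cconj (fst b) + quad t0 t1 t2 (fst q) * Cconj (fst b'))%C / cw q ^ 2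
     - 2 * Im (quad t0 t1 t2 (fst q) * Cconj (fst b))%C * cw q' / cw q ^ 3
     + Im (RtoC 2 * t2 * fst q')%C * cw b / cw q + Im (quad' t1 t2 (fst q)) * cw b' / cw q
     - Im (quad' t1 t2 (fst q)) * cw b * cw q' / cw q ^ 2 - Im (t2 * fst b')%C).

Lemma volume_potential_derivative t0 t1 t2 q b t q' b' : cw (q t) <> 0 ->
  is_vderive q t q' -> is_vderive b t b' ->
  is_derive (fun s => volume_potential t0 t1 t2 (q s) (b s)) t (potential_differential t0 t1 t2 (q t) (b t)
    q' b').
Proof.
  intros Hw Hq Hb. pose proof (is_vderive_cder _ _ _ Hq) as Cq. pose proof (is_vderive_cder _ _ _ Hb) as Cb.
  destruct Hq as (_ & _ & Hqw), Hb as (_ & _ & Hbw).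
  assert (Hw2 : cw (q t) ^ 2 <> 0) by (apply pow_nonzero, Hw).
  pose proof (cder_quad t0 t1 t2 _ _ _ Cq) as CQ. pose proof (cder_quad' t1 t2 _ _ _ Cq) as CQ'.
  unfold volume_potential. evar_last.
  - apply rder_opp, rder_minus; [apply rder_plus|].
    + apply rder_div; [exact Hw2| |apply rder_pow2, Hqw].
      apply (cder_mult _ _ _ _ _ CQ (cder_conj _ _ _ Cb)).
    + apply rder_div; [exact Hw| |apply Hqw]. apply rder_mult; [apply CQ'|apply Hbw].
    + apply (cder_mult _ _ _ _ _ (cder_const t2 t) Cb).
  - unfold potential_differential.
    assert (E0 : forall z w : C, Im (RtoC 0 * z + w)%C = Im w) by (intros [] []; simpl; ring).
    rewrite E0.
    set (A := Im (_ + _)%C). field. exact Hw.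
Qed.

(** The two terms in the mixed derivative [ab] cancel, as they must for an exterior derivative. *)
Lemma potential_exterior_derivative t0 t1 t2 q a b ab : cw q <> 0 ->
  potential_differential t0 t1 t2 q b a ab - potential_differential t0 t1 t2 q a b ab =
  2 * det3 a b (killing t0 t1 t2 q) / cw q ^ 3.
Proof.
  destruct t0 as [t0r t0i], t1 as [t1r t1i], t2 as [t2r t2i], q as [[u v] w].
  destruct a as [[a1 a2] a3], b as [[b1 b2] b3], ab as [[ab1 ab2] ab3].
  cbv beta iota zeta delta [potential_differential killing quad quad' det3
    hdot dot cross vadd vscal mkvec cu cv cw Cminus Copp Cplus Cmult RtoC Cconj Ci Re Im fst snd].
  intros Hw. field. exact Hw.
Qed.

Lemma volume_potential_linear t0 t1 t2 q a b x y :
  volume_potential t0 t1 t2 q (vadd (vscal x a) (vscal y b)) =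
  x * volume_potential t0 t1 t2 q a + y * volume_potential t0 t1 t2 q b.
Proof.
  destruct t0 as [t0r t0i], t1 as [t1r t1i], t2 as [t2r t2i], q as [[u v] w].
  destruct a as [[a1 a2] a3], b as [[b1 b2] b3].
  cbv beta iota zeta delta [volume_potential quad quad' vadd vscal mkvec cu cv cw Cminus Copp Cplus Cmult
    RtoC Cconj Ci Re Im fst snd].
  unfold Rdiv. ring.
Qed.

Lemma volume_potential_smooth n W t0 t1 t2 q b : open2 W -> (forall x y, W x y -> cw (q x y) <> 0) ->
  vsmooth n W q -> vsmooth n W b -> smooth n W (fun x y => volume_potential t0 t1 t2 (q x y) (b x y)).
Proof.
  intros HW Hw Hq Hb. pose proof (vsmooth_csmooth _ _ _ Hq) as Cq.
    pose proof (vsmooth_csmooth _ _ _ Hb) as Cb.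
  destruct Hq as (_ & _ & Hqw), Hb as (_ & _ & Hbw).
  unfold volume_potential. apply smooth_opp; auto. apply smooth_minus; auto; [apply smooth_plus; auto|].
  - apply smooth_div; auto; [intros; apply pow_nonzero; auto| |apply smooth_pow; auto].
    refine (proj2 (csmooth_mult n W (fun x y => quad t0 t1 t2 (fst (q x y))) (fun x y => Cconj (fst (b x y)))
      HW _ _)).
    apply csmooth_quad; auto. apply csmooth_conj; auto.
  - apply smooth_div; auto. apply smooth_mult; auto.
    refine (proj2 (csmooth_quad' n W t1 t2 (fun x y => fst (q x y)) HW Cq)).
  - refine (proj2 (csmooth_mult n W (fun x y => t2) (fun x y => fst (b x y)) HW _ Cb)).
    apply csmooth_const; auto.
Qed.

(** The normalizations of the unit normal and of the area element cancel. When the map is not an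
    immersion at the point, both sides vanish. *)
Lemma flux_density_det q a b Y : 0 < cw q ->
  hdot q (unit_normal q a b) Y * area_element q a b = det3 a b Y / cw q ^ 3.
Proof.
  intros Hw. unfold unit_normal, area_element, det3.
  set (n := cross a b). set (w := cw q) in *.
  assert (Hn : hdot q a a * hdot q b b - hdot q a b ^ 2 = dot n n / w ^ 4).
  { unfold hdot, n. fold w. replace (dot (cross a b) (cross a b)) with (dot a a * dot b b - dot a b ^ 2).
    - field. lra.
    - clear. vec_ring. }
  rewrite Hn. unfold hdot. rewrite dot_scal_l. fold w.
  destruct (classic (n = mkvec 0 0 0)) as [->|H0].
  - replace (dot (mkvec 0 0 0) Y) with 0 by (unfold dot, mkvec, cu, cv, cw; simpl; ring). unfold Rdiv; ring.
  - pose proof (cross_nonzero_norm _ _ H0) as Hp. fold n in Hp.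
    assert (Hw4 : 0 < w ^ 4) by (apply pow_lt, Hw).
    rewrite sqrt_div_alt by assumption.
    replace (sqrt (w ^ 4)) with (w ^ 2).
    2:{ replace (w ^ 4) with ((w ^ 2) ^ 2) by ring. symmetry. apply sqrt_pow2. apply pow2_ge_0. }
    assert (0 < sqrt (dot n n)) by (apply sqrt_lt_R0, Hp).
    field. lra.
Qed.

Lemma vDerive_unique f t l : is_vderive f t l -> vDerive f t = l.
Proof.
  intros (H1 & H2 & H3). apply vec_eq; [apply (is_derive_unique _ _ _ H1)|apply (is_derive_unique _ _ _
    H2)|apply (is_derive_unique _ _ _ H3)].
Qed.

Lemma vsmooth_comp_curve n W f g1 g2 t d1 d2 : open2 W -> vsmooth (S n) W (vec_field f) ->
  W (g1 t) (g2 t) -> is_derive g1 t d1 -> is_derive g2 t d2 ->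
  is_vderive (fun s => f (g1 s, g2 s)) t
     (vadd (vscal d1 (dx f (g1 t, g2 t))) (vscal d2 (dy f (g1 t, g2 t)))).
Proof.
  intros HW (S1 & S2 & S3) Hw H1 H2. split; [|split].
  - pose proof (smooth_comp_curve n W _ g1 g2 t d1 d2 HW S1 Hw H1 H2) as K.
    evar_last; [exact K|]. rewrite (Rmult_comm _ d1), (Rmult_comm _ d2). reflexivity.
  - pose proof (smooth_comp_curve n W _ g1 g2 t d1 d2 HW S2 Hw H1 H2) as K.
    evar_last; [exact K|]. rewrite (Rmult_comm _ d1), (Rmult_comm _ d2). reflexivity.
  - pose proof (smooth_comp_curve n W _ g1 g2 t d1 d2 HW S3 Hw H1 H2) as K.
    evar_last; [exact K|]. rewrite (Rmult_comm _ d1), (Rmult_comm _ d2). reflexivity.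
Qed.

Lemma open2_disc rho : open2 (on_plane (fun z => Cmod z < rho)).
Proof.
  intros x y H. unfold on_plane in *. assert (Hp : 0 < (rho - Cmod (x, y)) / 2) by lra.
  exists (mkposreal _ Hp). simpl. intros u v Hu Hv.
  replace ((u, v) : C) with ((x, y) + (u - x, v - y)%R)%C by (apply injective_projections; simpl; ring).
  eapply Rle_lt_trans; [apply Cmod_triangle|].
  assert (Hm : Rmax (Rabs (u - x)) (Rabs (v - y)) < (rho - Cmod (x, y)) / 2) by (apply Rmax_lub_lt;
    assumption).
  pose proof (Cmod_le_max (u - x) (v - y) _ (Rmax_l _ _) (Rmax_r _ _)). lra.
Qed.

Lemma open2_positive W f : open2 W -> smooth 0 W f -> open2 (fun x y => W x y /\ 0 < f x y).
Proof.
  intros HW Hf x y [Hw H]. pose proof (smooth_cont _ _ _ _ _ Hf Hw) as Hc.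
  destruct (HW x y Hw) as [d Hd]. destruct (Hc (mkposreal _ H)) as [d' Hd'].
  assert (Hm : 0 < Rmin d d') by (apply Rmin_pos; apply cond_pos).
  exists (mkposreal _ Hm). simpl. intros u v Hu Hv. pose proof (Rmin_l d d'). pose proof (Rmin_r d d').
  split; [apply Hd; lra|]. specialize (Hd' u v). simpl in Hd'.
  assert (K : Rabs (f u v - f x y) < f x y) by (apply Hd'; lra). apply Rabs_def2 in K. lra.
Qed.

(** The minimum on the unit circle is positive, and uniform continuity in the radius yields one
    width for all points of the circle. *)
Lemma positive_beyond_unit_disc rho f : 1 < rho -> smooth 0 (on_plane (fun z => Cmod z < rho)) f ->
  (forall x y, Cmod (x, y) <= 1 -> 0 < f x y) ->
  exists rho', 1 < rho' /\ forall r t, -1 < r < rho' -> -1 < t < 2 * PI + 1 ->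
     Cmod (r * cos t, r * sin t) < rho /\ 0 < f (r * cos t) (r * sin t).
Proof.
  intros Hrho Hf Hpos. pose proof PI_RGT_0.
  set (g := fun r t => f (r * cos t) (r * sin t)).
  assert (HC : forall t, continuity_2d_pt g 1 t).
  { intros t. apply continuity_2d_polar. apply (smooth_cont 0 _ f _ _ Hf). unfold on_plane.
    rewrite Cmod_polar; lra. }
  destruct (continuity_ab_min (fun t => g 1 t) (-1) (2 * PI + 1)) as (tm & Hm & Htm).
  { lra. }
  { intros t _. apply continuity_pt_filterlim. apply (continuity_2d_slice_y g). apply HC. }
  assert (Hp : 0 < g 1 tm) by (apply Hpos; rewrite Cmod_polar; lra).
  destruct (uniform_continuity_2d_1d' g (-1) (2 * PI + 1) 1 (fun t _ => HC t) (mkposreal _ Hp)) as [d Hd].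
  simpl in Hd. pose proof (cond_pos d) as Hdp.
  exists (Rmin rho (1 + d)). split; [apply Rmin_glb_lt; lra|].
  intros r t Hr Ht. pose proof (Rmin_l rho (1 + d)). pose proof (Rmin_r rho (1 + d)).
  assert (Hneg : r < 0 -> Cmod (r * cos t, r * sin t) = - r).
  { intros Hr0. rewrite <- (Cmod_polar (- r) t) by lra. rewrite <- Cmod_opp. f_equal.
    apply injective_projections; simpl; ring. }
  assert (Hc : Cmod (r * cos t, r * sin t) < rho).
  { destruct (Rle_dec 0 r); [rewrite Cmod_polar; lra|]. rewrite Hneg; lra. }
  split; auto.
  destruct (Rle_dec r 1).
  - apply Hpos. destruct (Rle_dec 0 r); [rewrite Cmod_polar; lra|]. rewrite Hneg; lra.
  - specialize (Hd t 1 t r). assert (K : Rabs (g r t - g 1 t) < g 1 tm).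
    { apply Hd; try lra. replace (t - t) with 0 by ring. rewrite Rabs_R0. lra. }
    specialize (Hm t). apply Rabs_def2 in K. change (0 < g r t). lra.
Qed.

(** Stokes' formula on the disk: the pull-back of [volume_potential] is a planar form to which
    [green_disc] applies. It only remains to recognize the flux integrand as half its
    exterior derivative. *)
Lemma disk_flux_boundary t0 t1 t2 X g k : spanning_disk X g k ->
  exists B, is_RInt (fun t => volume_potential t0 t1 t2 (X (g t)) (vDerive (fun s => X (g s)) t)) 0 (2 * PI)
    B /\
    2 * disk_flux (killing t0 t1 t2) k = B.
Proof.
  intros ((rho & Hrho & Hk) & Hw & Hbd). pose proof PI_RGT_0 as Hpi.
  assert (Sk : vsmooth 2 (on_plane (fun z => Cmod z < rho)) (vec_field k)).
  { split; [|split]; intros x y Hxy; apply (Hk (x, y) Hxy). }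
  pose proof Sk as (_ & _ & Sw).
  set (W := fun x y => on_plane (fun z => Cmod z < rho) x y /\ 0 < cw (k (x, y))).
  assert (HW : open2 W).
  { apply (open2_positive _ (fun x y => cw (k (x, y)))); [apply open2_disc|].
    eapply smooth_le; [|exact Sw]; lia. }
  assert (SkW : vsmooth 2 W (vec_field k)).
  { destruct Sk as (S1 & S2 & S3). split; [|split]; intros x y [Hxy _]; auto. }
  assert (Hw0 : forall x y, W x y -> cw (k (x, y)) <> 0) by (intros x y [_ K]; lra).
  destruct (positive_beyond_unit_disc rho (fun x y => cw (k (x, y))) Hrho) as (rho' & Hrho' & HWp).
  { eapply smooth_le; [|exact Sw]; lia. }
  { intros x y Hxy. apply Hw, Hxy. }
  set (b1 := fun x y => / 2 * volume_potential t0 t1 t2 (k (x, y)) (dx k (x, y))).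
  set (b2 := fun x y => / 2 * volume_potential t0 t1 t2 (k (x, y)) (dy k (x, y))).
  pose proof (vsmooth_dx _ _ _ SkW) as Sx. pose proof (vsmooth_dy _ _ _ SkW) as Sy.
  assert (Sb1 : smooth 1 W b1).
  { apply smooth_mult; auto using smooth_const.
    apply (volume_potential_smooth 1 W t0 t1 t2 (vec_field k) (vec_field (dx k))); auto.
    eapply vsmooth_le; [|exact SkW]; lia. }
  assert (Sb2 : smooth 1 W b2).
  { apply smooth_mult; auto using smooth_const.
    apply (volume_potential_smooth 1 W t0 t1 t2 (vec_field k) (vec_field (dy k))); auto.
    eapply vsmooth_le; [|exact SkW]; lia. }
  pose proof (green_disc W rho' b1 b2 HW Hrho' HWp Sb1 Sb2) as HG.
  assert (Hcirc : forall t, 0 <= t <= 2 * PI -> W (cos t) (sin t)).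
  { intros t Ht. rewrite <- (Rmult_1_l (cos t)), <- (Rmult_1_l (sin t)). apply HWp; lra. }
  assert (HB : is_RInt (form_along b1 b2 cos sin (fun t => - sin t) cos) 0 (2 * PI)
     (RInt (form_along b1 b2 cos sin (fun t => - sin t) cos) 0 (2 * PI))).
  { apply (RInt_correct (V:=R_CompleteNormedModule)), (ex_RInt_continuous (V:=R_CompleteNormedModule)).
    intros t Ht. rewrite Rmin_left, Rmax_right in Ht by lra.
    apply (form_along_continuous 1 W); auto.
    split; [|split; [|split]]; [apply is_derive_cos|apply is_derive_sin| |].
    - apply (is_derive_continuous _ t (- cos t)). auto_derive; auto; ring.
    - apply (is_derive_continuous _ t (- sin t)). apply is_derive_cos. }
  set (I0 := RInt (form_along b1 b2 cos sin (fun t => - sin t) cos) 0 (2 * PI)) in *.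
  exists (2 * I0). split.
  - apply (is_RInt_scal (V:=R_NormedModule) _ _ _ 2) in HB.
    eapply is_RInt_ext; [|exact HB]. intros t Ht. rewrite Rmin_left, Rmax_right in Ht by lra.
    replace (fun s => X (g s)) with (fun s => k (cos s, sin s)).
    2:{ apply functional_extensionality. intros s. apply Hbd. }
    rewrite (vDerive_unique _ _ _ (vsmooth_comp_curve 1 W k cos sin t _ _ HW SkW (Hcirc t ltac:(lra))
      (is_derive_cos t) (is_derive_sin t))).
    rewrite volume_potential_linear. rewrite <- (Hbd t : k (cos t, sin t) = X (g t)).
    unfold form_along, b1, b2, scal; simpl; unfold mult; simpl. field.
  - rewrite <- HG. unfold disk_flux. f_equal.
    apply RInt_ext. intros r Hr. rewrite Rmin_left, Rmax_right in Hr by lra.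
    apply RInt_ext. intros t Ht. rewrite Rmin_left, Rmax_right in Ht by lra.
    cbv zeta. rewrite cis_scaled.
    assert (Hxy : W (r * cos t) (r * sin t)) by (apply HWp; lra).
    set (x := r * cos t) in *. set (y := r * sin t) in *.
    rewrite flux_density_det by apply Hxy.
    assert (H2 : px b2 x y = / 2 * potential_differential t0 t1 t2 (k (x, y)) (dy k (x, y)) (dx k (x,
      y)) (dx (dy k) (x, y))).
    { apply is_derive_unique, is_derive_scal.
      apply (volume_potential_derivative t0 t1 t2 (fun z => k (z, y)) (fun z => dy k (z, y))); auto.
      - apply (vsmooth_is_dx 1 W); auto.
      - apply (vsmooth_is_dx 0 W); auto. }
    assert (H1 : py b1 x y = / 2 * potential_differential t0 t1 t2 (k (x, y)) (dx k (x, y)) (dy k (x,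
      y)) (dy (dx k) (x, y))).
    { apply is_derive_unique, is_derive_scal.
      apply (volume_potential_derivative t0 t1 t2 (fun z => k (x, z)) (fun z => dx k (x, z))); auto.
      - apply (vsmooth_is_dy 1 W); auto.
      - apply (vsmooth_is_dy 0 W); auto. }
    rewrite H1, H2, <- (vsmooth_schwarz W k x y HW SkW Hxy).
    rewrite <- Rmult_minus_distr_l, potential_exterior_derivative by auto.
    assert (cw (k (x, y)) <> 0) by auto. simpl. field. auto.
Qed.

(** In the plane of the two partial derivatives, which are orthogonal and of equal length, the
    unit conormal multiplied by the speed is the tangent vector rotated by a quarter turn. The
    sign condition selects the direction of the rotation. *)
Lemma scaled_conormal a b q g1 g2 x1 x2 : 0 < cw q -> dot a a = dot b b -> dot a b = 0 ->
  hdot q (vadd (vscal x1 a) (vscal x2 b)) (vadd (vscal x1 a) (vscal x2 b)) = 1 ->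
  hdot q (vadd (vscal x1 a) (vscal x2 b)) (vadd (vscal g1 a) (vscal g2 b)) = 0 ->
  g1 * x2 - g2 * x1 < 0 ->
  let k := sqrt (hdot q (vadd (vscal g1 a) (vscal g2 b)) (vadd (vscal g1 a) (vscal g2 b))) in
  k * x1 = g2 /\ k * x2 = - g1.
Proof.
  intros Hw HE HF H1 H2 HD.
  unfold hdot in *. rewrite !(dot_conformal_frame a b) in H1, H2 |- * by assumption. set (l := dot a a) in *.
    set (w := cw q) in *.
  set (n := g1 * g1 + g2 * g2) in *. set (m := x1 * x1 + x2 * x2) in *.
  assert (Hw2 : 0 < w ^ 2) by (apply pow_lt, Hw).
  assert (E1 : l * m = w ^ 2). { apply Rmult_eq_reg_r with (/ w ^ 2); [|apply Rinv_neq_0_compat; lra].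
    unfold Rdiv in H1. rewrite H1. field. lra. }
  assert (Hl0 : 0 <= l) by (unfold l, dot; nra).
  assert (Hm0 : 0 <= m) by (unfold m; nra).
  assert (Hl : 0 < l) by nra. assert (Hm : 0 < m) by nra.
  assert (E2 : x1 * g1 + x2 * g2 = 0).
  { apply Rmult_integral in H2. destruct H2 as [H2|H2]; [nra|].
    apply Rinv_neq_0_compat in H2; [contradiction|lra]. }
  set (D := g2 * x1 - g1 * x2) in *. assert (HD' : 0 < D) by (unfold D; lra).
  assert (Q1 : n * x1 = g2 * D).
  { unfold n, D. replace ((g1 * g1 + g2 * g2) * x1) with (g2 * (g2 * x1 - g1 * x2) + g1 * (x1 * g1 + x2 *
    g2)) by ring. rewrite E2. ring. }
  assert (Q2 : n * x2 = - g1 * D).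
  { unfold n, D. replace ((g1 * g1 + g2 * g2) * x2) with (- g1 * (g2 * x1 - g1 * x2) + g2 * (x1 * g1 + x2 *
    g2)) by ring. rewrite E2. ring. }
  assert (Q3 : D * D = n * m).
  { unfold n, D, m. replace ((g2 * x1 - g1 * x2) * (g2 * x1 - g1 * x2)) with ((g1 * g1 + g2 * g2) * (x1 * x1
    + x2 * x2) - (x1 * g1 + x2 * g2) ^ 2) by ring. rewrite E2. ring. }
  assert (Hk : sqrt (l * n / w ^ 2) = n / D).
  { assert (0 <= n) by (unfold n; nra).
    replace (l * n / w ^ 2) with ((n / D) ^ 2).
    - apply sqrt_pow2. apply Rmult_le_pos; [assumption|]. apply Rlt_le, Rinv_0_lt_compat, HD'.
    - rewrite <- E1. replace ((n / D) ^ 2) with (n * n / (D * D)) by (field; lra). rewrite Q3. field.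
      assert (n <> 0) by (intros Hn; rewrite Hn in Q3; nra). repeat split; lra. }
  simpl. simpl in Hk. rewrite Hk. split.
  - replace (n / D * x1) with (n * x1 / D) by (field; lra). rewrite Q1. field; lra.
  - replace (n / D * x2) with (n * x2 / D) by (field; lra). rewrite Q2. field; lra.
Qed.

Lemma hdot_scal_l q k a b : hdot q (vscal k a) b = k * hdot q a b.
Proof. unfold hdot. rewrite dot_scal_l. unfold Rdiv; ring. Qed.

Lemma det3_change_basis a b g1 g2 x1 x2 n :
  det3 (vadd (vscal g1 a) (vscal g2 b)) (vadd (vscal x1 a) (vscal x2 b)) (vscal (-1) n) =
  - (g1 * x2 - g2 * x1) * det3 a b n.
Proof.
  vec_ring.
Qed.

Lemma surface_velocity Om X g : bryant_end Om X -> loop_in (punctured Om) g -> C1_loop g -> forall t,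
  vDerive (fun s => X (g s)) t =
     vadd (vscal (Re (plane_velocity g t)) (dx X (g t))) (vscal (Im (plane_velocity g t)) (dy X (g t))).
Proof.
  intros HB Hloop Hg t. destruct (bryant_end_smooth Om X HB) as (HW & HS & Hw0).
  assert (Hgw : on_plane (punctured Om) (Re (g t)) (Im (g t))).
  { destruct (Hloop t) as (_ & _ & K). unfold on_plane. destruct (g t); exact K. }
  apply vDerive_unique. destruct (C1_loop_curve g t Hg) as (D1 & D2 & _).
  pose proof (vsmooth_comp_curve 1 _ X (fun t => Re (g t)) (fun t => Im (g t)) t _ _ HW HS Hgw D1 D2) as K.
  assert (E : forall s, (Re (g s), Im (g s)) = g s) by (intros s; destruct (g s); reflexivity).
  cbv beta in K. rewrite E in K.
  replace (fun s => X (g s)) with (fun s => X (Re (g s), Im (g s))); [exact K|].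
  apply functional_extensionality. intros s. rewrite E. reflexivity.
Qed.

(** With the two orientation conditions on the conormal the generator can only run clockwise.
    The flux integrand then is 2 Im(g dz) along the loop, which is homotopic to a circle. *)
Lemma killing_flux Om X t0 t1 t2 J : bryant_end Om X ->
  (forall r, disc_in Om r -> is_RInt (circle_form (im_density X t0 t1 t2)
      (re_density X t0 t1 t2) r) 0 (2 * PI) J) ->
  forall g xi k, end_generator Om X g xi -> spanning_disk X g k ->
  conormal_flux X (killing t0 t1 t2) g xi - 2 * disk_flux (killing t0 t1 t2) k = - (2 * J).
Proof.
  intros HB HJ g xi k (Hloop & Hreg & eps & r & Heps & Hr & HD & Hhom & Hxi) Hk.
  pose proof PI_RGT_0 as Hpi.
  destruct (bryant_end_smooth Om X HB) as (HW & HS & Hw0).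
  destruct (disk_flux_boundary t0 t1 t2 X g k Hk) as (B & HBi & HBe). rewrite HBe.
  assert (Hg : C1_loop g) by (intros t; destruct (Hreg t) as (K1 & K2 & _); auto).
  assert (Hgw : forall t, on_plane (punctured Om) (Re (g t)) (Im (g t))).
  { intros t. destruct (Hloop t) as (_ & _ & K). unfold on_plane. destruct (g t); exact K. }
  pose proof (surface_velocity Om X g HB Hloop Hg) as HT.
  assert (Hfacts : forall t, 0 < cw (X (g t)) /\ dot (dx X (g t)) (dx X (g t)) = dot (dy X (g t)) (dy X (g
    t)) /\
     dot (dx X (g t)) (dy X (g t)) = 0 /\ 0 < det3 (dx X (g t)) (dy X (g t)) (mean_curvature_vector X (g t))).
  { intros t. destruct (bryant_end_conformal Om X _ _ HB (Hgw t)) as [K1 K2].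
    assert (E : (Re (g t), Im (g t)) = g t) by (destruct (g t); reflexivity). rewrite E in K1, K2.
    destruct HB as (_ & _ & H). destruct (Hloop t) as (_ & _ & K).
      destruct (H (g t) K) as (P1 & _ & _ & _ & _ & _ & P2). auto. }
  assert (Hneg : forall t, Re (plane_velocity g t) * Im (xi t) - Im (plane_velocity g t) * Re (xi t) < 0).
  { intros t. destruct (Hxi t) as (_ & _ & _ & K). rewrite HT in K. unfold pushforward in K.
    rewrite det3_change_basis in K. destruct (Hfacts t) as (_ & _ & _ & K2). nra. }
  (* The conormal condition on the determinant fixes the sign of plane_det, hence of eps. *)
  assert (He : eps = -1).
  { destruct Heps as [->| ->]; [|reflexivity]. destruct (Hxi 0) as (_ & _ & K & _). unfold plane_det in K.
    specialize (Hneg 0). lra. }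
  subst eps.
  pose proof (end_loop_integral Om _ _ g r J (surface_density_closed_im Om X t0 t1 t2 HB) Hg (conj Hr HD)
    Hhom HJ) as HI.
  assert (HC : is_RInt (fun t => hdot (X (g t)) (pushforward X (g t) (xi t)) (killing t0 t1 t2 (X (g t))) *
      sqrt (hdot (X (g t)) (vDerive (fun s => X (g s)) t) (vDerive (fun s => X (g s)) t))) 0 (2 * PI) (2 * -
        J + B)).
  { eapply is_RInt_ext; [|exact (is_RInt_plus (V:=R_NormedModule) _ _ _ _ _ _ (is_RInt_scal
    (V:=R_NormedModule) _ _ _ 2 _ HI) HBi)].
    intros t _. destruct (Hfacts t) as (F1 & F2 & F3 & _). destruct (Hxi t) as (X1 & X2 & _).
    rewrite HT in X2 |- *. unfold pushforward in X1, X2 |- *.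
    destruct (scaled_conormal _ _ _ _ _ _ _ F1 F2 F3 X1 X2 (Hneg t)) as [K1 K2].
    set (kk := sqrt _) in *. rewrite (Rmult_comm (hdot _ _ _) kk), <- hdot_scal_l.
    replace (vscal kk (vadd (vscal (Re (xi t)) (dx X (g t))) (vscal (Im (xi t)) (dy X (g t))))) with
      (vadd (vscal (Im (plane_velocity g t)) (dx X (g t))) (vscal (- Re (plane_velocity g t)) (dy X (g t)))).
    2:{ rewrite <- K2, <- K1. apply vec_eq; unfold vadd, vscal, mkvec, cu, cv, cw; simpl; ring. }
    pose proof (density_flux t0 t1 t2 (X (g t)) (dx X (g t)) (dy X (g t)) (Re (plane_velocity g t)) (Im
      (plane_velocity g t))) as K.
    assert (Hn0 : cw (X (g t)) <> 0) by lra. specialize (K Hn0).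
    assert (E : (Re (g t), Im (g t)) = g t) by (destruct (g t); reflexivity).
    unfold loop_form, form_along, re_density, im_density. rewrite E.
    match goal with |- plus (scal 2 ?A) ?P = ?r => change (2 * A + P = r) end.
    change (density t0 t1 t2 (X (g t)) (dx X (g t)) (dy X (g t))) with (surface_density X t0 t1 t2 (g t)) in
      K.
    assert (E2 : forall (z : C) a b, Im (z * (a, b))%C = Im z * a + Re z * b) by (intros [] ? ?; simpl; ring).
    rewrite E2 in K. lra. }
  unfold conormal_flux. cbv zeta. rewrite (is_RInt_unique _ _ _ _ HC). ring.
Qed.

(** * Infinitesimal Moebius transformations *)

Definition mul2 (g h : mat2) : mat2 :=
  Mat2 (m11 g * m11 h + m12 g * m21 h)%C (m11 g * m12 h + m12 g * m22 h)%C
       (m21 g * m11 h + m22 g * m21 h)%C (m21 g * m12 h + m22 g * m22 h)%C.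

Definition norm2 (z : C) : R := Re z ^ 2 + Im z ^ 2.

Lemma Cmod_sqr z : Cmod z ^ 2 = norm2 z.
Proof. unfold Cmod, norm2, Re, Im. rewrite pow2_sqrt; auto. nra. Qed.

Definition denominator (g : mat2) (q : vec) : R :=
  norm2 (m21 g * fst q + m22 g)%C + norm2 (m21 g) * cw q ^ 2.
Definition numerator (g : mat2) (q : vec) : C :=
  ((m11 g * fst q + m12 g) * Cconj (m21 g * fst q + m22 g) + m11 g * Cconj (m21 g) * RtoC (cw q ^ 2))%C.

Lemma norm2_ge0 z : 0 <= norm2 z.
Proof. unfold norm2. nra. Qed.

Lemma norm2_eq0 z : norm2 z = 0 -> z = RtoC 0.
Proof. unfold norm2, Re, Im. destruct z as [a b]. simpl. intros H. assert (a = 0) by nra.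
  assert (b = 0) by nra. subst. reflexivity. Qed.

Lemma denominator_pos g q : det2 g <> RtoC 0 -> 0 < cw q -> 0 < denominator g q.
Proof.
  intros Hd Hw. unfold denominator. pose proof (norm2_ge0 (m21 g * fst q + m22 g)%C).
    pose proof (norm2_ge0 (m21 g)).
  assert (Hw2 : 0 < cw q ^ 2) by (apply pow_lt, Hw).
  destruct (Req_dec (norm2 (m21 g)) 0) as [E|E]; [|nra].
  destruct (Req_dec (norm2 (m21 g * fst q + m22 g)%C) 0) as [E'|E']; [|nra].
  apply norm2_eq0 in E. apply norm2_eq0 in E'. exfalso. apply Hd. unfold det2. rewrite E in *.
  replace (m22 g) with (RtoC 0 * fst q + m22 g)%C by ring. rewrite E'. ring.
Qed.

Lemma poincare_fraction g q : denominator g q <> 0 ->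
  poincare g q = ((RtoC (/ denominator g q) * numerator g q)%C, Cmod (det2 g) * cw q / denominator g q).
Proof.
  intros Hn. unfold poincare. fold (cw q). rewrite !Cmod_sqr. fold (denominator g q). fold (numerator g q).
  f_equal. rewrite RtoC_inv by exact Hn. unfold Cdiv. ring.
Qed.

(** Writing p and r for the images of [fst q] under the two rows of [h], the denominator of the
    left-hand side is that of the right-hand side divided by the denominator of [h], and
    likewise for the numerators; both are polynomial identities. *)
Lemma poincare_mul g h q : det2 g <> RtoC 0 -> det2 h <> RtoC 0 -> 0 < cw q ->
  poincare g (poincare h q) = poincare (mul2 g h) q.
Proof.
  intros Hg Hh Hw. pose proof (denominator_pos h q Hh Hw) as Hn.
  assert (Hdet : (det2 (mul2 g h) = det2 g * det2 h)%C) by (unfold det2, mul2; simpl; ring).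
  assert (Hgh : det2 (mul2 g h) <> RtoC 0) by (rewrite Hdet; apply Cmult_neq_0; assumption).
  pose proof (denominator_pos _ q Hgh Hw) as Hn'.
  rewrite (poincare_fraction h q), (poincare_fraction (mul2 g h) q) by lra.
  set (n := denominator h q) in *. set (nn := denominator (mul2 g h) q) in *.
  set (p := (m11 h * fst q + m12 h)%C). set (r := (m21 h * fst q + m22 h)%C).
  assert (Edet : det2 h = (m11 h * r - m21 h * p)%C) by (unfold det2, r, p; ring).
  assert (En : n = norm2 r + norm2 (m21 h) * cw q ^ 2) by reflexivity.
  assert (Enn : nn = norm2 (m21 g * p + m22 g * r)%C + norm2 (m21 g * m11 h + m22 g * m21 h)%C * cw q ^ 2).
  { unfold nn, denominator, mul2, p, r; simpl. f_equal. f_equal. ring. }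
  assert (ENN : numerator (mul2 g h) q = ((m11 g * p + m12 g * r) * Cconj (m21 g * p + m22 g * r) +
     (m11 g * m11 h + m12 g * m21 h) * Cconj (m21 g * m11 h + m22 g * m21 h) * RtoC (cw q ^ 2))%C).
  { unfold numerator, mul2. cbn [m11 m12 m21 m22]. f_equal.
    f_equal; [unfold p, r; ring|f_equal; unfold p, r; ring]. }
  assert (EN : numerator h q = (p * Cconj r + m11 h * Cconj (m21 h) * RtoC (cw q ^ 2))%C) by reflexivity.
  set (N := numerator h q) in *.
  set (q' := ((RtoC (/ n) * N)%C, Cmod (det2 h) * cw q / n)).
  assert (Hw' : 0 < cw q').
  { unfold q', cw; simpl. fold (cw q). apply Rdiv_lt_0_compat; [|exact Hn].
    apply Rmult_lt_0_compat; [|exact Hw]. apply Cmod_gt_0, Hh. }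
  pose proof (denominator_pos g q' Hg Hw') as Hn2.
  rewrite poincare_fraction by lra.
  assert (Hd2 : Cmod (det2 h) ^ 2 = norm2 (det2 h)) by apply Cmod_sqr.
  assert (Ew : cw q' ^ 2 = norm2 (m11 h * r - m21 h * p)%C * cw q ^ 2 / n ^ 2).
  { rewrite <- Edet, <- Hd2. unfold q', cw; simpl. field. lra. }
  assert (K1 : denominator g q' = nn / n).
  { unfold denominator. rewrite Ew. change (fst q') with (RtoC (/ n) * N)%C.
    replace (norm2 (m21 g * (RtoC (/ n) * N) + m22 g)%C) with (norm2 (m21 g * N + m22 g * RtoC n)%C / n ^ 2).
    2:{ unfold norm2. destruct N, (m21 g), (m22 g). simpl. field. lra. }
    apply Rmult_eq_reg_r with (n ^ 2); [|apply pow_nonzero; lra].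
    replace (nn / n * n ^ 2) with (nn * n) by (field; lra).
    transitivity (norm2 (m21 g * N + m22 g * RtoC n)%C + norm2 (m21 g) * (norm2 (m11 h * r - m21 h * p)%C *
      cw q ^ 2)); [field; lra|].
    rewrite Enn, EN, En. generalize (cw q) as w. clearbody p r. clear. intros w.
    destruct p, r, (m11 h), (m21 h), (m21 g), (m22 g).
    cbv beta iota zeta delta [norm2 Cminus Copp Cplus Cmult RtoC Cconj Re Im fst snd]. ring. }
  assert (K2 : numerator g q' = (RtoC (/ n) * numerator (mul2 g h) q)%C).
  { unfold numerator at 1.
    replace (RtoC (cw q' ^ 2)) with (RtoC (/ n * / n) * RtoC (norm2 (m11 h * r - m21 h * p)%C * cw q ^ 2))%C.
    2:{ rewrite Ew, <- RtoC_mult. f_equal. field. lra. }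
    change (fst q') with (RtoC (/ n) * N)%C.
    replace ((m11 g * (RtoC (/ n) * N) + m12 g) * Cconj (m21 g * (RtoC (/ n) * N) + m22 g))%C with
      (RtoC (/ n * / n) * ((m11 g * N + m12 g * RtoC n) * Cconj (m21 g * N + m22 g * RtoC n)))%C.
    2:{ destruct N, (m21 g), (m22 g), (m11 g), (m12 g). apply injective_projections; simpl; field; lra. }
    replace (m11 g * Cconj (m21 g) * (RtoC (/ n * / n) * RtoC (norm2 (m11 h * r - m21 h * p)%C * cw q ^ 2)))%C
      with (RtoC (/ n * / n) * (m11 g * Cconj (m21 g) * RtoC (norm2 (m11 h * r - m21 h * p)%C * cw q ^ 2)))%C
        by ring.
    rewrite <- Cmult_plus_distr_l.
    replace (RtoC (/ n) * numerator (mul2 g h) q)%C with (RtoC (/ n * / n) * (RtoC n * numerator (mul2 g h)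
      q))%C
      by (rewrite Cmult_assoc, <- RtoC_mult; f_equal; f_equal; field; lra).
    apply (f_equal (Cmult (RtoC (/ n * / n)))).
    rewrite ENN, EN, En. generalize (cw q) as w. clearbody p r. clear. intros w.
    destruct p, r, (m11 h), (m21 h), (m21 g), (m22 g), (m11 g), (m12 g).
    cbv beta iota zeta delta [norm2 Cminus Copp Cplus Cmult RtoC Cconj Re Im fst snd]. f_equal; ring. }
  rewrite K1, K2, Hdet, Cmod_mult. f_equal.
  - rewrite Cmult_assoc, <- RtoC_mult. f_equal. f_equal. field. lra.
  - unfold q', cw; simpl. field. lra.
Qed.

Lemma cder_fst (f : R -> vec) t l : cder (fun s => fst (f s)) t (fst l) ->
  is_derive (fun s => cw (f s)) t (cw l) -> is_vderive f t l.
Proof. intros [H1 H2] H3. split; [|split]; assumption. Qed.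

Lemma rder_norm2 (f : R -> C) t l : cder f t l ->
  is_derive (fun s => norm2 (f s)) t (2 * Re (Cconj (f t) * l)%C).
Proof.
  intros [H1 H2]. unfold norm2. evar_last.
  - apply rder_plus; apply rder_pow2; eassumption.
  - cbv beta. destruct (f t), l. simpl. ring.
Qed.

Lemma rder_Cmod (f : R -> C) t l : f t <> RtoC 0 -> cder f t l ->
  is_derive (fun s => Cmod (f s)) t (Re (Cconj (f t) * l)%C / Cmod (f t)).
Proof.
  intros H0 H. apply (is_derive_ext (fun s => sqrt (norm2 (f s)))).
  { intros s. rewrite <- Cmod_sqr. apply sqrt_pow2, Cmod_ge_0. }
  apply Cmod_gt_0 in H0. assert (Hp : 0 < norm2 (f t)) by (rewrite <- Cmod_sqr; apply pow_lt, H0).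
  evar_last.
  - apply (is_derive_comp sqrt (fun s => norm2 (f s))); [|apply rder_norm2, H].
    apply is_derive_Reals. apply derivable_pt_lim_sqrt, Hp.
  - unfold scal; simpl; unfold mult; simpl. rewrite <- Cmod_sqr, sqrt_pow2 by lra. field. lra.
Qed.

(** A path of matrices through a multiple of the identity moves boundary points with velocity
    (b' + (a' - d') z - c' z^2) / delta, and interior points with the corresponding Killing
    field. *)
Lemma poincare_derivative (a b c d : R -> C) (delta a' b' c' d' : C) q : delta <> RtoC 0 -> 0 < cw q ->
  a 0 = delta -> b 0 = RtoC 0 -> c 0 = RtoC 0 -> d 0 = delta ->
  cder a 0 a' -> cder b 0 b' -> cder c 0 c' -> cder d 0 d' ->
  (forall t, det2 (Mat2 (a t) (b t) (c t) (d t)) <> RtoC 0) ->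
  is_vderive (fun t => poincare (Mat2 (a t) (b t) (c t) (d t)) q) 0
    (killing (b' / delta)%C ((a' - d') / delta)%C (- c' / delta)%C q).
Proof.
  intros Hd Hw Ea Eb Ec Ed Da Db Dc Dd Hdet.
  assert (Hden : forall t, denominator (Mat2 (a t) (b t) (c t) (d t)) q <> 0).
  { intros t. pose proof (denominator_pos _ q (Hdet t) Hw). lra. }
  pose proof (proj1 (Cmod_gt_0 _) Hd) as Hm. pose proof (Cmod_sqr delta) as Hm2.
  assert (Dcd : cder (fun t => c t * fst q + d t)%C 0 (c' * fst q + d')%C).
  { eapply cder_eq; [apply cder_plus; [apply cder_mult; [exact Dc|apply cder_const]|exact Dd]|]. cbv beta.
    ring. }
  assert (Dn : is_derive (fun t => denominator (Mat2 (a t) (b t) (c t) (d t)) q) 0 (2 * Re (Cconj delta * (c'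
    * fst q + d'))%C)).
  { unfold denominator. cbn [m21 m22]. evar_last.
    - apply rder_plus; [apply rder_norm2, Dcd|]. apply rder_mult; [apply rder_norm2, Dc|].
      apply rder_const.
    - cbv beta. rewrite Ec, Ed. change (@zero R_NormedModule) with 0.
      replace (RtoC 0 * fst q + delta)%C with delta by ring.
      assert (E0 : norm2 (RtoC 0) = 0) by (unfold norm2; simpl; ring). rewrite E0.
      replace (Re (Cconj (RtoC 0) * c')%C) with 0 by (destruct c'; simpl; ring). ring. }
  assert (DN : cder (fun t => numerator (Mat2 (a t) (b t) (c t) (d t)) q) 0
     ((a' * fst q + b') * Cconj delta + delta * fst q * Cconj (c' * fst q + d') + delta * Cconj c' * RtoC (cw
       q ^ 2))%C).
  { unfold numerator. cbn [m11 m12 m21 m22]. eapply cder_eq.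
    - apply cder_plus; [apply cder_mult; [apply cder_plus; [apply cder_mult;
      [exact Da|apply cder_const]|exact Db]|apply cder_conj, Dcd]|].
      apply cder_mult; [apply cder_mult; [exact Da|apply cder_conj, Dc]|apply cder_const].
    - cbv beta. rewrite Ea, Eb, Ec, Ed.
      replace (RtoC 0 * fst q + delta)%C with delta by ring.
      replace (Cconj (RtoC 0)) with (RtoC 0) by (apply injective_projections; simpl; ring). ring. }
  assert (Ddet : cder (fun t => det2 (Mat2 (a t) (b t) (c t) (d t))) 0 (delta * (a' + d'))%C).
  { unfold det2. cbn [m11 m12 m21 m22]. eapply cder_eq.
    - apply cder_minus; apply cder_mult; eassumption.
    - rewrite Ea, Eb, Ec, Ed. ring. }
  assert (En0 : denominator (Mat2 (a 0) (b 0) (c 0) (d 0)) q = norm2 delta).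
  { unfold denominator. cbn [m21 m22]. rewrite Ec, Ed. replace (RtoC 0 * fst q + delta)%C with delta by ring.
    unfold norm2; simpl. ring. }
  assert (EN0 : numerator (Mat2 (a 0) (b 0) (c 0) (d 0)) q = (RtoC (norm2 delta) * fst q)%C).
  { unfold numerator. cbn [m11 m12 m21 m22]. rewrite Ea, Eb, Ec, Ed. destruct delta, (fst q). unfold norm2.
    apply injective_projections; simpl; ring. }
  assert (Ed0 : det2 (Mat2 (a 0) (b 0) (c 0) (d 0)) = (delta * delta)%C).
  { unfold det2. cbn [m11 m12 m21 m22]. rewrite Ea, Eb, Ec, Ed. ring. }
  assert (Hn2 : 0 < norm2 delta) by (rewrite <- Hm2; apply pow_lt, Hm).
  assert (Einv : (/ delta)%C = (RtoC (/ norm2 delta) * Cconj delta)%C).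
  { unfold norm2 in *. destruct delta as [x y]. simpl in Hn2. apply injective_projections; simpl; field; lra.
    }
  replace (fun t => poincare (Mat2 (a t) (b t) (c t) (d t)) q) with
   (fun t => ((RtoC (/ denominator (Mat2 (a t) (b t) (c t) (d t)) q) * numerator (Mat2 (a t) (b t) (c t) (d
     t)) q)%C,
     Cmod (det2 (Mat2 (a t) (b t) (c t) (d t))) * cw q / denominator (Mat2 (a t) (b t) (c t) (d t)) q) : vec).
  2:{ apply functional_extensionality. intros t. symmetry. apply poincare_fraction, Hden. }
  apply cder_fst.
  - cbn [fst]. eapply cder_eq.
    + apply cder_mult; [apply cder_RtoC, rder_inv; [apply Hden|exact Dn]|exact DN].
    + cbv beta. rewrite En0, EN0. unfold killing, quad. cbn [fst]. fold (cw q).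
      unfold Cdiv. rewrite Einv.
      generalize (cw q) as w, (fst q) as z. destruct delta as [x y], a', b', c', d'. intros w [u v].
      unfold norm2 in *. cbn [Re Im fst snd] in *.
      cbv beta iota zeta delta [Cminus Copp Cplus Cmult RtoC Cconj Re Im fst snd]. f_equal; field; lra.
  - unfold cw at 1. cbn [snd]. evar_last.
    + apply rder_div; [apply Hden| |exact Dn].
      apply rder_mult; [apply rder_Cmod; [apply Hdet|exact Ddet]|apply rder_const].
    + cbv beta. rewrite En0, Ed0, Cmod_mult. change (@zero R_NormedModule) with 0.
      unfold killing, cw at 3, quad'. cbn [snd]. fold (cw q).
      replace (Cmod delta * Cmod delta) with (norm2 delta) by (rewrite <- Hm2; ring).
      unfold Cdiv. rewrite Einv.
      generalize (cw q) as w, (fst q) as z. destruct delta as [x y], a', b', c', d'. intros w [u v].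
      unfold norm2 in *. cbn [Re Im fst snd] in *.
      cbv beta iota zeta delta [Cminus Copp Cplus Cmult RtoC Cconj Re Im fst snd]. field; lra.
Qed.

(** The multiplication by [l] on the boundary, transported from (0, infinity) to the geodesic
    joining the images of 0 and infinity under [g]. *)
Definition flow_matrix (g : mat2) (l : C) : mat2 := mul2 g (mul2 (Mat2 l (RtoC 0) (RtoC 0) (RtoC 1)) (adj2
  g)).

Lemma diagonal_action l q : l <> RtoC 0 -> 0 < cw q ->
  poincare (Mat2 l (RtoC 0) (RtoC 0) (RtoC 1)) q = ((l * fst q)%C, Cmod l * cw q).
Proof.
  intros Hl Hw. assert (E : denominator (Mat2 l (RtoC 0) (RtoC 0) (RtoC 1)) q = 1).
  { unfold denominator, norm2; simpl. destruct (fst q); simpl. ring. }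
  rewrite poincare_fraction by (rewrite E; lra). rewrite E. unfold numerator, det2. cbn [m11 m12 m21 m22].
    f_equal.
  - destruct l, (fst q). apply injective_projections; simpl; field.
  - replace (l * RtoC 1 - RtoC 0 * RtoC 0)%C with l by ring. field.
Qed.

(** For [k = 1] the field of the translation and for [k = i] that of the rotation: on the
    boundary it is k times the field z d/dz transported by [g]. *)
Definition geodesic_field (g : mat2) (k : C) : vec -> vec :=
  killing (- (k * (m11 g * m12 g)) / det2 g)%C (k * (m11 g * m22 g + m12 g * m21 g) / det2 g)%C
    (- (k * (m21 g * m22 g)) / det2 g)%C.

(** The conjugated flow acts through the matrices [flow_matrix g (l t)], which pass through
    [det2 g] times the identity at time 0. *)
Lemma conjugated_flow_killing g (l : R -> C) (l' : C) (Phi : R -> vec -> vec) q :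
  det2 g <> RtoC 0 -> l 0 = RtoC 1 -> (forall t, l t <> RtoC 0) -> cder l 0 l' -> 0 < cw q ->
  (forall t p, 0 < cw p -> Phi t p = ((l t * fst p)%C, Cmod (l t) * cw p)) ->
  killing_field (fun t q => poincare g (Phi t (poincare (adj2 g) q))) q =
  geodesic_field g l' q.
Proof.
  intros Hg H1 Hl Dl Hw HPhi. unfold killing_field, geodesic_field.
  assert (Hadj : det2 (adj2 g) = det2 g) by (unfold det2, adj2; simpl; ring).
  assert (Hdl : forall t, det2 (Mat2 (l t) (RtoC 0) (RtoC 0) (RtoC 1)) = l t) by (intros t; unfold det2;
    simpl; ring).
  assert (Hw' : 0 < cw (poincare (adj2 g) q)).
  { assert (Hp : 0 < denominator (adj2 g) q) by (apply denominator_pos; [rewrite Hadj|]; assumption).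
    rewrite poincare_fraction by lra. unfold cw; simpl; fold (cw q).
    apply Rdiv_lt_0_compat; [|exact Hp]. apply Rmult_lt_0_compat; [|exact Hw]. apply Cmod_gt_0. rewrite Hadj.
      exact Hg. }
  assert (Hdm : forall t, det2 (flow_matrix g (l t)) = (det2 g * l t * det2 g)%C).
  { intros t. unfold det2, flow_matrix, mul2, adj2. cbn [m11 m12 m21 m22]. ring. }
  assert (E : (fun t => poincare g (Phi t (poincare (adj2 g) q))) = fun t => poincare (flow_matrix g (l t))
    q).
  { apply functional_extensionality. intros t. rewrite HPhi by exact Hw'.
    rewrite <- diagonal_action by auto. unfold flow_matrix.
    rewrite (poincare_mul (Mat2 (l t) (RtoC 0) (RtoC 0) (RtoC 1)) (adj2 g)); [|rewrite Hdl;
      auto|rewrite Hadj; exact Hg|exact Hw].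
    rewrite poincare_mul; auto.
    assert (K : (det2 (mul2 (Mat2 (l t) (RtoC 0) (RtoC 0) (RtoC 1)) (adj2 g)) = l t * det2 g)%C).
    { unfold det2, mul2, adj2. cbn [m11 m12 m21 m22]. ring. }
    rewrite K. apply Cmult_neq_0; auto. }
  rewrite E. apply vDerive_unique.
  assert (EM : forall t, flow_matrix g (l t) = Mat2 (m11 g * m22 g * l t + - (m12 g * m21 g))%C (m11 g * m12
    g * (RtoC 1 - l t))%C
      (m21 g * m22 g * (l t - RtoC 1))%C (m11 g * m22 g + - (m12 g * m21 g * l t))%C).
  { intros t. unfold flow_matrix, mul2, adj2. cbn [m11 m12 m21 m22]. f_equal; ring. }
  replace (fun t => poincare (flow_matrix g (l t)) q) with (fun t => poincare (Mat2 (m11 g * m22 g * l t + -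
    (m12 g * m21 g))%C (m11 g * m12 g * (RtoC 1 - l t))%C
      (m21 g * m22 g * (l t - RtoC 1))%C (m11 g * m22 g + - (m12 g * m21 g * l t))%C) q).
  2:{ apply functional_extensionality. intros t. rewrite EM. reflexivity. }
  replace (- (l' * (m11 g * m12 g)))%C with (m11 g * m12 g * (- l'))%C by ring.
  replace (l' * (m11 g * m22 g + m12 g * m21 g))%C with (m11 g * m22 g * l' - - (m12 g * m21 g * l'))%C by
    ring.
  replace (l' * (m21 g * m22 g))%C with (m21 g * m22 g * l')%C by ring.
  apply poincare_derivative; auto.
  - unfold det2. rewrite H1. ring.
  - rewrite H1. ring.
  - rewrite H1. ring.
  - unfold det2. rewrite H1. ring.
  - eapply cder_eq; [apply cder_plus; [apply cder_mult; [apply cder_const|exact Dl]|apply cder_const]|].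
    cbv beta. ring.
  - eapply cder_eq; [apply cder_mult; [apply cder_const|apply cder_minus; [apply cder_const|exact Dl]]|].
    cbv beta. ring.
  - eapply cder_eq; [apply cder_mult; [apply cder_const|apply cder_minus; [exact Dl|apply cder_const]]|].
    cbv beta. ring.
  - eapply cder_eq; [apply cder_plus; [apply cder_const|apply cder_opp, cder_mult;
    [apply cder_const|exact Dl]]|]. cbv beta. ring.
  - intros t. rewrite <- EM, Hdm. apply Cmult_neq_0; auto. apply Cmult_neq_0; auto.
Qed.

Lemma translation_killing a b q : det2 (to_geodesic a b) <> RtoC 0 -> 0 < cw q ->
  killing_field (translation a b) q = geodesic_field (to_geodesic a b) (RtoC 1) q.
Proof.
  intros Hg Hw.
  apply (conjugated_flow_killing _ (fun t => RtoC (exp t)) (RtoC 1) (fun t q => vscal (exp t) q)); auto.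
  - rewrite exp_0. reflexivity.
  - intros t H. apply RtoC_inj in H. pose proof (exp_pos t). lra.
  - apply cder_RtoC. evar_last; [apply is_derive_exp|apply exp_0].
  - intros t p Hp. rewrite Cmod_R, Rabs_right by (left; apply exp_pos).
    generalize (exp t) as e. intros e. destruct p as [[u v] w].
    unfold vscal, mkvec, cu, cv, cw. apply injective_projections; [|reflexivity].
    apply injective_projections; simpl; ring.
Qed.

Lemma rotation_killing a b q : det2 (to_geodesic a b) <> RtoC 0 -> 0 < cw q ->
  killing_field (rotation a b) q = geodesic_field (to_geodesic a b) (Ci) q.
Proof.
  intros Hg Hw.
  assert (Hc : forall t, Cmod (cis t) = 1).
  { intros t. unfold cis. rewrite <- (Rmult_1_l (cos t)), <- (Rmult_1_l (sin t)). apply Cmod_polar; lra. }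
  apply (conjugated_flow_killing _ cis Ci (fun t q => ((cis t * fst q)%C, snd q))); auto.
  - unfold cis. rewrite cos_0, sin_0. reflexivity.
  - intros t H. specialize (Hc t). rewrite H, Cmod_0 in Hc. lra.
  - split; simpl.
    + evar_last; [apply is_derive_cos|]. rewrite sin_0. ring.
    + evar_last; [apply is_derive_sin|]. apply cos_0.
  - intros t p Hp. rewrite Hc, Rmult_1_l. reflexivity.
Qed.

(** * The one-forms of a Bryant representation *)

Definition line (s e : C) (t : R) : C := (s + RtoC t * e)%C.

Lemma line_0 s e : line s e 0 = s.
Proof. unfold line. destruct s, e. apply injective_projections; simpl; ring. Qed.

Lemma cder_line s e t : cder (line s e) t e.
Proof.
  unfold line. eapply cder_eq.
  - apply cder_plus; [apply cder_const|apply cder_mult; [|apply cder_const]].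
    apply (cder_RtoC (fun x => x) t 1), rder_id.
  - cbv beta. destruct e; apply injective_projections; simpl; ring.
Qed.

(** The bounds on [e] are tailored to the directions 1 and i. *)
Lemma line_near U s e : open U -> U s -> Rabs (Re e) <= 1 -> Rabs (Im e) <= 1 ->
  locally 0 (fun t => U (line s e t)).
Proof.
  intros HU Hs H1 H2. destruct (HU s Hs) as [d Hd]. exists d. intros t Ht. apply Hd.
  assert (Ht' : Rabs t < d). { rewrite <- (Rminus_0_r t). exact Ht. }
  pose proof (Rabs_pos t).
  split.
  - change (Rabs (Re (line s e t) - Re s) < d). replace (Re (line s e t) - Re s) with (t * Re e).
    + rewrite Rabs_mult. pose proof (Rabs_pos (Re e)). nra.
    + unfold line. destruct s, e; simpl; ring.
  - change (Rabs (Im (line s e t) - Im s) < d). replace (Im (line s e t) - Im s) with (t * Im e).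
    + rewrite Rabs_mult. pose proof (Rabs_pos (Im e)). nra.
    + unfold line. destruct s, e; simpl; ring.
Qed.

Lemma is_vderive_unique_loc f g (t : R) l m : locally t (fun s => f s = g s) ->
  is_vderive f t l -> is_vderive g t m -> l = m.
Proof.
  intros He (F1 & F2 & F3) (G1 & G2 & G3). apply vec_eq.
  - rewrite <- (is_derive_unique _ _ _ F1), <- (is_derive_unique _ _ _ G1). apply Derive_ext_loc.
    revert He. apply filter_imp. intros s ->. reflexivity.
  - rewrite <- (is_derive_unique _ _ _ F2), <- (is_derive_unique _ _ _ G2). apply Derive_ext_loc.
    revert He. apply filter_imp. intros s ->. reflexivity.
  - rewrite <- (is_derive_unique _ _ _ F3), <- (is_derive_unique _ _ _ G3). apply Derive_ext_loc.
    revert He. apply filter_imp. intros s ->. reflexivity.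
Qed.

(** The density transforms as the coefficient of a form of type (1, 0): the partial derivatives
    of the composition with a holomorphic map of derivative [m] are those on the left. *)
Lemma density_change_parameter t0 t1 t2 q a b m :
  (density t0 t1 t2 q (vadd (vscal (Re m) a) (vscal (Im m) b)) (vadd (vscal (Re (m * Ci)) a) (vscal (Im (m *
    Ci)) b))
   = density t0 t1 t2 q a b * m)%C.
Proof.
  unfold density.
  assert (K : forall x y : C, d_z (RtoC (Re m) * x + RtoC (Im m) * y) (RtoC (Re (m * Ci)) * x + RtoC (Im (m *
    Ci)) * y) = (d_z x y * m)%C).
  { intros [x1 x2] [y1 y2]. destruct m as [m1 m2]. unfold d_z. apply injective_projections; simpl; field. }
  assert (L : forall x y, fst (vadd (vscal x a) (vscal y b)) = (RtoC x * fst a + RtoC y * fst b)%C).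
  { intros x y. destruct a as [[a1 a2] a3], b as [[b1 b2] b3].
    apply injective_projections; unfold vadd, vscal, mkvec, cu, cv, cw; simpl; ring. }
  assert (L' : forall x y, RtoC (cw (vadd (vscal x a) (vscal y b))) = (RtoC x * RtoC (cw a) + RtoC y * RtoC
    (cw b))%C).
  { intros x y. destruct a as [[a1 a2] a3], b as [[b1 b2] b3].
    apply injective_projections; unfold vadd, vscal, mkvec, cu, cv, cw; simpl; ring. }
  assert (LC : forall (x y : R) (z w : C), Cconj (RtoC x * z + RtoC y * w)%C = (RtoC x * Cconj z + RtoC y *
    Cconj w)%C).
  { intros x y [] []. apply injective_projections; simpl; ring. }
  rewrite !L, !L', !LC, !K. ring.
Qed.

(** P and Q are the two components of a real linear map [P e + Q (Cconj e)], which is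
    evaluated in the directions 1 and i. *)
Lemma d_z_real_linear P Q : (d_z (P * RtoC 1 + Q * Cconj (RtoC 1)) (P * Ci + Q * Cconj Ci) = P)%C.
Proof. destruct P, Q. unfold d_z. apply injective_projections; simpl; field. Qed.

Lemma RtoC_norm2 z : RtoC (norm2 z) = (z * Cconj z)%C.
Proof. unfold norm2. destruct z. apply injective_projections; simpl; ring. Qed.

Lemma Cmult_cancel_r n x y : n <> RtoC 0 -> (x * n = y * n)%C -> x = y.
Proof.
  intros Hn H. replace x with (x * n / n)%C by (field; exact Hn). rewrite H. field. exact Hn.
Qed.

(** Capital letters stand for the conjugates of the small ones, which are treated as
    independent variables. The three densities come out as the entries of dF F^-1; the second
    one needs the determinant relation and the third one also its derivative. *)
Lemma representation_algebra (a b c d a' b' c' d' A B C0 D n t0 t1 t2 : C) : n <> RtoC 0 ->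
  (a * d - b * c = RtoC 1)%C -> (a' * d + a * d' - (b' * c + b * c') = RtoC 0)%C ->
  (A * D - B * C0 = RtoC 1)%C -> n = (a * A + b * B)%C ->
  let zeta := ((A * c + B * d) / n)%C in
  let nz := (A * a' + B * b')%C in
  (quad t0 t1 t2 zeta * ((a' * C0 + b' * D - (a * C0 + b * D) / n * nz) / n) * (n * n)
    + quad' t1 t2 zeta * (- nz / (n * n)) * n - t2 * ((A * c' + B * d' - zeta * nz) / n)
   = - t0 * (b * a' - a * b') + t1 * (c * b' - d * a') - t2 * (d * c' - c * d'))%C.
Proof.
  intros Hn H1 H2 H3 En zeta nz.
  (* The density of the constant polynomial 1, with 1/n for the height. *)
  assert (K0 : ((a' * C0 + b' * D - (a * C0 + b * D) / n * nz) / n * (n * n) = a * b' - a' * b)%C).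
  { transitivity (((a' * C0 + b' * D) * n - (a * C0 + b * D) * nz))%C; [field; exact Hn|].
    rewrite En. unfold nz. transitivity ((a * b' - a' * b) * (A * D - B * C0))%C; [ring|]. rewrite H3. ring. }
  (* The logarithmic derivative of the height. *)
  assert (K1 : (- nz / (n * n) * n = (c * b' - d * a') - zeta * (a * b' - a' * b))%C).
  { apply (Cmult_cancel_r n); [exact Hn|]. unfold zeta.
    transitivity (- nz)%C; [field; exact Hn|].
    transitivity ((c * b' - d * a') * n - (A * c + B * d) * (a * b' - a' * b))%C; [|field; exact Hn].
    rewrite En. unfold nz. transitivity (- (A * a' + B * b') * (a * d - b * c))%C; [rewrite H1; ring|ring]. }
  (* The part of the derivative of zeta that does not involve that of n. *)
  assert (K2 : ((A * c' + B * d') / n = d * c' - c * d' + zeta * (c * b' - d * a'))%C).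
  { apply (Cmult_cancel_r n); [exact Hn|]. unfold zeta.
    transitivity (A * c' + B * d')%C; [field; exact Hn|].
    transitivity ((d * c' - c * d') * n + (A * c + B * d) * (c * b' - d * a'))%C; [|field; exact Hn].
    rewrite En.
    transitivity ((A * c' + B * d') * (a * d - b * c) - (A * c + B * d) * (a' * d + a * d' - (b' * c + b *
      c')))%C; [rewrite H1, H2; ring|ring]. }
  assert (K3 : ((A * c' + B * d' - zeta * nz) / n = (A * c' + B * d') / n + zeta * (- nz / (n * n) * n))%C)
    by (field; exact Hn).
  rewrite K3, K2, <- Cmult_assoc, K0, <- (Cmult_assoc (quad' t1 t2 zeta)), K1. unfold quad, quad'. ring.
Qed.

(** The immersion on the cover is a rational function of the entries of F and their conjugates.
    Computing its derivatives in the directions 1 and i through the chain rule and through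
    this formula gives the two sides. *)
Lemma representation_density Om U p X A B C' D t0 t1 t2 s : bryant_end Om X ->
  open U -> holomorphic_on U p -> (forall s, U s -> punctured Om (p s)) ->
  bryant_representation U p X A B C' D -> U s ->
  (surface_density X t0 t1 t2 (p s) * C_derive p s =
    - t0 * (B s * C_derive A s - A s * C_derive B s)
    + t1 * (C' s * C_derive B s - D s * C_derive A s)
    - t2 * (D s * C_derive C' s - C' s * C_derive D s))%C.
Proof.
  intros HB HU Hp Hpu (HA & HBh & HC & HD & Hrep) Hs.
  destruct (bryant_end_smooth Om X HB) as (HW & HS & Hw0).
  assert (Dp := C_derive_correct p s s (Hp s Hs)). assert (DA := C_derive_correct A s s (HA s Hs)).
  assert (DB := C_derive_correct B s s (HBh s Hs)). assert (DC := C_derive_correct C' s s (HC s Hs)).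
  assert (DD := C_derive_correct D s s (HD s Hs)).
  set (p1 := C_derive p s) in *. set (a' := C_derive A s) in *. set (b' := C_derive B s) in *.
  set (c' := C_derive C' s) in *. set (d' := C_derive D s) in *.
  assert (Hline : forall e f l, is_derive (K := C_AbsRing) (V := C_NormedModule) f s l ->
    cder (fun t => f (line s e t)) 0 (l * e)%C).
  { intros e f l Hf. apply holomorphic_comp_curve; [rewrite line_0; exact Hf|apply cder_line]. }
  assert (Hnz : forall s, U s -> norm2 (A s) + norm2 (B s) <> 0).
  { intros s1 Hs1 H0. pose proof (norm2_ge0 (A s1)). pose proof (norm2_ge0 (B s1)).
    assert (E1 : A s1 = RtoC 0) by (apply norm2_eq0; lra).
      assert (E2 : B s1 = RtoC 0) by (apply norm2_eq0; lra).
    destruct (Hrep s1 Hs1) as (E & _). rewrite E1, E2 in E.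
    apply (f_equal Re) in E. destruct (C' s1), (D s1). simpl in E. lra. }
  set (n := norm2 (A s) + norm2 (B s)).
  assert (Hn : n <> 0) by (apply Hnz, Hs).
  set (N := (Cconj (A s) * C' s + Cconj (B s) * D s)%C).
  assert (EX : forall s, U s -> X (p s) =
    ((RtoC (/ (norm2 (A s) + norm2 (B s))) * (Cconj (A s) * C' s + Cconj (B s) * D s))%C,
     / (norm2 (A s) + norm2 (B s)))).
  { intros s1 Hs1. destruct (Hrep s1 Hs1) as (_ & _ & E). rewrite E, !Cmod_sqr.
    pose proof (Hnz s1 Hs1) as Hn1.
    f_equal; [|field; exact Hn1]. rewrite RtoC_inv by exact Hn1. unfold Cdiv. ring. }
  set (zeta := (RtoC (/ n) * N)%C).
  set (nz := (Cconj (A s) * a' + Cconj (B s) * b')%C).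
  set (P := (RtoC (/ n) * (Cconj (A s) * c' + Cconj (B s) * d' - zeta * nz))%C).
  set (Q := (RtoC (/ n) * (Cconj a' * C' s + Cconj b' * D s - zeta * Cconj nz))%C).
  set (V := (- (RtoC (/ n * / n)) * nz)%C).
  assert (HT : forall e, Rabs (Re e) <= 1 -> Rabs (Im e) <= 1 ->
     fst (vadd (vscal (Re (p1 * e)) (dx X (p s))) (vscal (Im (p1 * e)) (dy X (p s)))) = (P * e + Q * Cconj
       e)%C /\
     RtoC (cw (vadd (vscal (Re (p1 * e)) (dx X (p s))) (vscal (Im (p1 * e)) (dy X (p s))))) = (V * e + Cconj
       V * Cconj e)%C).
  { intros e He1 He2.
    destruct (Hline e p p1 Dp) as [Dp1 Dp2].
    assert (Hwp : on_plane (punctured Om) (Re (p (line s e 0))) (Im (p (line s e 0)))).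
    { rewrite line_0. unfold on_plane. specialize (Hpu s Hs). destruct (p s); exact Hpu. }
    pose proof (vsmooth_comp_curve 1 _ X (fun t => Re (p (line s e t))) (fun t => Im (p (line s e t))) 0 _ _
      HW HS Hwp Dp1 Dp2) as T1.
    cbv beta in T1. rewrite line_0 in T1.
    assert (Ep : (Re (p s), Im (p s)) = p s) by (destruct (p s); reflexivity). rewrite Ep in T1.
    pose proof (Hline e A a' DA) as LA. pose proof (Hline e B b' DB) as LB.
    pose proof (Hline e C' c' DC) as LC. pose proof (Hline e D d' DD) as LD.
    assert (Dn : is_derive (fun t => norm2 (A (line s e t)) + norm2 (B (line s e t))) 0 (2 * Re (nz * e)%C)).
    { evar_last; [apply rder_plus; [apply rder_norm2, LA|apply rder_norm2, LB]|]. cbv beta. rewrite line_0.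
      unfold nz. destruct (A s), (B s), a', b', e. simpl. ring. }
    assert (Hn0 : norm2 (A (line s e 0)) + norm2 (B (line s e 0)) <> 0) by (rewrite line_0; exact Hn).
    assert (T2 : is_vderive (fun t => ((RtoC (/ (norm2 (A (line s e t)) + norm2 (B (line s e t)))) *
         (Cconj (A (line s e t)) * C' (line s e t) + Cconj (B (line s e t)) * D (line s e t)))%C,
           / (norm2 (A (line s e t)) + norm2 (B (line s e t)))) : vec) 0
         ((P * e + Q * Cconj e)%C, Re (V * e + Cconj V * Cconj e)%C)).
    { apply cder_fst; cbn [fst].
      - eapply cder_eq.
        + apply cder_mult; [apply cder_RtoC, rder_inv; [exact Hn0|exact Dn]|].
          apply cder_plus; apply cder_mult; [apply cder_conj, LA|exact LC|apply cder_conj, LB|exact LD].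
        + cbv beta. rewrite !line_0. fold n. fold N. unfold P, Q, zeta.
          replace (RtoC (- (2 * Re (nz * e)) / n ^ 2)) with (- (RtoC (/ n) * RtoC (/ n) * (nz * e + Cconj nz
            * Cconj e)))%C.
          2:{ destruct nz, e. apply injective_projections; simpl; field; exact Hn. }
          rewrite !Cmult_conj. ring.
      - unfold cw at 1. cbn [snd]. evar_last; [apply rder_inv; [exact Hn0|exact Dn]|]. cbv beta.
        rewrite line_0. fold n. unfold cw; cbn [snd]. unfold V. destruct nz, e. simpl. field. exact Hn. }
    assert (E : vadd (vscal (Re (p1 * e)) (dx X (p s))) (vscal (Im (p1 * e)) (dy X (p s))) =
       ((P * e + Q * Cconj e)%C, Re (V * e + Cconj V * Cconj e)%C)).
    { eapply is_vderive_unique_loc; [|exact T1|exact T2].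
      generalize (line_near U s e HU Hs He1 He2). apply filter_imp. intros t Ht.
      rewrite <- EX by exact Ht. f_equal. destruct (p (line s e t)); reflexivity. }
    rewrite E. unfold cw; cbn [fst snd]. split; [reflexivity|].
    destruct V, e. apply injective_projections; simpl; ring. }
  unfold surface_density. rewrite <- density_change_parameter.
  destruct (HT (RtoC 1)) as [Z1 W1]. { simpl. rewrite Rabs_R1; lra. } { simpl. rewrite Rabs_R0; lra. }
  destruct (HT Ci) as [Z2 W2]. { simpl. rewrite Rabs_R0; lra. } { simpl. rewrite Rabs_R1; lra. }
  replace (p1 * RtoC 1)%C with p1 in Z1, W1 by ring.
  unfold density. rewrite Z1, Z2, W1, W2.
  assert (CJ : forall P Q e : C, Cconj (P * e + Q * Cconj e)%C = (Cconj Q * e + Cconj P * Cconj e)%C).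
  { intros [] [] []. apply injective_projections; simpl; ring. }
  rewrite !CJ, !d_z_real_linear.
  rewrite (EX s Hs). fold n. fold N. fold zeta. unfold cw; cbn [fst snd].
  (* The derivative of the determinant, which is constant. *)
  assert (Hdet : (a' * D s + A s * d' - (b' * C' s + B s * c') = RtoC 0)%C).
  { assert (K : cder (fun t => A (line s (RtoC 1) t) * D (line s (RtoC 1) t) - B (line s (RtoC 1) t) * C'
    (line s (RtoC 1) t))%C 0
       (a' * D s + A s * d' - (b' * C' s + B s * c'))%C).
    { eapply cder_eq; [apply cder_minus; apply cder_mult; apply Hline; eassumption|]. cbv beta.
      rewrite line_0. ring. }
    destruct K as [K1 K2].
    assert (Hnear : locally 0 (fun t => U (line s (RtoC 1) t))).
    { apply line_near; auto; simpl; [rewrite Rabs_R1|rewrite Rabs_R0]; lra. }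
    apply injective_projections.
    - etransitivity; [symmetry; exact (is_derive_unique _ _ _ K1)|].
      rewrite (Derive_ext_loc _ (fun _ => 1)); [apply Derive_const|].
      revert Hnear. apply filter_imp. intros t Ht. destruct (Hrep _ Ht) as (E & _). rewrite E. reflexivity.
    - etransitivity; [symmetry; exact (is_derive_unique _ _ _ K2)|].
      rewrite (Derive_ext_loc _ (fun _ => 0)); [apply Derive_const|].
      revert Hnear. apply filter_imp. intros t Ht. destruct (Hrep _ Ht) as (E & _). rewrite E. reflexivity. }
  assert (H1 : (A s * D s - B s * C' s = RtoC 1)%C) by apply (Hrep s Hs).
  assert (H3 : (Cconj (A s) * Cconj (D s) - Cconj (B s) * Cconj (C' s) = RtoC 1)%C).
  { rewrite <- !Cmult_conj, <- Cminus_conj, H1. apply injective_projections; simpl; ring. }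
  assert (En : RtoC n = (A s * Cconj (A s) + B s * Cconj (B s))%C).
  { unfold n. rewrite RtoC_plus, !RtoC_norm2. reflexivity. }
  assert (HnC : RtoC n <> RtoC 0) by (intros H0; apply RtoC_inj in H0; contradiction).
  pose proof (representation_algebra (A s) (B s) (C' s) (D s) a' b' c' d' (Cconj (A s)) (Cconj (B s)) (Cconj
    (C' s)) (Cconj (D s)) (RtoC n) t0 t1 t2 HnC H1 Hdet H3 En) as K.
  cbv zeta in K. rewrite <- K. fold N nz.
  assert (Ezeta : (N / RtoC n)%C = zeta) by (unfold zeta, Cdiv; rewrite RtoC_inv by exact Hn; ring).
  rewrite Ezeta.
  assert (EQ : Cconj Q = ((a' * Cconj (C' s) + b' * Cconj (D s) - (A s * Cconj (C' s) + B s * Cconj (D s)) /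
    RtoC n * nz) / RtoC n)%C).
  { unfold Q, zeta, N, Cdiv. rewrite <- RtoC_inv by exact Hn.
    destruct (A s), (B s), (C' s), (D s), a', b', nz. apply injective_projections; simpl; ring. }
  rewrite EQ.
  replace (RtoC (/ (/ n) ^ 2)) with (RtoC n * RtoC n)%C by (rewrite <- RtoC_mult; f_equal; field; exact Hn).
  replace (RtoC (/ / n)) with (RtoC n) by (f_equal; field; exact Hn).
  replace V with (- nz / (RtoC n * RtoC n))%C.
  2:{ unfold V. rewrite RtoC_mult, RtoC_inv by exact Hn. field. exact HnC. }
  replace P with ((Cconj (A s) * c' + Cconj (B s) * d' - zeta * nz) / RtoC n)%C.
  2:{ unfold P. rewrite RtoC_inv by exact Hn. unfold Cdiv. ring. }
  reflexivity.
Qed.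

(** * Existence of a generator and of a spanning disk *)

Lemma is_derive_mult_abs s : is_derive (fun x => x * Rabs x) s (2 * Rabs s).
Proof.
  destruct (Req_dec s 0) as [->|Hs].
  - apply is_derive_Reals. intros eps He. exists (mkposreal eps He). intros h Hh Hlt. simpl in Hlt.
    rewrite Rabs_R0. replace (((0 + h) * Rabs (0 + h) - 0 * 0) / h - 2 * 0) with (Rabs h).
    + rewrite Rabs_Rabsolu. exact Hlt.
    + rewrite Rplus_0_l. field. exact Hh.
  - evar_last.
    + apply (rder_mult (fun x => x) Rabs); [apply rder_id|].
      apply (is_derive_Rabs (fun x => x) s 1); [apply rder_id|exact Hs].
    + unfold one; simpl. destruct (Rlt_dec 0 s).
      * rewrite sign_eq_1, Rabs_right by lra. ring.
      * rewrite sign_eq_m1, Rabs_left by lra. ring.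
Qed.

Lemma smooth_abs W f : smooth 0 W f -> smooth 0 W (fun x y => Rabs (f x y)).
Proof.
  intros Hf x y Hw. split; [|exact I].
  apply (continuity_1d_2d_pt_comp Rabs f); [apply Rcontinuity_abs|eapply smooth_cont; eauto].
Qed.

Lemma smooth_mult_abs W f : open2 W -> smooth 1 W f -> smooth 1 W (fun x y => f x y * Rabs (f x y)).
Proof.
  intros HW Hf.
  assert (H0 : smooth 0 W f) by (eapply smooth_le; [|exact Hf]; lia).
  apply smooth_intro with (fun x y => 2 * Rabs (f x y) * px f x y) (fun x y => 2 * Rabs (f x y) * py f x y);
    auto.
  - intros x y Hw. evar_last.
    + apply (is_derive_comp (fun s => s * Rabs s) (fun z => f z y));
      [apply is_derive_mult_abs|apply (smooth_is_px 0 W); auto].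
    + unfold scal; simpl; unfold mult; simpl. ring.
  - intros x y Hw. evar_last.
    + apply (is_derive_comp (fun s => s * Rabs s) (f x)); [apply is_derive_mult_abs|apply (smooth_is_py 0 W);
      auto].
    + unfold scal; simpl; unfold mult; simpl. ring.
  - apply smooth_mult; auto using smooth_abs.
  - apply smooth_mult; auto using smooth_px, smooth_mult, smooth_const, smooth_abs.
  - apply smooth_mult; auto using smooth_py, smooth_mult, smooth_const, smooth_abs.
Qed.

Lemma smooth_sqr_abs W f : open2 W -> smooth 2 W f -> smooth 2 W (fun x y => f x y * (f x y * Rabs (f x y))).
Proof.
  intros HW Hf.
  assert (H1 : smooth 1 W f) by (eapply smooth_le; [|exact Hf]; lia).
  assert (H0 : smooth 0 W f) by (eapply smooth_le; [|exact Hf]; lia).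
  assert (HD : forall s, is_derive (fun s => s * (s * Rabs s)) s (3 * (s * Rabs s))).
  { intros s. evar_last.
    - apply (rder_mult (fun s => s) (fun s => s * Rabs s)); [apply rder_id|apply is_derive_mult_abs].
    - unfold one; simpl. ring. }
  apply smooth_intro with (fun x y => 3 * (f x y * Rabs (f x y)) * px f x y) (fun x y => 3 * (f x y * Rabs (f
    x y)) * py f x y); auto.
  - intros x y Hw. evar_last.
    + apply (is_derive_comp (fun s => s * (s * Rabs s)) (fun z => f z y));
      [apply HD|apply (smooth_is_px 1 W); auto].
    + unfold scal; simpl; unfold mult; simpl. ring.
  - intros x y Hw. evar_last.
    + apply (is_derive_comp (fun s => s * (s * Rabs s)) (f x)); [apply HD|apply (smooth_is_py 1 W); auto].
    + unfold scal; simpl; unfold mult; simpl. ring.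
  - apply smooth_mult; auto. apply smooth_mult; auto using smooth_abs.
  - apply smooth_mult; auto using smooth_px, smooth_mult, smooth_const, smooth_mult_abs.
  - apply smooth_mult; auto using smooth_py, smooth_mult, smooth_const, smooth_mult_abs.
Qed.

(** The function max(s, 0)^3, in a form that shows its two continuous derivatives. *)
Definition ramp (s : R) : R := / 2 * (s ^ 3 + s * (s * Rabs s)).

Lemma ramp_neg s : s <= 0 -> ramp s = 0.
Proof. intros H. unfold ramp. rewrite Rabs_left1 by exact H. ring. Qed.

Lemma ramp_pos s : 0 <= s -> ramp s = s ^ 3.
Proof. intros H. unfold ramp. rewrite Rabs_right by lra. field. Qed.

(** Equal to 0 for |z| <= 1/2 and to 1 on the unit circle. *)
Definition cutoff (x y : R) : R := ramp (4 / 3 * (x ^ 2 + y ^ 2 - / 4)).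

Lemma cutoff_smooth W : open2 W -> smooth 2 W cutoff.
Proof.
  intros HW. unfold cutoff, ramp.
  assert (Hs : smooth 2 W (fun x y => 4 / 3 * (x ^ 2 + y ^ 2 - / 4))).
  { apply smooth_mult; auto using smooth_const. apply smooth_minus; auto using smooth_const.
    apply smooth_plus; auto; apply smooth_pow; auto using smooth_fst, smooth_snd. }
  apply smooth_mult; auto using smooth_const. apply smooth_plus; auto.
  - apply smooth_pow; auto.
  - apply smooth_sqr_abs; auto.
Qed.

Lemma cutoff_range x y : x ^ 2 + y ^ 2 <= 1 -> 0 <= cutoff x y <= 1.
Proof.
  intros H. unfold cutoff. destruct (Rle_dec (4 / 3 * (x ^ 2 + y ^ 2 - / 4)) 0).
  - rewrite ramp_neg by assumption. lra.
  - rewrite ramp_pos by lra. set (s := 4 / 3 * (x ^ 2 + y ^ 2 - / 4)) in *.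
    assert (0 <= s <= 1) by (unfold s in *; lra).
    split; [apply pow_le; lra|]. simpl. nra.
Qed.

(** On the unit circle this is the curve [f] on the clockwise circle of radius [r]; near 0, where
    [f] is singular, it is constant. In the unit disc the height is a convex combination of 1 and
    the height of [f], hence positive. *)
Definition cone (f : C -> vec) (r : R) (z : C) : vec :=
  let c := cutoff (Re z) (Im z) in let q := f (r * Re z, - r * Im z) in
  mkvec (c * cu q) (c * cv q) (1 + c * (cw q - 1)).

Lemma cone_spanning Om X r : bryant_end Om X -> 0 < r -> (forall z, Cmod z < 2 * r -> Om z) ->
  spanning_disk X (fun t => (RtoC r * cis (-1 * t))%C) (cone X r).
Proof.
  intros HB Hr HO. destruct (bryant_end_smooth Om X HB) as (HW & (S1 & S2 & S3) & Hw0).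
  assert (Hpunct : forall x y, Cmod (x, y) < 2 -> x ^ 2 + y ^ 2 <> 0 -> punctured Om (r * x, - r * y)).
  { intros x y Hz H0. split.
    - apply HO. replace ((r * x, - r * y) : C) with (RtoC r * Cconj (x,
      y))%C by (apply injective_projections; simpl; ring).
      rewrite Cmod_mult, Cmod_conj, Cmod_R, Rabs_right by lra. nra.
    - intros E. injection E. intros E1 E2. apply H0.
      assert (x = 0) by nra. assert (y = 0) by nra. subst. ring. }
  split; [|split].
  - exists 2. split; [lra|]. intros [x y] Hz.
    destruct (Rlt_dec (x ^ 2 + y ^ 2) (/ 4)) as [Hs|Hs].
    + assert (Hloc : locally_2d (fun u v => cutoff u v = 0) x y).
      { assert (Hc : continuity_2d_pt (fun x y => x ^ 2 + y ^ 2) x y).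
        { assert (HT : open2 (fun _ _ => True)) by (intros u v _; exists (mkposreal 1 Rlt_0_1); auto).
          apply (smooth_cont 0 (fun _ _ => True)); auto.
          apply smooth_plus; auto; apply smooth_pow; auto using smooth_fst, smooth_snd. }
        assert (He : 0 < / 4 - (x ^ 2 + y ^ 2)) by lra.
        destruct (Hc (mkposreal _ He)) as [d Hd]. exists d. intros u v Hu Hv.
        specialize (Hd u v Hu Hv). simpl pos in Hd. apply Rabs_def2 in Hd. apply ramp_neg. lra. }
      assert (HT : open2 (fun _ _ => True)) by (intros u v _; exists (mkposreal 1 Rlt_0_1); auto).
      assert (K0 : forall c, ex_diff_n (fun _ _ => c) 2 x y) by (intros c;
        apply (smooth_const 2 (fun _ _ => True)); auto).
      assert (Kc : forall f c, (forall u v, cutoff u v = 0 -> f u v = c) -> ex_diff_n f 2 x y).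
      { intros f c Hf. apply ex_diff_n_ext_loc with (fun _ _ => c); [|apply K0].
        destruct Hloc as [d Hd]. exists d. intros u v Hu Hv. symmetry. apply Hf, Hd; assumption. }
      split; [|split].
      * apply (Kc _ 0). intros u v E. unfold cone, cu, mkvec; cbn [Re Im fst snd]. rewrite E. ring.
      * apply (Kc _ 0). intros u v E. unfold cone, cv, mkvec; cbn [Re Im fst snd]. rewrite E. ring.
      * apply (Kc _ 1). intros u v E. unfold cone, cw, mkvec; cbn [Re Im fst snd]. rewrite E. ring.
    + set (W := fun x y => on_plane (punctured Om) (r * x) (- r * y)).
      assert (HW' : open2 W) by (apply open2_scale, HW).
      pose proof (smooth_scale 2 _ _ r (- r) HW S1) as T1.
        pose proof (smooth_scale 2 _ _ r (- r) HW S2) as T2.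
      pose proof (smooth_scale 2 _ _ r (- r) HW S3) as T3. fold W in T1, T2, T3.
      pose proof (cutoff_smooth W HW') as Sc.
      assert (Hxy : W x y) by (apply Hpunct; [exact Hz|lra]).
      split; [|split].
      * apply (smooth_mult 2 W _ _ HW' Sc T1 x y Hxy).
      * apply (smooth_mult 2 W _ _ HW' Sc T2 x y Hxy).
      * apply (smooth_plus 2 W (fun _ _ => 1) _ HW' (smooth_const 2 W 1 HW')
          (smooth_mult 2 W _ _ HW' Sc (smooth_minus 2 W _ (fun _ _ => 1) HW' T3 (smooth_const 2 W 1 HW'))) x
            y Hxy).
  - intros [x y] Hz. unfold cone, cw, mkvec; cbn [Re Im fst snd]. fold (cw (X (r * x, - r * y))).
    assert (Hn : x ^ 2 + y ^ 2 <= 1).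
    { pose proof (Cmod_sqr (x, y)) as E. unfold norm2 in E. cbn [Re Im fst snd] in E. rewrite <- E.
      pose proof (Cmod_ge_0 (x, y)). nra. }
    pose proof (cutoff_range x y Hn) as Hc.
    destruct (Req_dec (cutoff x y) 0) as [E|E]; [rewrite E; lra|].
    assert (Hp : punctured Om (r * x, - r * y)).
    { apply Hpunct; [lra|]. intros E'. apply E, ramp_neg. rewrite E'. lra. }
    destruct HB as (_ & _ & H). destruct (H _ Hp) as (Hw & _). nra.
  - intros t. unfold cone. cbv zeta.
    assert (Ec : cutoff (Re (cis t)) (Im (cis t)) = 1).
    { unfold cutoff, cis; cbn [Re Im fst snd]. pose proof (sin2_cos2 t) as Hs. unfold Rsqr in Hs.
      replace (4 / 3 * (cos t ^ 2 + sin t ^ 2 - / 4)) with 1; [rewrite ramp_pos; [ring|lra]|].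
      replace (cos t ^ 2 + sin t ^ 2) with (sin t * sin t + cos t * cos t) by ring. rewrite Hs. field. }
    rewrite Ec, cis_scaled. unfold cis; cbn [Re Im fst snd].
    replace (-1 * t) with (- t) by ring. rewrite cos_neg, sin_neg.
    replace (- r * sin t) with (r * - sin t) by ring.
    apply vec_eq; unfold mkvec, cu, cv, cw, Re, Im; cbn [fst snd]; ring.
Qed.

Definition clockwise_circle (r t : R) : C := (RtoC r * cis (-1 * t))%C.

Lemma clockwise_velocity r t : plane_velocity (clockwise_circle r) t = (r * sin (-1 * t),
  - (r * cos (-1 * t))).
Proof.
  unfold plane_velocity, clockwise_circle.
  apply injective_projections; cbn [fst snd].
  - apply is_derive_unique. apply (is_derive_ext (fun s => r * cos (-1 * s))).
    { intros s. rewrite cis_scaled. reflexivity. }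
    auto_derive; auto; ring.
  - apply is_derive_unique. apply (is_derive_ext (fun s => r * sin (-1 * s))).
    { intros s. rewrite cis_scaled. reflexivity. }
    auto_derive; auto; ring.
Qed.

Lemma continuous_pair (f g : R -> R) (t : R) : continuous f t -> continuous g t ->
  continuous (fun s => (f s, g s) : C) t.
Proof.
  intros Hf Hg P [e He].
  assert (B1 : locally t (fun s => ball (f t) e (f s))) by (apply Hf; exists e; auto).
  assert (B2 : locally t (fun s => ball (g t) e (g s))) by (apply Hg; exists e; auto).
  change (locally t (fun s => P (f s, g s))).
  generalize (filter_and _ _ B1 B2). apply filter_imp. intros s [K1 K2]. apply He. split; assumption.
Qed.

Lemma clockwise_C1 r : C1_loop (clockwise_circle r).
Proof.
  intros t. split.
  - exists ((r * sin (-1 * t))%R, (- (r * cos (-1 * t)))%R).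
    apply (filterdiff_ext (K:=R_AbsRing) (fun s => ((r * cos (-1 * s))%R, (r * sin (-1 * s))%R))).
    { intros s. unfold clockwise_circle. rewrite cis_scaled. reflexivity. }
    apply (filterdiff_ext_lin (K:=R_AbsRing) (U:=R_NormedModule) (V:=R2) _ (fun y => (scal y (r * sin (-1 *
      t)), scal y (- (r * cos (-1 * t)))))); [|reflexivity].
    apply (filterdiff_comp'_2 (K:=R_AbsRing) (T:=R_NormedModule) (U:=R_NormedModule) (V:=R_NormedModule)
      (W:=R2)
      (fun s => r * cos (-1 * s)) (fun s => r * sin (-1 * s)) (fun a b => (a, b)) t).
    + change (is_derive (fun s => r * cos (-1 * s)) t (r * sin (-1 * t))). auto_derive; auto; ring.
    + change (is_derive (fun s => r * sin (-1 * s)) t (- (r * cos (-1 * t)))). auto_derive; auto; ring.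
    + apply (filterdiff_ext (fun z => z)); [intros [a b]; reflexivity|].
      apply (filterdiff_ext_lin (K:=R_AbsRing) _ (fun z => z)); [apply filterdiff_id|intros [a b];
        reflexivity].
  - apply (continuous_ext (fun s => (r * sin (-1 * s), - (r * cos (-1 * s))) : C)).
    { intros s. rewrite clockwise_velocity. reflexivity. }
    apply continuous_pair.
    + apply (is_derive_continuous _ t (- (r * cos (-1 * t)))). auto_derive; auto; ring.
    + apply (is_derive_continuous _ t (- (r * sin (-1 * t)))). auto_derive; auto; ring.
Qed.

Lemma bryant_end_disc Om X : bryant_end Om X -> exists r, 0 < r /\ forall z, Cmod z < 2 * r -> Om z.
Proof.
  intros (HO & H0 & _). destruct (HO _ H0) as [d Hd]. exists (d / 2). pose proof (cond_pos d). split; [lra|].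
  intros [x y] Hz. apply Hd. destruct (Cmod_ge_abs x y) as [G1 G2]. split.
  - change (Rabs (x - 0) < d). rewrite Rminus_0_r. lra.
  - change (Rabs (y - 0) < d). rewrite Rminus_0_r. lra.
Qed.

(** By conformality the conormal is the image of the inner normal of the circle, scaled by the
    conformal factor. *)
Lemma end_generator_exists Om X r : bryant_end Om X -> 0 < r -> (forall z, Cmod z < 2 * r -> Om z) ->
  exists xi, end_generator Om X (clockwise_circle r) xi.
Proof.
  intros HB Hr HO.
  assert (Hdisc : disc_in Om r) by (split; [exact Hr|intros z Hz; apply HO; lra]).
  assert (Hpt : forall t, punctured Om (clockwise_circle r t)).
  { intros t. unfold clockwise_circle. rewrite cis_scaled. apply (polar_punctured Om r r _ Hdisc). lra. }
  assert (Hloop : loop_in (punctured Om) (clockwise_circle r)).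
  { intros t. split; [|split; [|apply Hpt]].
    - apply (continuous_ext (fun s => (r * cos (-1 * s), r * sin (-1 * s)) : C)).
      { intros s. unfold clockwise_circle. rewrite cis_scaled. reflexivity. }
      apply continuous_pair.
      + apply (is_derive_continuous _ t (r * sin (-1 * t))). auto_derive; auto; ring.
      + apply (is_derive_continuous _ t (- (r * cos (-1 * t)))). auto_derive; auto; ring.
    - unfold clockwise_circle. f_equal. unfold cis.
      replace (-1 * (t + 2 * PI)) with (- (t + 2 * PI)) by ring. replace (-1 * t) with (- t) by ring.
      rewrite !cos_neg, !sin_neg, cos_plus, sin_plus, cos_2PI, sin_2PI. f_equal; ring. }
  exists (fun t => (RtoC (- (cw (X (clockwise_circle r t)) / sqrt (dot (dx X (clockwise_circle r t)) (dx X
    (clockwise_circle r t))))) * cis (-1 * t))%C).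
  split; [exact Hloop|split].
  - intros t. destruct (clockwise_C1 r t) as [K1 K2]. split; [exact K1|split; [exact K2|]].
    rewrite clockwise_velocity. intros E. injection E. intros E1 E2.
    pose proof (sin2_cos2 (-1 * t)) as Hs. unfold Rsqr in Hs.
    assert (sin (-1 * t) = 0) by nra. assert (cos (-1 * t) = 0) by nra. nra.
  - exists (-1), r. split; [auto|split; [exact Hr|split; [apply Hdisc|split]]].
    + exists (fun _ t => clockwise_circle r t). split; [|split; [|split; reflexivity]].
      * intros q. apply (continuous_comp (fun q : R * R => snd q) (clockwise_circle r));
        [apply continuous_snd|]. apply Hloop.
      * intros s _ t. split; apply Hloop.
    + intros t. cbv zeta. rewrite (surface_velocity Om X _ HB Hloop (clockwise_C1 r)).
      set (g := clockwise_circle r t) in *. set (m := cw (X g) / sqrt _).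
      assert (E : (Re g, Im g) = g) by (destruct g; reflexivity).
      assert (Hg : on_plane (punctured Om) (Re g) (Im g)) by (unfold on_plane; rewrite E; apply Hpt).
      destruct (bryant_end_conformal Om X _ _ HB Hg) as [HE HF]. rewrite E in HE, HF.
      destruct HB as (_ & _ & H). destruct (H g (Hpt t)) as (Hw & _ & Hn & _ & _ & _ & Hdet). clear H.
      pose proof (cross_nonzero_norm _ _ Hn) as Hp. rewrite (conformal_cross_norm _ _ HE HF) in Hp.
      assert (Hl : 0 < dot (dx X g) (dx X g)).
      { assert (0 <= dot (dx X g) (dx X g)) by (unfold dot; nra).
        destruct (Req_dec (dot (dx X g) (dx X g)) 0) as [E0|E0]; [rewrite E0 in Hp; lra|lra]. }
      assert (Hsq : 0 < sqrt (dot (dx X g) (dx X g))) by (apply sqrt_lt_R0, Hl).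
      assert (Hsq2 : sqrt (dot (dx X g) (dx X g)) * sqrt (dot (dx X g) (dx X g)) = dot (dx X g) (dx X g)) by
        (apply sqrt_sqrt; lra).
      assert (Hm : 0 < m) by (apply Rdiv_lt_0_compat; assumption).
      assert (Hm2 : m * m * dot (dx X g) (dx X g) = cw (X g) ^ 2).
      { rewrite <- Hsq2. unfold m. field. lra. }
      rewrite clockwise_velocity, cis_scaled. unfold pushforward, plane_det. cbn [Re Im fst snd].
      pose proof (sin2_cos2 (-1 * t)) as Hs. unfold Rsqr in Hs.
      set (co := cos (-1 * t)) in *. set (si := sin (-1 * t)) in *.
      assert (Hpd : r * si * (- m * si) - - (r * co) * (- m * co) = - (r * m)).
      { transitivity (- (r * m) * (si * si + co * co)); [ring|rewrite Hs; ring]. }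
      unfold hdot. rewrite !(dot_conformal_frame _ _ _ _ _ _ HE HF). split; [|split; [|split]].
      * replace (- m * co * (- m * co) + - m * si * (- m * si)) with (m * m * (si * si + co * co)) by ring.
        rewrite Hs, Rmult_1_r, Rmult_comm, Hm2. field. apply Rgt_not_eq, Hw.
      * replace (- m * co * (r * si) + - m * si * - (r * co)) with 0 by ring. unfold Rdiv; ring.
      * rewrite Hpd. nra.
      * rewrite det3_change_basis, Hpd. assert (0 < r * m) by nra. nra.
Qed.

(** * The flux polynomial *)

(** Only the values of the field on the open half-space enter the flux. *)
Lemma is_flux_killing Om X Y t0 t1 t2 (J : R) : bryant_end Om X ->
  (forall q, 0 < cw q -> Y q = killing t0 t1 t2 q) ->
  (forall r, disc_in Om r -> is_RInt (circle_form (im_density X t0 t1 t2)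
      (re_density X t0 t1 t2) r) 0 (2 * PI) J) ->
  is_flux Om X Y (- (2 * J)).
Proof.
  intros HB HY HJ. split.
  - destruct (bryant_end_disc Om X HB) as (r & Hr & HO).
    destruct (end_generator_exists Om X r HB Hr HO) as [xi Hxi].
    exists (clockwise_circle r), xi, (cone X r). split; [exact Hxi|]. apply (cone_spanning Om); assumption.
  - intros g xi k Hg Hk. rewrite <- (killing_flux Om X t0 t1 t2 J HB HJ g xi k Hg Hk). f_equal; [|f_equal].
    + unfold conormal_flux. apply RInt_ext. intros t _. cbv zeta. rewrite HY; [reflexivity|].
      destruct Hg as (Hloop & _). destruct HB as (_ & _ & H). destruct (Hloop t) as (_ & _ & K).
        apply (H _ K).
    + unfold disk_flux. pose proof PI_RGT_0. apply RInt_ext. intros r Hr.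
      rewrite Rmin_left, Rmax_right in Hr by lra.
      apply RInt_ext. intros t _. cbv zeta. rewrite HY; [reflexivity|].
      destruct Hk as (_ & Hw & _). apply Hw. rewrite cis_scaled, Cmod_polar; lra.
Qed.

Lemma is_flux_unique Om X Y f1 f2 : is_flux Om X Y f1 -> is_flux Om X Y f2 -> f1 = f2.
Proof.
  intros [(g & xi & k & Hg & Hk) H1] [_ H2]. rewrite <- (H1 g xi k Hg Hk). apply H2; assumption.
Qed.

Definition has_circle_integral (f : C -> C) (r : R) (I : C) : Prop :=
  is_RInt (circle_form (fun x y => Re (f (x, y))) (fun x y => - Im (f (x, y))) r) 0 (2 * PI) (Re I) /\
  is_RInt (circle_form (fun x y => Im (f (x, y))) (fun x y => Re (f (x, y))) r) 0 (2 * PI) (Im I).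

Lemma has_circle_integral_plus f g r I J : has_circle_integral f r I -> has_circle_integral g r J ->
  has_circle_integral (fun z => f z + g z)%C r (I + J)%C.
Proof.
  intros [F1 F2] [G1 G2]. split.
  - eapply is_RInt_ext; [|exact (is_RInt_plus (V:=R_NormedModule) _ _ _ _ _ _ F1 G1)].
    intros t _. unfold circle_form, form_along, plus; simpl. unfold Re, Im. ring.
  - eapply is_RInt_ext; [|exact (is_RInt_plus (V:=R_NormedModule) _ _ _ _ _ _ F2 G2)].
    intros t _. unfold circle_form, form_along, plus; simpl. unfold Re, Im. ring.
Qed.

Lemma has_circle_integral_scal f r I c : has_circle_integral f r I ->
  has_circle_integral (fun z => c * f z)%C r (c * I)%C.
Proof.
  intros [F1 F2]. destruct c as [c1 c2]. split.
  - eapply is_RInt_ext; [|exact (is_RInt_minus (V:=R_NormedModule) _ _ _ _ _ _ (is_RInt_scal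
    (V:=R_NormedModule) _ _ _ c1 _ F1) (is_RInt_scal (V:=R_NormedModule) _ _ _ c2 _ F2))].
    intros t _. unfold circle_form, form_along, minus, plus, opp, scal; simpl. unfold mult; simpl.
      unfold Re, Im. ring.
  - eapply is_RInt_ext; [|exact (is_RInt_plus (V:=R_NormedModule) _ _ _ _ _ _ (is_RInt_scal
    (V:=R_NormedModule) _ _ _ c1 _ F2) (is_RInt_scal (V:=R_NormedModule) _ _ _ c2 _ F1))].
    intros t _. unfold circle_form, form_along, minus, plus, opp, scal; simpl. unfold mult; simpl.
      unfold Re, Im. ring.
Qed.

(** The three polynomials are those whose densities are the forms of a Bryant representation. *)
Lemma surface_density_linear X t0 t1 t2 z :
  (surface_density X t0 t1 t2 z = - t0 * surface_density X (- RtoC 1) (RtoC 0) (RtoC 0) z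
    + (t1 * surface_density X (RtoC 0) (RtoC 1) (RtoC 0) z + - t2 * surface_density X (RtoC 0) (RtoC 0) (-
      RtoC 1) z))%C.
Proof. unfold surface_density, density, quad, quad'. ring. Qed.

Lemma surface_density_circle_integral Om X t0 t1 t2 : bryant_end Om X ->
  exists I, forall r, disc_in Om r -> has_circle_integral (surface_density X t0 t1 t2) r I.
Proof.
  intros HB. destruct (bryant_end_disc Om X HB) as (r & Hr & HO).
  assert (HD : disc_in Om r) by (split; [exact Hr|intros z Hz; apply HO; lra]).
  destruct (circle_integral_constant Om _ _ r (surface_density_closed_re Om X t0 t1 t2 HB) HD) as [J HJ].
  destruct (circle_integral_constant Om _ _ r (surface_density_closed_im Om X t0 t1 t2 HB) HD) as [K HK].
  exists (J, K). intros r' Hr'. split; [apply HJ, Hr'|apply HK, Hr'].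
Qed.

Lemma surface_density_residue Om X t0 t1 t2 I : bryant_end Om X ->
  (forall r, disc_in Om r -> has_circle_integral (surface_density X t0 t1 t2) r I) ->
  is_residue (surface_density X t0 t1 t2) (I / (RtoC 2 * RtoC PI * Ci))%C.
Proof.
  intros HB HI. destruct (bryant_end_disc Om X HB) as (r0 & Hr0 & HO). exists r0. split; [exact Hr0|].
  intros r Hr. destruct (HI r) as [H1 H2]. { split; [lra|intros z Hz; apply HO; lra]. }
  rewrite (circle_integral_components _ _ _ _ H1 H2). destruct I; reflexivity.
Qed.

(** Sums over the additive monoid of complex numbers state their equations in its carrier, which
    hides the ring structure. *)
Ltac ring_in_C := match goal with |- ?a = ?b => change (@eq C a b); ring end.

Lemma sum_n_Cmod_le (a : nat -> C) n t : 1 <= t ->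
  Cmod (sum_n (fun i => a i * RtoC t ^ i)%C n) <= sum_n (fun i => Cmod (a i)) n * t ^ n.
Proof.
  intros Ht. induction n as [|n IH].
  - rewrite !sum_O. simpl. rewrite Cmult_1_r. lra.
  - rewrite !sum_Sn. change plus with Cplus at 1. eapply Rle_trans; [apply Cmod_triangle|].
    rewrite Cmod_mult, Cmod_pow, Cmod_R, Rabs_right by lra.
    change plus with Rplus. simpl (t ^ S n).
    assert (0 < t ^ n) by (apply pow_lt; lra).
    assert (0 <= sum_n (fun i => Cmod (a i)) n).
    { clear. induction n; [rewrite sum_O; apply Cmod_ge_0|rewrite sum_Sn; change plus with Rplus;
      pose proof (Cmod_ge_0 (a (S n))); simpl in *; lra]. }
    assert (t ^ n <= t * t ^ n) by nra. nra.
Qed.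

(** By descending induction on the degree: the leading coefficient is bounded by a constant
    divided by t, for all large real t. *)
Lemma polynomial_zero (a : nat -> C) T n : (forall t,
  T < t -> sum_n (fun i => a i * RtoC t ^ i)%C n = RtoC 0) ->
  forall i, (i <= n)%nat -> a i = RtoC 0.
Proof.
  induction n as [|n IH]; intros H i Hi.
  - replace i with O by lia. specialize (H (T + 1)). rewrite sum_O in H. simpl in H. rewrite Cmult_1_r in H.
    apply H. lra.
  - assert (Hn : a (S n) = RtoC 0).
    { destruct (Ceq_dec (a (S n)) (RtoC 0)) as [E|E]; [exact E|exfalso]. apply Cmod_gt_0 in E.
      set (M := sum_n (fun i => Cmod (a i)) n).
      (* Beyond M / |a_(n+1)| the leading term outweighs the others. *)
      set (t := Rmax (T + 1) (Rmax 1 (M / Cmod (a (S n)) + 1))).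
      assert (H1 : T + 1 <= t) by apply Rmax_l.
      assert (H2 : 1 <= t) by (eapply Rle_trans; [apply Rmax_l|apply Rmax_r]).
      assert (H3 : M / Cmod (a (S n)) + 1 <= t) by (eapply Rle_trans; [apply Rmax_r|apply Rmax_r]).
      specialize (H t). rewrite sum_Sn in H. change plus with Cplus in H.
      assert (K : (a (S n) * RtoC t ^ S n = - sum_n (fun i => a i * RtoC t ^ i) n)%C).
      { assert (H' := H ltac:(lra)).
        transitivity ((sum_n (fun i => a i * RtoC t ^ i) n + a (S n) * RtoC t ^ S n) - sum_n (fun i => a i *
          RtoC t ^ i) n)%C; [ring|].
        rewrite H'. ring. }
      apply (f_equal Cmod) in K. rewrite Cmod_opp, Cmod_mult, Cmod_pow, Cmod_R, Rabs_right in K by lra.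
      pose proof (sum_n_Cmod_le a n t H2) as Hb. fold M in Hb. rewrite <- K in Hb. simpl in Hb.
      assert (Htn : 0 < t ^ n) by (apply pow_lt; lra).
      assert (Hb' : Cmod (a (S n)) * t <= M).
      { apply Rmult_le_reg_r with (t ^ n); [exact Htn|]. lra. }
      assert (Cmod (a (S n)) * (M / Cmod (a (S n)) + 1) <= Cmod (a (S n)) * t) by (apply Rmult_le_compat_l;
        lra).
      replace (Cmod (a (S n)) * (M / Cmod (a (S n)) + 1)) with (M + Cmod (a (S n))) in H0 by (field; lra).
        lra. }
    destruct (Nat.eq_dec i (S n)) as [->|Hne]; [exact Hn|]. apply IH; [|lia].
    intros t Ht. specialize (H t Ht). rewrite sum_Sn, Hn in H. change plus with Cplus in H.
      rewrite Cmult_0_l, Cplus_0_r in H. exact H.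
Qed.

Lemma sum_n_C_extend (f : nat -> C) n m : (n <= m)%nat -> (forall i,
  (n < i)%nat -> f i = RtoC 0) -> sum_n f m = sum_n f n.
Proof.
  intros Hnm H. induction Hnm as [|m Hnm IH]; [reflexivity|].
  rewrite sum_Sn, IH, H by lia. change plus with Cplus. apply Cplus_0_r.
Qed.

Lemma eval_extend n m P x y : supported n P -> (n <= m)%nat -> eval m P x y = eval n P x y.
Proof.
  intros HP Hnm. unfold eval.
  rewrite (sum_n_C_extend (fun i => sum_n (fun j => P i j * x ^ i * y ^ j)%C m) n m Hnm).
  - apply sum_n_ext. intros i. apply (sum_n_C_extend (fun j => P i j * x ^ i * y ^ j)%C n m Hnm).
    intros j Hj. rewrite HP by auto. ring_in_C.
  - intros i Hi. rewrite (sum_n_ext _ (fun _ => RtoC 0)).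
    + rewrite (sum_n_C_extend _ 0 m); [apply sum_O|lia|reflexivity].
    + intros j. rewrite HP by auto. ring_in_C.
Qed.

Lemma sum_n_C_minus (f g : nat -> C) n : (sum_n (fun i => f i - g i) n = sum_n f n - sum_n g n)%C.
Proof.
  induction n as [|n IH]; [rewrite !sum_O; reflexivity|]. rewrite !sum_Sn, IH. change plus with Cplus.
    ring_in_C.
Qed.

Lemma sum_n_C_mult_r (f : nat -> C) c n : (sum_n (fun i => f i * c) n = sum_n f n * c)%C.
Proof.
  induction n as [|n IH]; [rewrite !sum_O; reflexivity|]. rewrite !sum_Sn, IH. change plus with Cplus.
    ring_in_C.
Qed.

(** For fixed d the difference is a polynomial in c vanishing for all large real c, so its
    coefficients, which are polynomials in d, vanish for all d. *)
Lemma eval_off_diagonal_injective n m P Q : supported n P -> supported m Q ->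
  (forall c d, c <> d -> eval n P c d = eval m Q c d) -> P = Q.
Proof.
  intros HP HQ H. set (N := Nat.max n m).
  assert (HD : forall i d, (i <= N)%nat -> sum_n (fun j => (P i j - Q i j) * d ^ j)%C N = RtoC 0).
  { intros i d Hi. apply (polynomial_zero (fun i => sum_n (fun j => (P i j - Q i j) * d ^ j)%C N) (Cmod d)
    N); [|exact Hi].
    clear i Hi. intros t Ht. pose proof (Cmod_ge_0 d).
    assert (Ht0 : 0 < t) by lra.
    assert (Hne : RtoC t <> d). { intros E. rewrite <- E, Cmod_R, Rabs_right in Ht by lra. lra. }
    specialize (H _ _ Hne). rewrite <- (eval_extend n N P),
      <- (eval_extend m N Q) in H by (assumption || (unfold N; lia)).
    transitivity (eval N P (RtoC t) d - eval N Q (RtoC t) d)%C; [|rewrite H; ring_in_C].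
    unfold eval. rewrite <- sum_n_C_minus. apply sum_n_ext. intros i.
    rewrite <- sum_n_C_minus, <- sum_n_C_mult_r. apply sum_n_ext. intros j. ring_in_C. }
  apply functional_extensionality. intros i. apply functional_extensionality. intros j.
  destruct (Compare_dec.le_lt_dec i N) as [Hi|Hi]; [destruct (Compare_dec.le_lt_dec j N) as [Hj|Hj]|].
  - assert (E : (P i j - Q i j)%C = RtoC 0).
    { apply (polynomial_zero (fun j => P i j - Q i j)%C 0 N); [|exact Hj]. intros t _. apply HD, Hi. }
    replace (P i j) with (P i j - Q i j + Q i j)%C by ring. rewrite E. ring.
  - rewrite (HP i j), (HQ i j) by (right; unfold N in Hj; lia). reflexivity.
  - rewrite (HP i j), (HQ i j) by (left; unfold N in Hi; lia). reflexivity.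
Qed.

Lemma eval_biaffine f0 f1 f2 x y :
  eval 1 (symmetric_biaffine f0 f1 f2) x y = (f2 * x * y + f1 * (x + y) + f0)%C.
Proof.
  unfold eval. rewrite sum_Sn, !sum_O, !sum_Sn, !sum_O. simpl. change plus with Cplus. ring_in_C.
Qed.

(** The sign [s] covers both orders of the difference in the denominator. *)
Lemma filterlim_Cinfinity (g : C -> C) (q K d : C) (s : R) : s = 1 \/ s = -1 ->
  (forall z, z <> d -> g z = q + K / (RtoC s * (z - d)))%C -> filterlim g Cinfinity (locally q).
Proof.
  intros Hs Hg P [eps HP]. pose proof (cond_pos eps). pose proof (Cmod_ge_0 K).
  exists (Cmod d + Cmod K / eps). intros z Hz.
  assert (HKe : 0 <= Cmod K / eps) by (apply Rmult_le_pos; [assumption|left; apply Rinv_0_lt_compat;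
    assumption]).
  assert (Ht : Cmod z <= Cmod (z - d) + Cmod d).
  { replace z with ((z - d) + d)%C at 1 by ring. apply Cmod_triangle. }
  assert (Hzd : Cmod K / eps < Cmod (z - d)) by lra.
  assert (Hne : z <> d). { intros ->. replace (d - d)%C with (RtoC 0) in Hzd by ring. rewrite Cmod_0 in Hzd.
    lra. }
  apply HP. rewrite Hg by exact Hne.
  assert (Hpos : 0 < Cmod (z - d)) by lra.
  assert (Hs0 : RtoC s <> RtoC 0) by (intros E; apply RtoC_inj in E; lra).
  assert (Hz0 : (z - d)%C <> RtoC 0) by (apply Cmod_gt_0, Hpos).
  assert (Hc : Cmod (K / (RtoC s * (z - d)))%C < eps).
  { rewrite Cmod_div by (apply Cmult_neq_0; assumption). rewrite Cmod_mult, Cmod_R.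
    replace (Rabs s) with 1 by (destruct Hs as [->| ->]; [rewrite Rabs_R1|rewrite Rabs_left; lra];
      reflexivity || lra).
    apply Rmult_lt_reg_r with (Cmod (z - d)); [exact Hpos|].
    replace (Cmod K / (1 * Cmod (z - d)) * Cmod (z - d)) with (Cmod K) by (field; lra).
    apply (Rmult_lt_compat_r eps) in Hzd; [|assumption].
      replace (Cmod K / eps * eps) with (Cmod K) in Hzd by (field; lra). lra. }
  set (e := (K / (RtoC s * (z - d)))%C) in *. destruct e as [e1 e2]. destruct q as [q1 q2].
    destruct (Cmod_ge_abs e1 e2) as [G1 G2].
  split.
  - change (Rabs (q1 + e1 - q1) < eps). replace (q1 + e1 - q1) with e1 by ring. lra.
  - change (Rabs (q2 + e2 - q2) < eps). replace (q2 + e2 - q2) with e2 by ring. lra.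
Qed.

(** The quotient P(c, d)/(c - d) in homogeneous form: c and d are the images of 0 and infinity
    under [g], which makes the value meaningful when one of them is infinite. *)
Definition flux_value (f0 f1 f2 : C) (g : mat2) : C :=
  (- (f2 * (m11 g * m12 g) + f1 * (m11 g * m22 g + m12 g * m21 g) + f0 * (m21 g * m22 g)) / det2 g)%C.

Lemma to_geodesic_invertible c d : c <> d -> det2 (to_geodesic c d) <> RtoC 0.
Proof.
  intros Hne. destruct c as [c|], d as [d|]; unfold det2, to_geodesic; cbn [m11 m12 m21 m22]; intros E.
  - apply Hne. f_equal. replace d with ((d * RtoC 1 - c * RtoC 1) + c)%C by ring. rewrite E. ring.
  - apply (f_equal Re) in E. destruct c. simpl in E. lra.
  - apply (f_equal Re) in E. destruct d. simpl in E. lra.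
  - apply Hne. reflexivity.
Qed.

Lemma biaffine_quotient f0 f1 f2 c d : c <> d ->
  is_quotient (eval 1 (symmetric_biaffine f0 f1 f2)) c d (flux_value f0 f1 f2 (to_geodesic c d)).
Proof.
  intros Hne. pose proof (to_geodesic_invertible c d Hne) as Hdet.
  assert (H1 : RtoC 1 <> RtoC 0) by (intros E; apply RtoC_inj in E; lra).
  assert (Hsub : forall z w : C, z <> w -> (z - w)%C <> RtoC 0).
  { intros z w Hzw E. apply Hzw. replace z with (z - w + w)%C by ring. rewrite E. ring. }
  destruct c as [c|], d as [d|]; unfold is_quotient, flux_value, det2, to_geodesic; cbn [m11 m12 m21 m22].
  - rewrite eval_biaffine. assert (c <> d) by congruence. field. split.
    + apply Hsub; assumption.
    + apply Hsub. congruence.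
  - apply (filterlim_Cinfinity _ _ (f2 * c * c + RtoC 2 * f1 * c + f0)%C c (-1)); [auto|].
    intros z Hz. rewrite eval_biaffine.
    replace (RtoC (-1)) with (- RtoC 1)%C by (apply injective_projections; simpl; ring).
    replace (RtoC 2) with (RtoC 1 + RtoC 1)%C by (apply injective_projections; simpl; ring). field.
    assert (Hz' := Hsub _ _ Hz). assert (Hz'' := Hsub c z ltac:(congruence)).
    repeat split; try assumption.
    all: try (intros E; apply (f_equal Re) in E; simpl in E; lra).
  - apply (filterlim_Cinfinity _ _ (f2 * d * d + RtoC 2 * f1 * d + f0)%C d 1); [auto|].
    intros z Hz. rewrite eval_biaffine.
    replace (RtoC 2) with (RtoC 1 + RtoC 1)%C by (apply injective_projections; simpl; ring). field.
    assert (Hz' := Hsub _ _ Hz). assert (Hz'' := Hsub d z ltac:(congruence)).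
    repeat split; try assumption.
    all: try (intros E; apply (f_equal Re) in E; simpl in E; lra).
  - congruence.
Qed.

Theorem theorem3 :
  forall (Om : C -> Prop) (X : C -> vec)
         (U : C -> Prop) (p : C -> C) (A B C' D : C -> C),
  bryant_end Om X ->
  universal_cover U p (punctured Om) ->
  bryant_representation U p X A B C' D ->
  exists P : nat -> nat -> C,
    unique (is_flux_polynomial Om X) P /\
    (forall i j, P i j = P j i) /\
    exists rho0 rho1 rho2 : C,
      form_residue Om U p
        (fun s => D s * C_derive C' s - C' s * C_derive D s)%C rho0 /\
      form_residue Om U p
        (fun s => C' s * C_derive B s - D s * C_derive A s)%C rho1 /\
      form_residue Om U p
        (fun s => B s * C_derive A s - A s * C_derive B s)%C rho2 /\
      let phi0 := (RtoC 4 * RtoC PI * rho0)%C in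
      let phi1 := (RtoC 4 * RtoC PI * rho1)%C in
      let phi2 := (RtoC 4 * RtoC PI * rho2)%C in
      P = symmetric_biaffine phi0 phi1 phi2 /\
      (forall x : C,
         eval 1 P x x = (phi2 * x ^ 2 + RtoC 2 * phi1 * x + phi0)%C).
Proof.
  intros Om X U p A B C' D HB (HU & _ & Hp & Hpu & _) Hrep.
  destruct (surface_density_circle_integral Om X (RtoC 0) (RtoC 0) (- RtoC 1)%C HB) as [I0 HI0].
  destruct (surface_density_circle_integral Om X (RtoC 0) (RtoC 1) (RtoC 0) HB) as [I1 HI1].
  destruct (surface_density_circle_integral Om X (- RtoC 1)%C (RtoC 0) (RtoC 0) HB) as [I2 HI2].
  set (rho := fun I => (I / (RtoC 2 * RtoC PI * Ci))%C).
  set (phi := fun I => (RtoC 4 * RtoC PI * rho I)%C).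
  assert (HPI : RtoC PI <> RtoC 0) by (intros E; apply RtoC_inj in E; pose proof PI_RGT_0; lra).
  (* 4 pi / (2 pi i) = - 2 i. *)
  assert (Hphi : forall I, phi I = (- (RtoC 2 * Ci) * I)%C).
  { intros I. unfold phi, rho. assert (HCi : (Ci * Ci = - RtoC 1)%C) by (apply injective_projections; simpl;
    ring).
    assert (HCi0 : Ci <> RtoC 0) by (intros E; apply (f_equal Im) in E; simpl in E; lra).
    assert (H2 : RtoC 2 <> RtoC 0) by (intros E; apply RtoC_inj in E; lra).
    replace (RtoC 4) with (RtoC 2 * RtoC 2)%C by (apply injective_projections; simpl; ring).
    transitivity (- (RtoC 2 * (Ci * Ci) * I / Ci))%C; [rewrite HCi; field; auto|field; auto]. }
  assert (Hflux : forall Y t0 t1 t2, (forall q, 0 < cw q -> Y q = killing t0 t1 t2 q) ->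
     is_flux Om X Y (Re (t0 * phi I2 - t1 * phi I1 + t2 * phi I0)%C)).
  { intros Y t0 t1 t2 HY.
    set (J := (- t0 * I2 + (t1 * I1 + - t2 * I0))%C).
    replace (Re (t0 * phi I2 - t1 * phi I1 + t2 * phi I0)%C) with (- (2 * Im J)).
    2:{ rewrite !Hphi. unfold J. destruct t0, t1, t2, I0, I1, I2. simpl. ring. }
    apply (is_flux_killing Om X Y t0 t1 t2); auto. intros r Hr.
    pose proof (has_circle_integral_plus _ _ _ _ _ (has_circle_integral_scal _ _ _ (- t0)%C (HI2 r Hr))
       (has_circle_integral_plus _ _ _ _ _ (has_circle_integral_scal _ _ _ t1 (HI1 r Hr))
         (has_circle_integral_scal _ _ _ (- t2)%C (HI0 r Hr)))) as [_ K].
    eapply is_RInt_ext; [|exact K]. intros t _. cbv beta.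
    unfold circle_form, form_along. rewrite <- surface_density_linear. reflexivity. }
  assert (Hgeo : forall Y g k, det2 g <> RtoC 0 -> (forall q, 0 < cw q -> Y q = geodesic_field g k q) ->
     is_flux Om X Y (Re (k * flux_value (phi I0) (phi I1) (phi I2) g)%C)).
  { intros Y g k Hg HY. pose proof (Hflux Y _ _ _ HY) as K.
    match type of K with is_flux _ _ _ (Re ?z) =>
      replace (k * flux_value (phi I0) (phi I1) (phi I2) g)%C with z; [exact K|] end.
    unfold flux_value. field. exact Hg. }
  set (P := symmetric_biaffine (phi I0) (phi I1) (phi I2)).
  assert (HP : is_flux_polynomial Om X P).
  { exists 1%nat. split.
    - intros i j Hij. unfold P. destruct i as [|[|i]], j as [|[|j]]; try reflexivity; lia.
    - intros c d Hne. pose proof (to_geodesic_invertible c d Hne) as Hdet.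
      set (q := flux_value (phi I0) (phi I1) (phi I2) (to_geodesic c d)).
      exists q. split; [apply biaffine_quotient, Hne|]. split.
      + replace q with (RtoC 1 * q)%C by ring.
        apply (Hgeo _ (to_geodesic c d)); [exact Hdet|]. intros; apply translation_killing; assumption.
      + replace (- Im q) with (Re (Ci * q)%C) by (destruct q; simpl; ring).
        apply (Hgeo _ (to_geodesic c d)); [exact Hdet|]. intros; apply rotation_killing; assumption. }
  exists P. split; [split; [exact HP|]|split].
  - intros P' (n' & HS' & H'). destruct HP as (n & HS & H).
    apply (eval_off_diagonal_injective n n'); auto. intros c d Hne.
    assert (HneF : Fin c <> Fin d) by congruence.
    destruct (H (Fin c) (Fin d) HneF) as (q & Eq & F1 & F2).
    destruct (H' (Fin c) (Fin d) HneF) as (q' & Eq' & F1' & F2').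
    assert (E : q = q').
    { apply injective_projections.
      - exact (is_flux_unique _ _ _ _ _ F1 F1').
      - pose proof (is_flux_unique _ _ _ _ _ F2 F2') as K. unfold Im in K. lra. }
    simpl in Eq, Eq'. rewrite Eq, Eq' in E.
    assert (Hcd : (c - d)%C <> RtoC 0).
    { intros E0. apply Hne. replace c with (c - d + d)%C by ring. rewrite E0. ring. }
    apply (Cmult_cancel_r (/ (c - d))%C); [|exact E].
    intros E0. apply (f_equal (fun z => z * (c - d))%C) in E0. rewrite Cinv_l in E0 by exact Hcd.
    rewrite Cmult_0_l in E0. apply RtoC_inj in E0. lra.
  - intros i j. unfold P. destruct i as [|[|i]], j as [|[|j]]; reflexivity.
  - exists (rho I0), (rho I1), (rho I2).
    assert (Hform : forall t0 t1 t2 I omega,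
      (forall r, disc_in Om r -> has_circle_integral (surface_density X t0 t1 t2) r I) ->
      (forall s, omega s = (- t0 * (B s * C_derive A s - A s * C_derive B s)
        + t1 * (C' s * C_derive B s - D s * C_derive A s)
        - t2 * (D s * C_derive C' s - C' s * C_derive D s))%C) -> form_residue Om U p omega (rho I)).
    { intros t0 t1 t2 I omega HI Hom. exists (surface_density X t0 t1 t2).
      split; [apply surface_density_holomorphic, HB|]. split.
      - intros s Hs. rewrite Hom. symmetry. apply (representation_density Om U); assumption.
      - apply surface_density_residue with Om; assumption. }
    split; [|split; [|split]].
    + apply (Hform _ _ _ _ _ HI0). intros s. ring.
    + apply (Hform _ _ _ _ _ HI1). intros s. ring.
    + apply (Hform _ _ _ _ _ HI2). intros s. ring.
    + cbv zeta. split; [reflexivity|]. intros x. unfold P. rewrite eval_biaffine.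
      fold (phi I0) (phi I1) (phi I2).
      replace (RtoC 2) with (RtoC 1 + RtoC 1)%C by (apply injective_projections; simpl; ring). simpl. ring.
Qed.
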